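(* Let $2\le r<\infty$ and $1\le s\le\infty$. Then there exists a constant $C=C(r,s)>0$ such that for every sequence $(J_m)$ of index sets, each of degree at most $m$, and every $n$, $$\boldsymbol{\chi_{\mathrm{mon}}}\big(\mathcal{P}_{J_m}(\ell_{r,s}^n)\big)\le C^m\Big(1+\frac nm\Big)^{\frac{m-1}2}\quad\text{and}\quad\boldsymbol{\lambda}\big(\mathcal{P}_{J_m}(\ell_{r,s}^n)\big)\le C^m\Big(1+\frac nm\Big)^{\frac m2}.$$ Moreover, in each of the cases (A) $2<r<\infty$, $1\le s\le\infty$, or (B) $r=2$, $1\le s\le 2$, these estimates are optimal for all $n$ and all $m$ with $\Lambda_T(m)\subset J_m$: there is $C'=C'(r,s)>0$ such that for all such $n,m$, $\big(1+\frac nm\big)^{\frac{m-1}2}\le C'^m\boldsymbol{\chi_{\mathrm{mon}}}\big(\mathcal{P}_{J_m}(\ell_{r,s}^n)\big)$ and $\big(1+\frac nm\big)^{\frac m2}\le C'^m\boldsymbol{\lambda}\big(\mathcal{P}_{J_m}(\ell_{r,s}^n)\big)$.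
   Context: An index set is a subset of $\mathbb{N}_0^{(\mathbb{N})}$ (finitely supported sequences of nonnegative integers); it has degree at most $m$ if $|\alpha|=\sum\alpha_i\le m$ for all its elements. $\Lambda_T(m)$ is the set of multi-indices with all entries in $\{0,1\}$ and $|\alpha|=m$. $\ell_{r,s}^n$ is $\mathbb{C}^n$ with Lorentz (quasi-)norm $\|z\|_{\ell_{r,s}}=\|(z_k^*k^{1/r-1/s})_k\|_{\ell_s}$. For $X_n=(\mathbb{C}^n,\|\cdot\|)$ and index set $J$, $\mathcal{P}_J(X_n)$ is the space of polynomials $\sum_{\alpha\in J\cap\mathbb{N}_0^n}c_\alpha z^\alpha$ with sup norm over the open unit ball of $X_n$. $\boldsymbol{\lambda}$ denotes the projection constant (sup over isometric embeddings $I:E\to Y$ of the minimal norm of a projection of $Y$ onto $I(E)$), and $\boldsymbol{\chi_{\mathrm{mon}}}$ the unconditional basis constant of the monomial basis $(z^\alpha)$ (least $K$ with $\|\sum\varepsilon_\alpha c_\alpha z^\alpha\|\le K\|\sum c_\alpha z^\alpha\|$ for all $|\varepsilon_\alpha|=1$).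
   Formalization: The optimality part additionally assumes that J_m contains a multi-index supported in the first n variables (the polynomial space is nonzero); otherwise, e.g. n=1, m=2, J_m=Λ_T(2), both constants are 0 and the lower bounds fail; m≥1 throughout. *)

(* Defs.v *)
From Stdlib Require Import Reals List.
From Coquelicot Require Import Coquelicot.
Import ListNotations.
Open Scope R_scope.

Definition multi_index := nat -> nat.

Definition fin_supp (a : multi_index) : Prop :=
  exists N : nat, forall i, (N <= i)%nat -> a i = 0%nat.

Definition psum (a : multi_index) (N : nat) : nat := list_sum (map a (seq 0 N)).

Definition index_set (J : multi_index -> Prop) : Prop := forall a, J a -> fin_supp a.

Definition deg_le (J : multi_index -> Prop) (m : nat) : Prop :=
  forall a, J a -> forall N, (psum a N <= m)%nat.

Definition LambdaT (m : nat) (a : multi_index) : Prop :=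
  (forall i, (a i <= 1)%nat) /\
  exists N, (forall i, (N <= i)%nat -> a i = 0%nat) /\ psum a N = m.

Definition rpow0 (x y : R) : R := if Rle_dec x 0 then 0 else Rpower x y.

Definition rsum (l : list R) : R := fold_right Rplus 0 l.
Fixpoint insert_desc (x : R) (l : list R) : list R :=
  match l with
  | [] => [x]
  | y :: l' => if Rle_dec y x then x :: l else y :: insert_desc x l'
  end.
Definition sort_desc (l : list R) : list R := fold_right insert_desc [] l.

(* vectors of C^n are represented by z : nat -> C (only z 0 .. z (n-1) matter) *)
(* decreasing rearrangement: zstar n z k = z^*_k for 1 <= k <= n *)
Definition zstar (n : nat) (z : nat -> C) (k : nat) : R :=
  nth (k - 1) (sort_desc (map (fun i => Cmod (z i)) (seq 0 n))) 0.

Definition lorentz (r : R) (s : Rbar) (n : nat) (z : nat -> C) : R :=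
  match s with
  | Finite s0 =>
      rpow0 (rsum (map (fun k => rpow0 (zstar n z k * Rpower (INR k) (/ r - / s0)) s0)
                           (seq 1 n))) (/ s0)
  | p_infty => fold_right Rmax 0 (map (fun k => zstar n z k * Rpower (INR k) (/ r)) (seq 1 n))
  | m_infty => 0
  end.

Fixpoint mindices (n m : nat) : list (list nat) :=
  match n with
  | O => [[]]
  | S n' => flat_map (fun e => map (cons e) (mindices n' m)) (seq 0 (S m))
  end.

Definition ext (l : list nat) : multi_index := fun i => nth i l 0%nat.

Definition mono (n : nat) (z : nat -> C) (a : multi_index) : C :=
  fold_right Cmult (RtoC 1) (map (fun i => Cpow (z i) (a i)) (seq 0 n)).

Definition suppJ (J : multi_index -> Prop) (c : multi_index -> C) : Prop :=
  forall a, c a <> RtoC 0 -> J a.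

(* sum_{a in J cap N_0^n} c_a z^a   (for J of degree <= m and c supported in J) *)
Definition peval (n m : nat) (c : multi_index -> C) (z : nat -> C) : C :=
  fold_right Cplus (RtoC 0) (map (fun l => Cmult (c (ext l)) (mono n z (ext l))) (mindices n m)).

Definition supnorm (r : R) (s : Rbar) (n m : nat) (c : multi_index -> C) : R :=
  real (Lub_Rbar (fun t => exists z, lorentz r s n z < 1 /\ t = Cmod (peval n m c z))).

Definition chi_mon (r : R) (s : Rbar) (n m : nat) (J : multi_index -> Prop) : Rbar :=
  Glb_Rbar (fun K => 0 <= K /\
    forall (c eps : multi_index -> C), suppJ J c -> (forall a, Cmod (eps a) = 1) ->
      supnorm r s n m (fun a => Cmult (eps a) (c a)) <= K * supnorm r s n m c).

(* linear isometric embeddings I : P_J(X_n) -> Y, P_J(X_n) given by its coefficients *)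
Definition iso_embed (r : R) (s : Rbar) (n m : nat) (J : multi_index -> Prop)
  (Y : CompleteNormedModule C_AbsRing) (I : (multi_index -> C) -> Y) : Prop :=
  (forall c1 c2, suppJ J c1 -> suppJ J c2 ->
     I (fun a => Cplus (c1 a) (c2 a)) = plus (I c1) (I c2)) /\
  (forall (t : C) c, suppJ J c -> I (fun a => Cmult t (c a)) = scal t (I c)) /\
  (forall c, suppJ J c -> norm (I c) = supnorm r s n m c).

Definition is_proj (J : multi_index -> Prop) (Y : CompleteNormedModule C_AbsRing)
  (I : (multi_index -> C) -> Y) (Q : Y -> Y) : Prop :=
  (forall y1 y2, Q (plus y1 y2) = plus (Q y1) (Q y2)) /\
  (forall (t : C) y, Q (scal t y) = scal t (Q y)) /\
  (forall y, exists c, suppJ J c /\ Q y = I c) /\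
  (forall c, suppJ J c -> Q (I c) = I c).

Definition opnorm (Y : CompleteNormedModule C_AbsRing) (Q : Y -> Y) : Rbar :=
  Glb_Rbar (fun k => 0 <= k /\ forall y, norm (Q y) <= k * norm y).

Definition rel_proj_const (J : multi_index -> Prop) (Y : CompleteNormedModule C_AbsRing)
  (I : (multi_index -> C) -> Y) : Rbar :=
  Glb_Rbar (fun x => exists Q, is_proj J Y I Q /\ opnorm Y Q = Finite x).

Definition proj_const (r : R) (s : Rbar) (n m : nat) (J : multi_index -> Prop) : Rbar :=
  Lub_Rbar (fun x => exists (Y : CompleteNormedModule C_AbsRing) (I : (multi_index -> C) -> Y),
    iso_embed r s n m J Y I /\ rel_proj_const J Y I = Finite x).

(* Main.v *)
(** The upper bound for the projection constant is a Kadets-Snobar argument: an almost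
    determinant-maximising probability on the ball turns the monomials of degree at most [m]
    into an orthogonal system whose reproducing kernel is at most [6 N] on the diagonal, [N]
    being the number of monomials, and [N <= (e (1 + n / m)) ^ m]; Hahn-Banach extends the
    point evaluations to the ambient space.  The upper bound for the unconditional constant
    reduces, by dilation, to the polydisc, where the Euler operators [z_i d/dz_i] and the
    equivalence of the L1 and L2 norms on polynomials of degree [m] save one factor
    [sqrt (1 + n / m)] over Cauchy-Schwarz.

    For the lower bounds, a projection onto [P_J] averaged over the torus sends the Riesz
    product [prod_i (1 + 2 i t Re z_i)], a bounded function on the ball, to the polynomial
    with coefficients [(i t) ^ |a|] on the 0/1 multi-indices [a] of [J], and [t ^ 2 = m / S]
    is the optimal choice when [sum_i |z_i| ^ 2 <= S] on the ball.  For the unconditional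
    constant the test polynomial has signs as coefficients on the 0/1 multi-indices of degree
    [m] and is small by a Kahane-Salem-Zygmund argument. *)

Require Import Defs.
From Stdlib Require Import Reals.
From Coquelicot Require Import Coquelicot.
From mathcomp Require classical_sets.
From Stdlib Require Import List Lra Lia Permutation Sorted Classical ClassicalEpsilon.
From Stdlib Require Import FunctionalExtensionality PropExtensionality ProofIrrelevance ssreflect.
Import ListNotations.
Open Scope R_scope.

(** * Finite sums and products *)

(** All measures are finitely supported. Integrals over the torus are averages over [N]-th roots of
    unity, exact as soon as [N] exceeds the exponents involved, so no integration theory enters.
    Rotation invariance makes the Gram matrix of the monomials diagonal: its determinant is a
    product of moments, and an almost maximising measure replaces the compactness behind an optimal
    one.

    The exponents have two sources. The bound on the number of monomials divisible by a given [z_i]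
    is smaller by a factor [1 + n / m] than the bound on all of them, which turns [m / 2] into
    [(m - 1) / 2]. For the lower bounds, (A) and (B) ensure that [sum_i |z_i| ^ 2] is at most of
    order [n ^ (1 - 2 / r)] on the ball, while the ball contains a constant vector of height of
    order [n ^ (- 1 / r)]: the squared height divided by this bound is of order [1 / n], whatever
    [r] and [s]. For [m <= n] there are at least [(n / m) ^ m] squarefree monomials of degree [m],
    which yields [(n / m) ^ (m / 2)] for the projection constant; the small polynomial with sign
    coefficients loses a further [sqrt n]. All other losses are of the form [C ^ m]. *)

Definition sumR {A} (l : list A) (f : A -> R) : R := fold_right Rplus 0 (map f l).
Definition sumC {A} (l : list A) (f : A -> C) : C := fold_right Cplus (RtoC 0) (map f l).
Definition prodR {A} (l : list A) (f : A -> R) : R := fold_right Rmult 1 (map f l).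
Definition prodC {A} (l : list A) (f : A -> C) : C := fold_right Cmult (RtoC 1) (map f l).

Lemma sumR_cons {A} (x : A) l f : sumR (x :: l) f = f x + sumR l f.
Proof. reflexivity. Qed.
Lemma sumC_cons {A} (x : A) l f : sumC (x :: l) f = Cplus (f x) (sumC l f).
Proof. reflexivity. Qed.
Lemma prodR_cons {A} (x : A) l f : prodR (x :: l) f = f x * prodR l f.
Proof. reflexivity. Qed.
Lemma prodC_cons {A} (x : A) l f : prodC (x :: l) f = Cmult (f x) (prodC l f).
Proof. reflexivity. Qed.

Lemma sumR_ext {A} (l : list A) f g : (forall x, In x l -> f x = g x) -> sumR l f = sumR l g.
Proof. by move=> H; rewrite /sumR (map_ext_in _ _ _ H). Qed.
Lemma sumC_ext {A} (l : list A) f g : (forall x, In x l -> f x = g x) -> sumC l f = sumC l g.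
Proof. by move=> H; rewrite /sumC (map_ext_in _ _ _ H). Qed.
Lemma prodR_ext {A} (l : list A) f g : (forall x, In x l -> f x = g x) -> prodR l f = prodR l g.
Proof. by move=> H; rewrite /prodR (map_ext_in _ _ _ H). Qed.
Lemma prodC_ext {A} (l : list A) f g : (forall x, In x l -> f x = g x) -> prodC l f = prodC l g.
Proof. by move=> H; rewrite /prodC (map_ext_in _ _ _ H). Qed.

Lemma sumR_map {A B} (h : A -> B) l f : sumR (map h l) f = sumR l (fun x => f (h x)).
Proof. by rewrite /sumR map_map. Qed.
Lemma sumC_map {A B} (h : A -> B) l f : sumC (map h l) f = sumC l (fun x => f (h x)).
Proof. by rewrite /sumC map_map. Qed.
Lemma prodR_map {A B} (h : A -> B) l f : prodR (map h l) f = prodR l (fun x => f (h x)).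
Proof. by rewrite /prodR map_map. Qed.
Lemma prodC_map {A B} (h : A -> B) l f : prodC (map h l) f = prodC l (fun x => f (h x)).
Proof. by rewrite /prodC map_map. Qed.

Lemma RtoC_sum {A} (l : list A) f : RtoC (sumR l f) = sumC l (fun x => RtoC (f x)).
Proof. elim: l => [|x l IH] //. by rewrite sumR_cons sumC_cons RtoC_plus IH. Qed.
Lemma RtoC_prod {A} (l : list A) f : RtoC (prodR l f) = prodC l (fun x => RtoC (f x)).
Proof. elim: l => [|x l IH] //. by rewrite prodR_cons prodC_cons RtoC_mult IH. Qed.

Lemma sumR_le {A} (l : list A) f g : (forall x, In x l -> f x <= g x) -> sumR l f <= sumR l g.
Proof.
elim: l => [|x l IH] H; first by apply: Rle_refl.
rewrite !sumR_cons; apply: Rplus_le_compat; first by apply: H; left.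
by apply: IH => y Hy; apply: H; right.
Qed.
Lemma sumR_0 {A} (l : list A) f : (forall x, In x l -> f x = 0) -> sumR l f = 0.
Proof.
elim: l => [|x l IH] H //.
rewrite sumR_cons H; last by left. rewrite IH ?Rplus_0_l // => y Hy; apply: H; by right.
Qed.
Lemma sumR_ge0 {A} (l : list A) f : (forall x, In x l -> 0 <= f x) -> 0 <= sumR l f.
Proof. move=> H. rewrite -(sumR_0 l (fun _ => 0)) //. exact: sumR_le. Qed.
Lemma sumR_plus {A} (l : list A) f g : sumR l (fun x => f x + g x) = sumR l f + sumR l g.
Proof. elim: l => [|x l IH]; last rewrite !sumR_cons IH; rewrite /sumR /=; ring. Qed.
Lemma sumR_scal {A} (l : list A) c f : sumR l (fun x => c * f x) = c * sumR l f.
Proof. elim: l => [|x l IH]; last rewrite !sumR_cons IH; rewrite /sumR /=; ring. Qed.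
Lemma sumR_scal_r {A} (l : list A) c f : sumR l (fun x => f x * c) = sumR l f * c.
Proof. rewrite Rmult_comm -sumR_scal; apply: sumR_ext => x _; ring. Qed.
Lemma sumR_const {A} (l : list A) c : sumR l (fun _ => c) = INR (length l) * c.
Proof.
elim: l => [|x l IH]; first by rewrite /sumR /=; ring.
rewrite sumR_cons IH; change (length (x :: l)) with (S (length l)); rewrite S_INR; ring.
Qed.
Lemma sumR_swap {A B} (l : list A) (k : list B) f :
  sumR l (fun x => sumR k (fun y => f x y)) = sumR k (fun y => sumR l (fun x => f x y)).
Proof.
elim: l => [|x l IH]; first by rewrite [RHS]sumR_0.
by rewrite sumR_cons IH -sumR_plus.
Qed.
Lemma sumR_term_le {A} (l : list A) f x : (forall y, In y l -> 0 <= f y) -> In x l -> f x <= sumR l f.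
Proof.
elim: l => [|y l IH] // H [->|Hx]; rewrite sumR_cons.
- have : 0 <= sumR l f by apply: sumR_ge0 => z Hz; apply: H; right.
  lra.
- have := IH (fun z Hz => H z (or_intror Hz)) Hx. have := H y (or_introl eq_refl). lra.
Qed.
Lemma sumR_app {A} (l k : list A) f : sumR (l ++ k) f = sumR l f + sumR k f.
Proof. elim: l => [|x l IH]; first by rewrite /sumR /=; ring. by rewrite /= !sumR_cons IH; ring. Qed.
Lemma sumR_filter_le {A} (p : A -> bool) (l : list A) f : (forall x, 0 <= f x) -> sumR (filter p l) f <= sumR l f.
Proof.
move=> H; elim: l => [|x l IH]; first exact: Rle_refl. have := H x.
rewrite [filter _ _]/=. case: (p x); rewrite !sumR_cons; lra.
Qed.
Lemma sumR_perm {A} (l k : list A) f : Permutation l k -> sumR l f = sumR k f.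
Proof.
elim => [|x l1 l2 _ IH|x y l1|l1 l2 l3 _ IH1 _ IH2] //; rewrite ?sumR_cons ?IH //; first by ring.
by rewrite IH1.
Qed.

Lemma sumC_0 {A} (l : list A) f : (forall x, In x l -> f x = RtoC 0) -> sumC l f = RtoC 0.
Proof.
elim: l => [|x l IH] H //.
rewrite sumC_cons H; last by left. rewrite IH ?Cplus_0_l // => y Hy; apply: H; by right.
Qed.
Lemma sumC_plus {A} (l : list A) f g : sumC l (fun x => Cplus (f x) (g x)) = Cplus (sumC l f) (sumC l g).
Proof. elim: l => [|x l IH]; last rewrite !sumC_cons IH; rewrite /sumC /=; ring. Qed.
Lemma sumC_scal {A} (l : list A) c f : sumC l (fun x => Cmult c (f x)) = Cmult c (sumC l f).
Proof. elim: l => [|x l IH]; last rewrite !sumC_cons IH; rewrite /sumC /=; ring. Qed.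
Lemma sumC_scal_r {A} (l : list A) c f : sumC l (fun x => Cmult (f x) c) = Cmult (sumC l f) c.
Proof. rewrite Cmult_comm -sumC_scal; apply: sumC_ext => x _; ring. Qed.
Lemma sumC_swap {A B} (l : list A) (k : list B) f :
  sumC l (fun x => sumC k (fun y => f x y)) = sumC k (fun y => sumC l (fun x => f x y)).
Proof.
elim: l => [|x l IH]; first by rewrite [RHS]sumC_0.
by rewrite sumC_cons IH -sumC_plus.
Qed.
Lemma sumC_app {A} (l k : list A) f : sumC (l ++ k) f = Cplus (sumC l f) (sumC k f).
Proof. elim: l => [|x l IH]; first by rewrite /sumC /=; ring. by rewrite /= !sumC_cons IH; ring. Qed.
Lemma sumC_mult {A B} (l : list A) (k : list B) f g :
  Cmult (sumC l f) (sumC k g) = sumC l (fun x => sumC k (fun y => Cmult (f x) (g y))).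
Proof.
rewrite -sumC_scal_r; apply: sumC_ext => x _. by rewrite sumC_scal.
Qed.
Lemma sumR_mult {A B} (l : list A) (k : list B) f g :
  sumR l f * sumR k g = sumR l (fun x => sumR k (fun y => f x * g y)).
Proof.
rewrite -sumR_scal_r; apply: sumR_ext => x _. by rewrite sumR_scal.
Qed.
Lemma sumC_conj {A} (l : list A) f : Cconj (sumC l f) = sumC l (fun x => Cconj (f x)).
Proof.
elim: l => [|x l IH]; first by rewrite /sumC /=; apply: injective_projections => //=; ring.
by rewrite !sumC_cons Cplus_conj IH.
Qed.
Lemma Cmod_sum {A} (l : list A) f : Cmod (sumC l f) <= sumR l (fun x => Cmod (f x)).
Proof.
elim: l => [|x l IH]; first by rewrite /sumC /sumR /= Cmod_0; lra.
rewrite sumC_cons sumR_cons. have := Cmod_triangle (f x) (sumC l f). lra.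
Qed.
Lemma sumC_flat_map {A B} (l : list A) (h : A -> list B) f :
  sumC (flat_map h l) f = sumC l (fun x => sumC (h x) f).
Proof. elim: l => [|x l IH] //=. by rewrite sumC_app sumC_cons IH. Qed.

Lemma Cmod_prod {A} (l : list A) f : Cmod (prodC l f) = prodR l (fun x => Cmod (f x)).
Proof.
elim: l => [|x l IH]; first by rewrite /prodC /prodR /= Cmod_1.
by rewrite prodC_cons prodR_cons Cmod_mult IH.
Qed.
Lemma prodC_conj {A} (l : list A) f : Cconj (prodC l f) = prodC l (fun x => Cconj (f x)).
Proof.
elim: l => [|x l IH]; first by rewrite /prodC /=; apply: injective_projections => //=; ring.
by rewrite !prodC_cons Cmult_conj IH.
Qed.
Lemma prodC_mult {A} (l : list A) f g : prodC l (fun x => Cmult (f x) (g x)) = Cmult (prodC l f) (prodC l g).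
Proof. elim: l => [|x l IH]; last rewrite !prodC_cons IH; rewrite /prodC /=; ring. Qed.
Lemma prodR_mult {A} (l : list A) f g : prodR l (fun x => f x * g x) = prodR l f * prodR l g.
Proof. elim: l => [|x l IH]; last rewrite !prodR_cons IH; rewrite /prodR /=; ring. Qed.
Lemma prodC_1 {A} (l : list A) f : (forall x, In x l -> f x = RtoC 1) -> prodC l f = RtoC 1.
Proof.
elim: l => [|x l IH] H //.
rewrite prodC_cons H; last by left. rewrite IH ?Cmult_1_l // => y Hy; apply: H; by right.
Qed.
Lemma prodC_0 {A} (l : list A) f x : In x l -> f x = RtoC 0 -> prodC l f = RtoC 0.
Proof.
elim: l => [|y l IH] // [->|Hx] H; rewrite prodC_cons; first by rewrite H Cmult_0_l.
by rewrite IH // Cmult_0_r.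
Qed.
Lemma prodR_const {A} (l : list A) c : prodR l (fun _ => c) = c ^ length l.
Proof. by elim: l => [|x l IH] //; rewrite prodR_cons IH. Qed.
Lemma prodR_ge0 {A} (l : list A) f : (forall x, In x l -> 0 <= f x) -> 0 <= prodR l f.
Proof.
elim: l => [|x l IH] H; first by rewrite /prodR /=; lra.
rewrite prodR_cons; apply: Rmult_le_pos; first by apply: H; left.
by apply: IH => y Hy; apply: H; right.
Qed.
Lemma prodR_gt0 {A} (l : list A) f : (forall x, In x l -> 0 < f x) -> 0 < prodR l f.
Proof.
elim: l => [|x l IH] H; first by rewrite /prodR /=; lra.
rewrite prodR_cons; apply: Rmult_lt_0_compat; first by apply: H; left.
by apply: IH => y Hy; apply: H; right.
Qed.
Lemma prodR_le {A} (l : list A) f g : (forall x, In x l -> 0 <= f x <= g x) -> prodR l f <= prodR l g.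
Proof.
elim: l => [|x l IH] H; first by rewrite /prodR /=; lra.
rewrite !prodR_cons; apply: Rmult_le_compat.
- by case: (H x); [left|].
- by apply: prodR_ge0 => y Hy; case: (H y); [right|].
- by case: (H x); [left|].
- by apply: IH => y Hy; apply: H; right.
Qed.
Lemma prodR_exp {A} (l : list A) f : prodR l (fun x => exp (f x)) = exp (sumR l f).
Proof.
elim: l => [|x l IH]; first by rewrite /prodR /sumR /= exp_0.
by rewrite prodR_cons sumR_cons exp_plus IH.
Qed.

(** The form [s ^ 2 * a + 2 * s * t * c + t ^ 2 * b] is a sum of squares, and at [(s, t) = (b, - c)]
    it equals [b * (a * b - c ^ 2)]. If [b = 0], the choice [s = 1], [t = - (a + 1) / (2 * c)] would
    make it [-1] unless [c = 0]. *)
Lemma cauchy_schwarz {A} (l : list A) f g :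
  (sumR l (fun x => f x * g x)) ^ 2 <= sumR l (fun x => f x ^ 2) * sumR l (fun x => g x ^ 2).
Proof.
set a := sumR l (fun x => f x ^ 2); set b := sumR l (fun x => g x ^ 2).
set c := sumR l (fun x => f x * g x).
have Ha : 0 <= a by apply: sumR_ge0 => x _; apply: pow2_ge_0.
have Hb : 0 <= b by apply: sumR_ge0 => x _; apply: pow2_ge_0.
have H s t : 0 <= s ^ 2 * a + 2 * s * t * c + t ^ 2 * b.
  have -> : s ^ 2 * a + 2 * s * t * c + t ^ 2 * b = sumR l (fun x => (s * f x + t * g x) ^ 2).
    rewrite /a /b /c -!sumR_scal -!sumR_plus. apply: sumR_ext => x _; ring.
  by apply: sumR_ge0 => x _; apply: pow2_ge_0.
have [Hb0|Hb0] : b = 0 \/ 0 < b by lra.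
- have Hc : c = 0.
    apply: NNPP => Hc. have := H 1 (- (a + 1) / (2 * c)). rewrite Hb0.
    have -> : 1 ^ 2 * a + 2 * 1 * (- (a + 1) / (2 * c)) * c + (- (a + 1) / (2 * c)) ^ 2 * 0 = -1 by field.
    lra.
  rewrite Hc Hb0; lra.
- have := H b (- c). have -> : b ^ 2 * a + 2 * b * - c * c + (- c) ^ 2 * b = b * (a * b - c ^ 2) by ring.
  move=> H1. have := Rmult_le_reg_l b 0 (a * b - c ^ 2) Hb0. lra.
Qed.

Lemma prodC_seq_S n f : prodC (seq 0 (S n)) f = Cmult (f 0%nat) (prodC (seq 0 n) (fun i => f (S i))).
Proof. by rewrite [seq _ _]/= prodC_cons -seq_shift prodC_map. Qed.
Lemma prodR_seq_S n f : prodR (seq 0 (S n)) f = f 0%nat * prodR (seq 0 n) (fun i => f (S i)).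
Proof. by rewrite [seq _ _]/= prodR_cons -seq_shift prodR_map. Qed.
Lemma sumR_seq_S n f : sumR (seq 0 (S n)) f = f 0%nat + sumR (seq 0 n) (fun i => f (S i)).
Proof. by rewrite [seq _ _]/= sumR_cons -seq_shift sumR_map. Qed.
Lemma sumR_seq_Sr n f : sumR (seq 0 (S n)) f = sumR (seq 0 n) f + f n.
Proof. by rewrite seq_S sumR_app /sumR /= Rplus_0_r. Qed.
Lemma sumC_seq_Sr n f : sumC (seq 0 (S n)) f = Cplus (sumC (seq 0 n) f) (f n).
Proof. by rewrite seq_S sumC_app /sumC /= Cplus_0_r. Qed.

(** [mindices n M] is the full grid of exponents [0 .. M], so a sum of products over it is a product
    of sums. Torus orthogonality, generating functions and the expansion of Riesz products all rest
    on this. *)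
Lemma sumC_mindices n M (phi : nat -> nat -> C) :
  sumC (mindices n M) (fun l => prodC (seq 0 n) (fun i => phi i (nth i l 0%nat))) =
  prodC (seq 0 n) (fun i => sumC (seq 0 (S M)) (phi i)).
Proof.
elim: n phi => [|n IH] phi; first by rewrite /sumC /prodC /= Cplus_0_r.
rewrite prodC_seq_S -IH -sumC_scal_r /mindices -/mindices sumC_flat_map.
apply: sumC_ext => e _. rewrite sumC_map -sumC_scal. apply: sumC_ext => l _.
by rewrite prodC_seq_S.
Qed.

Lemma choice_fun {A B} (P : A -> B -> Prop) : (forall x, exists y, P x y) -> exists f, forall x, P x (f x).
Proof.
move=> H. exists (fun x => proj1_sig (constructive_indefinite_description _ (H x))) => x.
exact: (proj2_sig (constructive_indefinite_description _ (H x))).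
Qed.

Lemma sumR_mindices n M (phi : nat -> nat -> R) :
  sumR (mindices n M) (fun l => prodR (seq 0 n) (fun i => phi i (nth i l 0%nat))) =
  prodR (seq 0 n) (fun i => sumR (seq 0 (S M)) (phi i)).
Proof.
apply: RtoC_inj. rewrite RtoC_sum RtoC_prod.
rewrite (sumC_ext _ _ (fun l => prodC (seq 0 n) (fun i => RtoC (phi i (nth i l 0%nat))))); last first.
  by move=> l _; rewrite RtoC_prod.
rewrite (sumC_mindices n M (fun i k => RtoC (phi i k))). by apply: prodC_ext => i _; rewrite RtoC_sum.
Qed.

Lemma in_mindices n M l : In l (mindices n M) <-> length l = n /\ (forall i, (nth i l 0 <= M)%nat).
Proof.
elim: n l => [|n IH] l.
- split; first by case=> [<-|[]]; split=> // -[|i] /=; lia.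
  by case; case: l => //=; left.
- rewrite /mindices -/mindices in_flat_map; split.
  + move=> [e [/in_seq He /in_map_iff [k [<- /IH [Hk Hk']]]]]. split; first by rewrite /= Hk.
    case=> [|i] /=; first by lia. exact: Hk'.
  + case: l => [|e l] [] // [Hl] H. exists e; split; first by apply/in_seq; have := H 0%nat; simpl; lia.
    apply/in_map_iff; exists l; split=> //. apply/IH; split=> // i. exact: (H (S i)).
Qed.

Lemma NoDup_mindices n M : NoDup (mindices n M).
Proof.
elim: n => [|n IH]; first by repeat constructor; case.
rewrite /mindices -/mindices. move: (seq_NoDup (S M) 0). elim: (seq 0 (S M)) => [|e s IHs] /=; first by constructor.
move=> H; inversion H; subst. apply: NoDup_app.
- apply: FinFun.Injective_map_NoDup => //. by move=> x y [].
- exact: IHs.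
- move=> l /in_map_iff [k [<- Hk]] /in_flat_map [e' [He' /in_map_iff [k' [[E _] _]]]]. by subst.
Qed.

(** * Averages over roots of unity *)

(** Real valued and classical, so that cardinalities and Kronecker deltas are ordinary sums. *)
Definition indic (P : Prop) : R :=
  match excluded_middle_informative P with left _ => 1 | right _ => 0 end.
Lemma indic_T (P : Prop) : P -> indic P = 1.
Proof. by rewrite /indic; case: excluded_middle_informative. Qed.
Lemma indic_F (P : Prop) : ~ P -> indic P = 0.
Proof. by rewrite /indic; case: excluded_middle_informative. Qed.
Lemma indic_01 P : 0 <= indic P <= 1.
Proof. rewrite /indic; case: excluded_middle_informative => _; lra. Qed.
Lemma indic_ge0 P : 0 <= indic P.
Proof. by case: (indic_01 P). Qed.
Lemma indic_ext (P Q : Prop) : (P <-> Q) -> indic P = indic Q.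
Proof.
move=> H; case: (classic P) => HP; first by rewrite !indic_T //; apply/H.
by rewrite !indic_F // => HQ; apply/HP/H.
Qed.

Lemma sumC_indic_eq {A} (L : list A) (f : A -> C) x :
  NoDup L -> In x L -> sumC L (fun y => Cmult (f y) (RtoC (indic (x = y)))) = f x.
Proof.
elim: L => [|y L IH] // H; inversion H; subst; case=> [<-|Hx]; rewrite sumC_cons.
- rewrite indic_T // sumC_0; first by rewrite Cmult_1_r Cplus_0_r.
  by move=> z Hz; rewrite indic_F ?Cmult_0_r // => E; subst.
- rewrite IH // indic_F ?Cmult_0_r ?Cplus_0_l // => E; by subst.
Qed.
Lemma sumR_indic_eq {A} (L : list A) (f : A -> R) x :
  NoDup L -> In x L -> sumR L (fun y => f y * indic (x = y)) = f x.
Proof.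
move=> H Hx; apply: RtoC_inj; rewrite RtoC_sum -(sumC_indic_eq L (fun y => RtoC (f y)) x) //.
by apply: sumC_ext => y _; rewrite RtoC_mult.
Qed.
Lemma sumR_indic_le {A} (L : list A) (f : A -> R) x :
  NoDup L -> 0 <= f x -> sumR L (fun y => f y * indic (x = y)) <= f x.
Proof.
move=> H Hf; case: (classic (In x L)) => Hx; first by rewrite sumR_indic_eq //; lra.
rewrite sumR_0 // => y Hy; rewrite indic_F ?Rmult_0_r // => E; by subst.
Qed.

(** * Algebra and modulus of monomials *)

Lemma mono_mult n z w a : mono n (fun i => Cmult (z i) (w i)) a = Cmult (mono n z a) (mono n w a).
Proof.
rewrite -[RHS](prodC_mult (seq 0 n)); apply: prodC_ext => i _; exact: Cpow_mult_l.
Qed.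
Lemma mono_add n z a b : mono n z (fun i => (a i + b i)%nat) = Cmult (mono n z a) (mono n z b).
Proof.
rewrite -[RHS](prodC_mult (seq 0 n)); apply: prodC_ext => i _; exact: Cpow_add_r.
Qed.
Lemma mono_conj n z a : Cconj (mono n z a) = mono n (fun i => Cconj (z i)) a.
Proof. rewrite [LHS]prodC_conj; apply: prodC_ext => i _; exact: Cpow_conj. Qed.
Lemma mono_ext n z w a b :
  (forall i, (i < n)%nat -> z i = w i) -> (forall i, (i < n)%nat -> a i = b i) -> mono n z a = mono n w b.
Proof. by move=> H1 H2; apply: prodC_ext => i /in_seq Hi; rewrite H1 ?H2 //; lia. Qed.
Lemma Cmod_mono n z a : Cmod (mono n z a) = prodR (seq 0 n) (fun i => Cmod (z i) ^ a i).
Proof. rewrite [LHS]Cmod_prod; apply: prodR_ext => i _; exact: Cmod_pow. Qed.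
Lemma Cmod_mono_le1 n z a : (forall i, (i < n)%nat -> Cmod (z i) <= 1) -> Cmod (mono n z a) <= 1.
Proof.
move=> H; rewrite Cmod_mono; apply: (Rle_trans _ (prodR (seq 0 n) (fun _ => 1))); last first.
  rewrite prodR_const pow1; lra.
apply: prodR_le => i /in_seq Hi; split; first by apply/pow_le/Cmod_ge_0.
rewrite -(pow1 (a i)); apply: pow_incr; split; [exact: Cmod_ge_0|apply: H; lia].
Qed.
Lemma Cmod_mono_1 n w a : (forall i, (i < n)%nat -> Cmod (w i) = 1) -> Cmod (mono n w a) = 1.
Proof.
move=> H; rewrite Cmod_mono (prodR_ext _ _ (fun _ => 1)) ?prodR_const ?pow1 // => i /in_seq Hi.
rewrite H ?pow1 //; lia.
Qed.

(** * Roots of unity and exact orthogonality on the discrete torus *)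

Definition om (N k : nat) : C := (cos (2 * PI * (INR k / INR N)), sin (2 * PI * (INR k / INR N))).

Lemma Cmod_om N k : Cmod (om N k) = 1.
Proof.
rewrite /Cmod /om [fst _]/= [snd _]/=. set x := 2 * PI * _.
have -> : cos x ^ 2 + sin x ^ 2 = 1; last by apply: sqrt_1.
have := sin2_cos2 x; rewrite /Rsqr; lra.
Qed.
Lemma om_add N j k : om N (j + k) = Cmult (om N j) (om N k).
Proof.
rewrite /om plus_INR Rdiv_plus_distr Rmult_plus_distr_l cos_plus sin_plus /Cmult /=.
by congr pair; ring.
Qed.
Lemma om_0 N : om N 0 = RtoC 1.
Proof. by rewrite /om /= /Rdiv Rmult_0_l Rmult_0_r cos_0 sin_0. Qed.
Lemma om_pow N k : om N k = Cpow (om N 1) k.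
Proof. elim: k => [|k IH]; first exact: om_0. by rewrite Cpow_S -IH -om_add. Qed.
Lemma om_N N : (0 < N)%nat -> om N N = RtoC 1.
Proof.
move=> HN. have HN' : INR N <> 0 by apply: not_0_INR; lia.
have -> : om N N = (cos (2 * PI), sin (2 * PI)) by rewrite /om Rdiv_diag // Rmult_1_r.
by rewrite cos_2PI sin_2PI.
Qed.
(** With [x = PI * (k / N)] strictly between 0 and [PI], [cos (2 * x) = 1 - 2 * sin x ^ 2] differs
    from 1. *)
Lemma om_neq1 N k : (0 < k < N)%nat -> om N k <> RtoC 1.
Proof.
move=> Hk E. have Hk0 : 0 < INR k by apply: lt_0_INR; lia.
have HN0 : 0 < INR N by apply: lt_0_INR; lia.
have HkN : INR k < INR N by apply: lt_INR; lia.
have H1 : cos (2 * (PI * (INR k / INR N))) = 1.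
  rewrite -Rmult_assoc; exact: (f_equal fst E).
rewrite cos_2a_sin in H1.
have H2 : 0 < sin (PI * (INR k / INR N)).
  have HP := PI_RGT_0.
  have H3 : 0 < INR k / INR N by apply: Rdiv_lt_0_compat.
  have H4 : INR k / INR N < 1 by apply: (Rmult_lt_reg_r (INR N)) => //; rewrite /Rdiv Rmult_assoc Rinv_l; lra.
  apply: sin_gt_0; nra.
nra.
Qed.
Lemma Cconj_om_mul N k : Cmult (om N k) (Cconj (om N k)) = RtoC 1.
Proof. by rewrite -Cmod2_conj Cmod_om pow1. Qed.

Lemma geom_C (q : C) N : Cmult (Cminus q 1) (sumC (seq 0 N) (fun k => Cpow q k)) = Cminus (Cpow q N) 1.
Proof.
elim: N => [|N IH]; first by rewrite /sumC /=; ring.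
rewrite sumC_seq_Sr Cmult_plus_distr_l IH Cpow_S; ring.
Qed.

(** A geometric sum whose ratio [q] is the power [a - b] of a primitive root: [q ^ N = 1] and
    [q <> 1]. *)
Lemma root_sum_neq N a b : (a < N)%nat -> (b < N)%nat -> a <> b ->
  sumC (seq 0 N) (fun k => Cmult (Cpow (om N k) a) (Cconj (Cpow (om N k) b))) = RtoC 0.
Proof.
move=> Ha Hb Hab.
set q := Cmult (Cpow (om N 1) a) (Cconj (Cpow (om N 1) b)).
rewrite (sumC_ext _ _ (fun k => Cpow q k)); last first.
  move=> k _. rewrite om_pow /q Cpow_mult_l !Cpow_conj -!Cpow_mult_r.
  by rewrite (Nat.mul_comm k a) (Nat.mul_comm k b).
have HqN : Cpow q N = RtoC 1.
  rewrite /q Cpow_mult_l -Cpow_conj -!Cpow_mult_r (Nat.mul_comm a N) (Nat.mul_comm b N) !Cpow_mult_r -om_pow om_N; last lia.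
  rewrite !Cpow_1_l; apply: injective_projections => /=; ring.
have Hq : q <> RtoC 1.
  have H j k : (j < k < N)%nat -> Cmult (om N k) (Cconj (om N j)) <> RtoC 1.
    move=> Hjk. have -> : k = (k - j + j)%nat by lia.
    rewrite om_add -Cmult_assoc Cconj_om_mul Cmult_1_r; apply: om_neq1; lia.
  rewrite /q -!om_pow. have [L|L] : (b < a \/ a < b)%nat by lia.
  - by apply: H; lia.
  - move=> E; apply: (H a b); first by lia.
    rewrite -(Cconj_conj (om N b)) -Cmult_conj Cmult_comm E. apply: injective_projections => /=; ring.
have := geom_C q N. rewrite HqN => H.
have Hq1 : Cminus q 1 <> RtoC 0 by move=> E; apply: Hq; rewrite -(Cplus_0_l 1) -E; ring.
apply: NNPP => Hs. case: (Cmult_neq_0 _ _ Hq1 Hs). rewrite H; ring.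
Qed.
Lemma root_sum_eq N a :
  sumC (seq 0 N) (fun k => Cmult (Cpow (om N k) a) (Cconj (Cpow (om N k) a))) = RtoC (INR N).
Proof.
rewrite (sumC_ext _ _ (fun _ => RtoC 1)); last first.
  move=> k _. by rewrite -Cmod2_conj Cmod_pow Cmod_om !pow1.
rewrite -(RtoC_sum _ (fun _ => 1)) sumR_const length_seq Rmult_1_r //.
Qed.

(** Points of the discrete torus, coded by their exponents; averages over its [N ^ n] points play
    the role of Haar measure. *)
Definition tor (N : nat) (g : list nat) : nat -> C := fun i => om N (nth i g 0%nat).
Definition avgR (n N : nat) (F : (nat -> C) -> R) : R :=
  / INR N ^ n * sumR (mindices n (N - 1)) (fun g => F (tor N g)).
Definition avgC (n N : nat) (F : (nat -> C) -> C) : C :=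
  Cmult (RtoC (/ INR N ^ n)) (sumC (mindices n (N - 1)) (fun g => F (tor N g))).

Lemma Cmod_tor N g i : Cmod (tor N g i) = 1.
Proof. exact: Cmod_om. Qed.
Lemma RtoC_avg n N F : RtoC (avgR n N F) = avgC n N (fun w => RtoC (F w)).
Proof. by rewrite /avgR RtoC_mult RtoC_sum. Qed.
Lemma avgC_sum {A} n N (l : list A) F : avgC n N (fun w => sumC l (fun x => F x w)) = sumC l (fun x => avgC n N (F x)).
Proof. by rewrite /avgC sumC_swap -sumC_scal. Qed.
Lemma avgR_sum {A} n N (l : list A) F : avgR n N (fun w => sumR l (fun x => F x w)) = sumR l (fun x => avgR n N (F x)).
Proof. by rewrite /avgR sumR_swap -sumR_scal. Qed.
Lemma avgC_scal n N c F : avgC n N (fun w => Cmult c (F w)) = Cmult c (avgC n N F).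
Proof. rewrite /avgC sumC_scal; ring. Qed.
Lemma avgR_scal n N c F : avgR n N (fun w => c * F w) = c * avgR n N F.
Proof. rewrite /avgR sumR_scal; ring. Qed.
Lemma avgR_plus n N F G : avgR n N (fun w => F w + G w) = avgR n N F + avgR n N G.
Proof. rewrite /avgR sumR_plus; ring. Qed.
Lemma avgC_ext n N F G : (forall g, F (tor N g) = G (tor N g)) -> avgC n N F = avgC n N G.
Proof. by move=> H; rewrite /avgC; congr Cmult; apply: sumC_ext => g _. Qed.
Lemma avgR_ext n N F G : (forall g, F (tor N g) = G (tor N g)) -> avgR n N F = avgR n N G.
Proof. by move=> H; rewrite /avgR; congr Rmult; apply: sumR_ext => g _. Qed.
Lemma INR_pow_inv_ge0 N n : 0 <= / INR N ^ n.
Proof.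
case: N => [|N]; last by apply/Rlt_le/Rinv_0_lt_compat/pow_lt/lt_0_INR; lia.
case: n => [|n]; first by rewrite /= Rinv_1; lra.
rewrite /= Rmult_0_l Rinv_0; lra.
Qed.
Lemma avgR_le n N F G : (forall g, F (tor N g) <= G (tor N g)) -> avgR n N F <= avgR n N G.
Proof.
move=> H; apply: Rmult_le_compat_l; first exact: INR_pow_inv_ge0.
by apply: sumR_le => g _.
Qed.
Lemma avgR_const n N c : (0 < N)%nat -> avgR n N (fun _ => c) = c.
Proof.
move=> HN. rewrite /avgR.
rewrite (sumR_ext _ _ (fun l => c * prodR (seq 0 n) (fun i => (fun _ _ => 1) i (nth i l 0%nat)))); last first.
  by move=> l _; rewrite prodR_const pow1 Rmult_1_r.
rewrite sumR_scal (sumR_mindices n (N - 1) (fun _ _ => 1)) prodR_const sumR_const !length_seq Rmult_1_r.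
have -> : S (N - 1) = N by lia.
field. apply/pow_nonzero/not_0_INR; lia.
Qed.
Lemma avgR_ge0 n N F : (forall g, 0 <= F (tor N g)) -> 0 <= avgR n N F.
Proof.
move=> H; apply: Rmult_le_pos; first exact: INR_pow_inv_ge0. by apply: sumR_ge0 => g _.
Qed.
Lemma Cmod_avg n N F : Cmod (avgC n N F) <= avgR n N (fun w => Cmod (F w)).
Proof.
rewrite /avgC Cmod_mult Cmod_R Rabs_pos_eq; last exact: INR_pow_inv_ge0.
apply: Rmult_le_compat_l; [exact: INR_pow_inv_ge0|exact: Cmod_sum].
Qed.

(** The average factorises over the variables. The exponents are kept below [N] because the discrete
    torus identifies exponents that agree modulo [N]. *)
Lemma torus_orth n N a b :
  (forall i, (i < n)%nat -> (a i < N)%nat) -> (forall i, (i < n)%nat -> (b i < N)%nat) ->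
  avgC n N (fun w => Cmult (mono n w a) (Cconj (mono n w b))) =
  RtoC (indic (forall i, (i < n)%nat -> a i = b i)).
Proof.
move=> Ha Hb. rewrite /avgC.
pose phi := fun i k => Cmult (Cpow (om N k) (a i)) (Cconj (Cpow (om N k) (b i))).
rewrite (sumC_ext _ _ (fun l => prodC (seq 0 n) (fun i => phi i (nth i l 0%nat)))); last first.
  move=> l _. rewrite [Cconj _]prodC_conj -[LHS](prodC_mult (seq 0 n)). by apply: prodC_ext.
rewrite sumC_mindices. case: (classic (forall i, (i < n)%nat -> a i = b i)) => H.
- rewrite indic_T //. case: n Ha Hb H => [|n] Ha Hb H.
    by rewrite /prodC /= Rinv_1; ring.
  have HN : (0 < N)%nat by have := Ha 0%nat; lia.
  rewrite (prodC_ext _ _ (fun _ => RtoC (INR N))); last first.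
    move=> i /in_seq Hi. rewrite /phi H; last lia. rewrite -(root_sum_eq N (b i)).
    by have -> : S (N - 1) = N by lia.
  rewrite -(RtoC_prod _ (fun _ => INR N)) prodR_const length_seq -RtoC_mult; congr RtoC.
  rewrite Rinv_l //; apply/pow_nonzero/not_0_INR; lia.
- rewrite indic_F //. have [i Hi] : exists i, (i < n)%nat /\ a i <> b i.
    apply: NNPP => H'. apply: H => i Hi. apply: NNPP => Hi'. by apply: H'; exists i.
  rewrite (prodC_0 _ _ i) ?Cmult_0_r //; first by apply/in_seq; lia.
  rewrite /phi. have := Ha i; have := Hb i => ??. have -> : S (N - 1) = N by lia.
  apply: root_sum_neq; lia.
Qed.

Lemma ext_inj n M l l' : In l (mindices n M) -> In l' (mindices n M) ->
  (forall i, (i < n)%nat -> ext l i = ext l' i) -> l = l'.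
Proof.
move=> /in_mindices [H1 _] /in_mindices [H2 _] H. apply: (nth_ext _ _ 0%nat 0%nat); first by rewrite H1 H2.
by move=> i Hi; apply: H; lia.
Qed.

Lemma torus_orth_list n M N l l' : (M < N)%nat -> In l (mindices n M) -> In l' (mindices n M) ->
  avgC n N (fun w => Cmult (mono n w (ext l)) (Cconj (mono n w (ext l')))) = RtoC (indic (l = l')).
Proof.
move=> HN Hl Hl'. rewrite torus_orth.
- congr RtoC; apply: indic_ext; split=> [|-> //]. exact: ext_inj Hl Hl'.
- move=> i _; move/in_mindices: Hl => [_ H]; have := H i; rewrite /ext; lia.
- move=> i _; move/in_mindices: Hl' => [_ H]; have := H i; rewrite /ext; lia.
Qed.

(** Coefficients are indexed by lists of exponents rather than by functions, so that an index set is
    a list without repetition, over which one can sum. *)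
Definition mpoly n (L : list (list nat)) (c : list nat -> C) (z : nat -> C) : C :=
  sumC L (fun l => Cmult (c l) (mono n z (ext l))).

Lemma torus_coeff n M N L c l : (M < N)%nat -> NoDup L -> incl L (mindices n M) -> In l L ->
  avgC n N (fun w => Cmult (mpoly n L c w) (Cconj (mono n w (ext l)))) = c l.
Proof.
move=> HN HL Hi Hl.
rewrite -[RHS](sumC_indic_eq L c l) //.
rewrite (avgC_ext _ _ _ (fun w => sumC L (fun x => Cmult (c x) (Cmult (mono n w (ext x)) (Cconj (mono n w (ext l))))))).
- rewrite avgC_sum; apply: sumC_ext => x Hx. rewrite avgC_scal (torus_orth_list n M) //; try by apply: Hi.
  congr Cmult; congr RtoC; apply: indic_ext; split=> ->; by [].
- move=> g; rewrite /mpoly -sumC_scal_r; apply: sumC_ext => x _; ring.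
Qed.

Lemma RtoC_Cmod2 z : RtoC (Cmod z ^ 2) = Cmult z (Cconj z).
Proof. by rewrite -Cmod2_conj. Qed.

Lemma parseval n M N L c : (M < N)%nat -> NoDup L -> incl L (mindices n M) ->
  avgR n N (fun w => Cmod (mpoly n L c w) ^ 2) = sumR L (fun l => Cmod (c l) ^ 2).
Proof.
move=> HN HL Hi. apply: RtoC_inj. rewrite RtoC_avg RtoC_sum.
rewrite (avgC_ext _ _ _ (fun w => sumC L (fun l => Cmult (Cconj (c l)) (Cmult (mpoly n L c w) (Cconj (mono n w (ext l))))))); last first.
  move=> g; rewrite RtoC_Cmod2 {2}/mpoly sumC_conj -sumC_scal; apply: sumC_ext => l _.
  rewrite Cmult_conj; ring.
rewrite avgC_sum; apply: sumC_ext => l Hl.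
by rewrite avgC_scal (torus_coeff n M) // RtoC_Cmod2 Cmult_comm.
Qed.

(** Passage from the ball to the polydisc: for fixed [z] the coefficients absorb the point, and the
    torus results apply in [w]. *)
Lemma mpoly_scale n L c z w : mpoly n L c (fun i => Cmult (z i) (w i)) = mpoly n L (fun l => Cmult (c l) (mono n z (ext l))) w.
Proof. by apply: sumC_ext => l _; rewrite mono_mult; ring. Qed.

(** * Counting monomials and near-optimal designs *)

Definition deg_list n d : list (list nat) := filter (fun l => Nat.leb (list_sum l) d) (mindices n d).

Lemma nth_le_list_sum i l : (nth i l 0 <= list_sum l)%nat.
Proof.
elim: l i => [|x l IH] [|i] //; change (list_sum (x :: l)) with (x + list_sum l)%nat; first by rewrite /=; lia.
apply: (Nat.le_trans _ _ _ (IH i)); lia.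
Qed.
Lemma in_deg_list n d l : In l (deg_list n d) <-> length l = n /\ (list_sum l <= d)%nat.
Proof.
rewrite /deg_list filter_In in_mindices Nat.leb_le; split; first by move=> [[]].
move=> [H1 H2]; split=> //; split=> // i. have := nth_le_list_sum i l; lia.
Qed.
Lemma NoDup_deg_list n d : NoDup (deg_list n d).
Proof. apply/NoDup_filter/NoDup_mindices. Qed.
Lemma incl_deg_list n d : incl (deg_list n d) (mindices n d).
Proof. by move=> l /filter_In []. Qed.

Lemma zero_in_deg_list n d : In (repeat 0%nat n) (deg_list n d).
Proof.
apply/in_deg_list. rewrite repeat_length; split=> //. have -> : list_sum (repeat 0%nat n) = 0%nat; last lia.
by elim: n.
Qed.

Lemma pow_list_sum x l : x ^ list_sum l = prodR (seq 0 (length l)) (fun i => x ^ nth i l 0%nat).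
Proof.
elim: l => [|k l IH] //. change (list_sum (k :: l)) with (k + list_sum l)%nat.
by rewrite [length _]/= prodR_seq_S pow_add IH.
Qed.

Lemma geom_R x d : (1 - x) * sumR (seq 0 d) (fun k => x ^ k) = 1 - x ^ d.
Proof.
elim: d => [|d IH]; first by rewrite /sumR /=; ring.
rewrite sumR_seq_Sr Rmult_plus_distr_l IH /=; ring.
Qed.
Lemma geom_R_le x d : 0 <= x < 1 -> sumR (seq 0 d) (fun k => x ^ k) <= / (1 - x).
Proof.
move=> Hx. apply: (Rmult_le_reg_l (1 - x)); first by lra.
rewrite geom_R Rinv_r; last by lra. have := pow_le x d ltac:(lra); lra.
Qed.

Lemma prodR_single n i x : (i < n)%nat ->
  prodR (seq 0 n) (fun j => if Nat.eqb j i then x else 1) = x.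
Proof.
elim: n i => [|n IH] [|i] Hi; try lia; rewrite prodR_seq_S /=.
- rewrite prodR_const pow1; ring.
- rewrite IH; [ring|lia].
Qed.

Lemma exp_pow x k : exp x ^ k = exp (INR k * x).
Proof.
elim: k => [|k IH]; first by rewrite /= Rmult_0_l exp_0.
rewrite S_INR /= IH -exp_plus; congr exp; ring.
Qed.
Lemma exp_le_compat x y : x <= y -> exp x <= exp y.
Proof. by case=> [H|->]; [exact/Rlt_le/exp_increasing|exact: Rle_refl]. Qed.
Lemma one_plus_le_exp x : 1 + x <= exp x.
Proof. exact: exp_ineq1_le. Qed.

(* At [x = d / (n + d)], [x ^ - d * (1 - x) ^ - n] is [(1 + n / d) ^ d * (1 + d / n) ^ n]. *)
Lemma genfun_bound n d : (0 < n)%nat -> (0 < d)%nat ->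
  exists x, 0 < x < 1 /\ / x = 1 + INR n / INR d /\ (/ (1 - x)) ^ n <= exp (INR d).
Proof.
move=> Hn Hd. have Hn0 : 0 < INR n by apply: lt_0_INR. have Hd0 : 0 < INR d by apply: lt_0_INR.
exists (INR d / (INR n + INR d)). have H1 : 1 - INR d / (INR n + INR d) = INR n / (INR n + INR d) by field; lra.
have H0 : 0 < INR d / (INR n + INR d) by apply: Rdiv_lt_0_compat; lra.
have H2 : 0 < INR n / (INR n + INR d) by apply: Rdiv_lt_0_compat; lra.
split; first by lra.
split; first by field; lra.
rewrite H1. have -> : / (INR n / (INR n + INR d)) = 1 + INR d / INR n by field; lra.
have -> : INR d = INR n * (INR d / INR n) by field; lra.
rewrite -exp_pow; apply: pow_incr. split.
- have := Rdiv_lt_0_compat _ _ Hd0 Hn0. have -> : INR n * (INR d / INR n) / INR n = INR d / INR n by field; lra. lra.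
- have -> : INR n * (INR d / INR n) / INR n = INR d / INR n by field; lra. exact: one_plus_le_exp.
Qed.

Lemma pow_inv_ge1 x k d : 0 < x < 1 -> (k <= d)%nat -> 1 <= (/ x) ^ d * x ^ k.
Proof.
move=> Hx Hk. have -> : d = (d - k + k)%nat by lia.
rewrite pow_add Rmult_assoc -Rpow_mult_distr Rinv_l; last lra. rewrite pow1 Rmult_1_r.
apply: pow_R1_Rle. rewrite -Rinv_1. apply: Rinv_le_contravar; lra.
Qed.

(** Rankin's trick: [x ^ (|l| - d) >= 1] for [|l| <= d], after which the degree restriction is
    dropped and the sum over the grid factorises. *)
Lemma genfun_count n d x (chi : nat -> nat -> R) : 0 < x < 1 -> (forall i k, 0 <= chi i k) ->
  sumR (deg_list n d) (fun l => prodR (seq 0 n) (fun i => chi i (nth i l 0%nat))) <=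
  (/ x) ^ d * prodR (seq 0 n) (fun i => sumR (seq 0 (S d)) (fun k => chi i k * x ^ k)).
Proof.
move=> Hx Hchi. have Hix : 0 < / x by apply: Rinv_0_lt_compat; lra.
have Hpos l : 0 <= prodR (seq 0 n) (fun i => chi i (nth i l 0%nat)) by exact: prodR_ge0.
rewrite -(sumR_mindices n d (fun i k => chi i k * x ^ k)) -sumR_scal.
apply: Rle_trans (sumR_filter_le _ _ _ _); last first.
  move=> l; apply: Rmult_le_pos; first by apply: pow_le; lra.
  apply: prodR_ge0 => i _. apply: Rmult_le_pos => //. apply: pow_le; lra.
apply: sumR_le => l /in_deg_list [Hl1 Hl2].
rewrite prodR_mult -{3}Hl1 -pow_list_sum.
have := pow_inv_ge1 x _ _ Hx Hl2. have := Hpos l. nra.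
Qed.

(** [genfun_count] with trivial weights: each factor is a truncated geometric series, at most
    [/ (1 - x)]. The case [n = 0] is apart because [genfun_bound] divides by [n]. *)
Lemma length_deg_list n d : (0 < d)%nat ->
  INR (length (deg_list n d)) <= exp (INR d) * (1 + INR n / INR d) ^ d.
Proof.
move=> Hd. have Hd0 : 0 < INR d by apply: lt_0_INR.
case: (Nat.eq_dec n 0) => [->|Hn].
  have H1 : 1 <= exp (INR d) by have := one_plus_le_exp (INR d); lra.
  have -> : 1 + INR 0 / INR d = 1 by rewrite /=; field; lra.
  rewrite pow1 /deg_list /=; lra.
have [x [Hx [Hx1 Hx2]]] := genfun_bound n d ltac:(lia) Hd.
have := genfun_count n d x (fun _ _ => 1) Hx (fun _ _ => Rle_0_1).
rewrite (sumR_ext _ _ (fun _ => 1)); last by move=> l _; rewrite prodR_const pow1.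
rewrite sumR_const Rmult_1_r Hx1 (Rmult_comm (exp _)) => H. apply: Rle_trans H _.
apply: Rmult_le_compat_l.
  apply: pow_le. have := Rdiv_lt_0_compat (INR n) (INR d) (lt_0_INR n ltac:(lia)) Hd0. lra.
apply: Rle_trans Hx2. rewrite prodR_const length_seq.
rewrite (sumR_ext _ _ (fun k => x ^ k)); last by move=> k _; ring.
apply: pow_incr; split.
- apply: sumR_ge0 => k _; apply: pow_le; lra.
- apply: geom_R_le; lra.
Qed.

(** Requiring [l_i >= 1] multiplies the bound on the [i]-th factor by [x = / (1 + n / d)]. The saved
    power is the source of [m - 1] in the upper bound for the unconditional constant. *)
Lemma count_deg_list_pos n d i : (0 < d)%nat -> (i < n)%nat ->
  sumR (deg_list n d) (fun l => indic (1 <= nth i l 0)%nat) <= exp (INR d) * (1 + INR n / INR d) ^ (d - 1).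
Proof.
move=> Hd Hi. have [x [Hx [Hx1 Hx2]]] := genfun_bound n d ltac:(lia) Hd.
have Hix : 0 < / x by apply: Rinv_0_lt_compat; lra.
have := genfun_count n d x (fun j k => if Nat.eqb j i then indic (1 <= k)%nat else 1) Hx
  ltac:(move=> j k; cbv beta; case: (Nat.eqb j i); [exact: indic_ge0|lra]).
rewrite (sumR_ext _ _ (fun l => indic (1 <= nth i l 0)%nat)); last first.
  move=> l _. rewrite -[RHS](prodR_single n i) //. apply: prodR_ext => j _. by case: (Nat.eqb_spec j i) => // ->.
move=> H. apply: Rle_trans H _. rewrite -Hx1.
have H1 : prodR (seq 0 n) (fun j => sumR (seq 0 (S d)) (fun k => (if Nat.eqb j i then indic (1 <= k)%nat else 1) * x ^ k)) <= x * (/ (1 - x)) ^ n.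
  have -> : x * (/ (1 - x)) ^ n = prodR (seq 0 n) (fun j => (if Nat.eqb j i then x else 1) * / (1 - x)).
    by rewrite prodR_mult prodR_single // prodR_const length_seq.
  have Hg := geom_R_le x d ltac:(lra). have Hg' := geom_R_le x (S d) ltac:(lra).
  apply: prodR_le => j _. case: (Nat.eqb j i).
  - rewrite sumR_seq_S indic_F; last lia. rewrite Rmult_0_l Rplus_0_l.
    rewrite (sumR_ext _ _ (fun k => x * x ^ k)); last by move=> k _; rewrite indic_T; [rewrite /=; ring|lia].
    rewrite sumR_scal. have H0 : 0 <= sumR (seq 0 d) (fun k => x ^ k) by apply: sumR_ge0 => k _; apply: pow_le; lra.
    split; [apply: Rmult_le_pos => //; lra|apply: Rmult_le_compat_l => //; lra].
  - rewrite Rmult_1_l (sumR_ext _ _ (fun k => x ^ k)); last by move=> k _; ring.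
    split=> //. apply: sumR_ge0 => k _; apply: pow_le; lra.
have -> : (/ x) ^ d = (/ x) ^ (d - 1) * / x.
  by rewrite -(pow_1 (/ x)) -{3}(pow_1 (/ x)) -pow_add; congr pow; lia.
have H2 : 0 <= (/ x) ^ (d - 1) by apply: pow_le; lra.
rewrite Rmult_assoc (Rmult_comm (exp _)). apply: Rmult_le_compat_l => //.
apply: (Rle_trans _ (/ x * (x * (/ (1 - x)) ^ n))).
  by apply: Rmult_le_compat_l => //; lra.
rewrite -Rmult_assoc Rinv_l; lra.
Qed.

(** * Almost maximising a product of moments *)

Lemma prodR_one_plus {A} (L : list A) f : (forall a, In a L -> 0 <= f a) ->
  1 + sumR L f <= prodR L (fun a => 1 + f a).
Proof.
elim: L => [|a L IH] H; first by rewrite /sumR /prodR /=; lra.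
rewrite sumR_cons prodR_cons.
have H1 := IH (fun b Hb => H b (or_intror Hb)). have H2 := H a (or_introl eq_refl).
have H3 : 0 <= sumR L f by apply: sumR_ge0 => b Hb; apply: H; right.
nra.
Qed.
Lemma bernoulli t N : 0 <= t <= 1 -> 1 - INR N * t <= (1 - t) ^ N.
Proof.
move=> Ht; elim: N => [|N IH]; first by rewrite /=; lra.
rewrite S_INR /=. have := pos_INR N. have H : 0 <= (1 - t) ^ N by apply: pow_le; lra.
nra.
Qed.
Lemma prodR_le1 {A} (l : list A) f : (forall x, In x l -> 0 <= f x <= 1) -> prodR l f <= 1.
Proof.
move=> H; apply: (Rle_trans _ (prodR l (fun _ => 1))); first exact: prodR_le.
rewrite prodR_const pow1; lra.
Qed.

(* Almost maximising [prod_a M_a] over all finitely supported probabilities and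
   comparing with the perturbation [(1 - t) mu + t delta_z], [t = 1 / (2 |L|)], gives the bound. *)
Lemma design {X A} (L : list A) (u : A -> X -> R) (x0 : X) :
  (forall a x, 0 <= u a x <= 1) -> (forall a, 0 < u a x0) ->
  exists mu : list (R * X), (forall p, In p mu -> 0 <= fst p) /\ sumR mu fst = 1 /\
   (forall a, In a L -> 0 < sumR mu (fun p => fst p * u a (snd p))) /\
   forall z, sumR L (fun a => u a z / sumR mu (fun p => fst p * u a (snd p))) <= 6 * INR (length L).
Proof.
move=> Hu Hu0.
pose M (mu : list (R * X)) a := sumR mu (fun p => fst p * u a (snd p)).
pose ok (mu : list (R * X)) := (forall p, In p mu -> 0 <= fst p) /\ sumR mu fst = 1.
pose V mu := prodR L (M mu).
have HM mu a : ok mu -> 0 <= M mu a <= 1.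
  move=> [H1 H2]; split.
  - apply: sumR_ge0 => p Hp. apply: Rmult_le_pos; [exact: H1|by case: (Hu a (snd p))].
  - rewrite -H2; apply: sumR_le => p Hp. have := H1 p Hp. have := Hu a (snd p). nra.
have ok0 : ok [(1, x0)].
  split; first by move=> p [<-|[]] /=; lra. by rewrite /sumR /=; lra.
have HV0 : 0 < V [(1, x0)].
  apply: prodR_gt0 => a _. rewrite /M /sumR /=. have := Hu0 a; lra.
have [S [HS1 HS2]] : {S | is_lub (fun v => exists mu, ok mu /\ v = V mu) S}.
  apply: completeness; last by exists (V [(1, x0)]), [(1, x0)].
  exists 1 => v [mu [Hok ->]]. apply: prodR_le1 => a _. exact: HM.
have HS0 : V [(1, x0)] <= S by apply: HS1; exists [(1, x0)].
(* The supremum [S] need not be attained; exceeding half of it is enough, since every competitor is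
   then below [2 * V mu]. *)
have [mu [Hok Hmu]] : exists mu, ok mu /\ S / 2 < V mu.
  apply: NNPP => H. have : S <= S / 2; last lra.
  apply: HS2 => v [mu [Hok ->]]. apply: Rnot_lt_le => H1; apply: H; by exists mu.
have HMpos a : In a L -> 0 < M mu a.
  move=> Ha. case: (HM mu a Hok) => [[]] // E _.
  suff : V mu = 0 by lra. rewrite /V. elim: L Ha {HV0 V HS1 HS2 HS0 Hmu} => [|b l IH] // [->|Hb].
  - by rewrite prodR_cons -E Rmult_0_l.
  - by rewrite prodR_cons IH ?Rmult_0_r.
exists mu; case: (Hok) => H1 H2; split=> //; split=> //; split=> // z.
case E : L => [|a0 L0]; first by rewrite /sumR /=; lra. rewrite -E.
have HN : 1 <= INR (length L).
  rewrite E; change (length (a0 :: L0)) with (Datatypes.S (length L0)). rewrite S_INR. have := pos_INR (length L0); lra.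
(* With [N] the length of [L], [N * t = 1 / 2] keeps [(1 - t) ^ N >= 1 / 2]. The comparison then
   reads [(1 + t * sum) / 2 <= 2], so [t * sum <= 3] and [sum <= 6 * N]. *)
pose t := / (2 * INR (length L)).
have HNt : INR (length L) * t = / 2 by rewrite /t; field; lra.
have Ht : 0 < t <= / 2 by split; [apply: Rinv_0_lt_compat|]; nra.
pose mu' := (t, z) :: map (fun p => ((1 - t) * fst p, snd p)) mu.
have Hok' : ok mu'.
  split.
  - move=> p [<- /=|]; first by lra. move/in_map_iff => [q [<- Hq]] /=.
    apply: Rmult_le_pos; [lra|exact: H1].
  - rewrite /mu' sumR_cons sumR_map /= (sumR_scal mu (1 - t) fst) H2; lra.
have HM' a : M mu' a = t * u a z + (1 - t) * M mu a.
  rewrite /M /mu' sumR_cons sumR_map /= -sumR_scal; congr (_ + _); apply: sumR_ext => p _; ring.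
pose v a := u a z / M mu a.
have Hv a : In a L -> 0 <= v a.
  move=> Ha; apply: Rmult_le_pos; first by case: (Hu a z). by apply/Rlt_le/Rinv_0_lt_compat/HMpos.
have HVV : V mu' <= 2 * V mu by have : V mu' <= S; [apply: HS1; exists mu'|lra].
have H3 : V mu * ((1 - t) ^ length L * (1 + t * sumR L v)) <= V mu'.
  apply: (Rle_trans _ (V mu * ((1 - t) ^ length L * prodR L (fun a => 1 + t * v a)))).
  - have HVpos : 0 <= V mu by lra. apply: Rmult_le_compat_l => //.
    apply: Rmult_le_compat_l; first by apply: pow_le; lra.
    rewrite -sumR_scal; apply: prodR_one_plus => a Ha. have := Hv a Ha; nra.
  - rewrite -prodR_const /V -!prodR_mult; apply: prodR_le => a Ha.
    have HM1 := HMpos a Ha. have Hv1 := Hv a Ha.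
    have H5 : 0 <= M mu a * v a by nra.
    split; first by apply: Rmult_le_pos; [lra|]; apply: Rmult_le_pos; nra.
    rewrite HM'. have -> : u a z = M mu a * v a by rewrite /v; field; lra.
    nra.
have H4 := bernoulli t (length L) ltac:(lra). rewrite HNt in H4.
have Hs : 0 <= sumR L v by apply: sumR_ge0.
have H5 : (1 - t) ^ length L * (1 + t * sumR L v) <= 2.
  apply: (Rmult_le_reg_l (V mu)); lra.
have H6 : 1 + t * sumR L v <= 4 by nra.
have H7 : INR (length L) * (t * sumR L v) <= INR (length L) * 3 by apply: Rmult_le_compat_l; lra.
rewrite -Rmult_assoc HNt in H7. rewrite /v /M in H7. lra.
Qed.

(** Averaging over the torus makes the monomials orthogonal, so the product of moments almost
    maximised by [design] is their Gram determinant, and the sum bounded here is the diagonal of the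
    reproducing kernel. *)
Lemma design_ball n (L : list (list nat)) (B : (nat -> C) -> Prop) :
  (forall z, B z -> forall i, (i < n)%nat -> Cmod (z i) <= 1) ->
  (exists x0, B x0 /\ forall i, (i < n)%nat -> x0 i <> RtoC 0) ->
  exists mu : list (R * (nat -> C)), (forall p, In p mu -> 0 <= fst p /\ B (snd p)) /\ sumR mu fst = 1 /\
   (forall l, In l L -> 0 < sumR mu (fun p => fst p * Cmod (mono n (snd p) (ext l)) ^ 2)) /\
   forall z, B z -> sumR L (fun l => Cmod (mono n z (ext l)) ^ 2 /
       sumR mu (fun p => fst p * Cmod (mono n (snd p) (ext l)) ^ 2)) <= 6 * INR (length L).
Proof.
move=> HB [x0 [Hx0 Hx0']].
have [mu [H1 [H2 [H3 H4]]]] := @design {z | B z} _ L (fun l x => Cmod (mono n (proj1_sig x) (ext l)) ^ 2) (exist _ x0 Hx0)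
  ltac:(move=> l [x Hx] /=; split; [exact: pow2_ge_0|]; have := Cmod_mono_le1 n x (ext l) (HB x Hx); have := Cmod_ge_0 (mono n x (ext l)); nra)
  ltac:(move=> l; apply: pow_lt; rewrite Cmod_mono; apply: prodR_gt0 => i /in_seq Hi; apply/pow_lt/Cmod_gt_0/Hx0'; lia).
exists (map (fun p => (fst p, proj1_sig (snd p))) mu); split; last split; last split.
- move=> p /in_map_iff [q [<- Hq]] /=; split; [exact: H1|exact: (proj2_sig (snd q))].
- by rewrite sumR_map.
- move=> l Hl; rewrite sumR_map; exact: H3.
- move=> z Hz. have := H4 (exist _ z Hz). rewrite [proj1_sig _]/= => H5. apply: Rle_trans H5; right.
  by apply: sumR_ext => l _; rewrite sumR_map.
Qed.

(** Cauchy-Schwarz after splitting each term into [sqrt M_l * c_l] and [z ^ l / sqrt M_l], where the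
    [M_l] are the moments of the design: passing from the supremum to a mean square costs 6 times
    the dimension. *)
Lemma nikolskii n M N (L : list (list nat)) (B : (nat -> C) -> Prop) :
  (M < N)%nat -> NoDup L -> incl L (mindices n M) ->
  (forall z, B z -> forall i, (i < n)%nat -> Cmod (z i) <= 1) ->
  (exists x0, B x0 /\ forall i, (i < n)%nat -> x0 i <> RtoC 0) ->
  exists mu : list (R * (nat -> C)), (forall p, In p mu -> 0 <= fst p /\ B (snd p)) /\ sumR mu fst = 1 /\
   forall c z, B z -> Cmod (mpoly n L c z) ^ 2 <= 6 * INR (length L) *
     sumR mu (fun p => fst p * avgR n N (fun w => Cmod (mpoly n L c (fun i => Cmult (snd p i) (w i))) ^ 2)).
Proof.
move=> HN HL Hi HB Hx0. have [mu [H1 [H2 [H3 H4]]]] := design_ball n L B HB Hx0.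
exists mu; split=> //; split=> // c z Hz.
pose Ml l := sumR mu (fun p => fst p * Cmod (mono n (snd p) (ext l)) ^ 2).
have -> : sumR mu (fun p => fst p * avgR n N (fun w => Cmod (mpoly n L c (fun i => Cmult (snd p i) (w i))) ^ 2))
  = sumR L (fun l => Cmod (c l) ^ 2 * Ml l).
  rewrite (sumR_ext _ _ (fun p => sumR L (fun l => Cmod (c l) ^ 2 * (fst p * Cmod (mono n (snd p) (ext l)) ^ 2)))).
  - rewrite sumR_swap; apply: sumR_ext => l _. by rewrite sumR_scal.
  - move=> p _. rewrite (avgR_ext _ _ _ (fun w => Cmod (mpoly n L (fun l => Cmult (c l) (mono n (snd p) (ext l))) w) ^ 2)); last first.
      by move=> g; rewrite mpoly_scale.
    rewrite (parseval n M) // -sumR_scal; apply: sumR_ext => l _. rewrite Cmod_mult; ring.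
have H5 := H4 z Hz.
apply: (Rle_trans _ (sumR L (fun l => sqrt (Ml l) * Cmod (c l) * (Cmod (mono n z (ext l)) / sqrt (Ml l))) ^ 2)).
  apply: pow_incr; split; first exact: Cmod_ge_0.
  apply: Rle_trans (Cmod_sum _ _) _. right; apply: sumR_ext => l Hl.
  rewrite Cmod_mult; field. apply: Rgt_not_eq; apply: sqrt_lt_R0; exact: H3.
apply: Rle_trans (cauchy_schwarz _ _ _) _.
rewrite Rmult_comm. apply: Rmult_le_compat.
- by apply: sumR_ge0 => l _; apply: pow2_ge_0.
- by apply: sumR_ge0 => l _; apply: pow2_ge_0.
- apply: Rle_trans H5; right; apply: sumR_ext => l Hl.
  have Hs : sqrt (Ml l) ^ 2 = Ml l by apply: pow2_sqrt; apply/Rlt_le/H3.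
  have Hs0 : 0 < sqrt (Ml l) by apply/sqrt_lt_R0/H3.
  rewrite /Rdiv Rpow_mult_distr pow_inv Hs //.
- right; apply: sumR_ext => l Hl.
  have Hs : sqrt (Ml l) ^ 2 = Ml l by apply: pow2_sqrt; apply/Rlt_le/H3.
  rewrite Rpow_mult_distr Hs; ring.
Qed.

(** * Lorentz norms *)

Lemma insert_desc_perm x l : Permutation (insert_desc x l) (x :: l).
Proof.
elim: l => [|y l IH] //=. case: Rle_dec => _ //. rewrite IH; exact: perm_swap.
Qed.
Lemma sort_desc_perm l : Permutation (sort_desc l) l.
Proof. elim: l => [|x l IH] //=. by rewrite insert_desc_perm IH. Qed.

Notation desc := (StronglySorted (fun x y : R => y <= x)).

Lemma insert_desc_sorted x l : desc l -> desc (insert_desc x l).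
Proof.
elim: l => [|y l IH] H /=; first by repeat constructor.
inversion H; subst. case: Rle_dec => Hxy.
- constructor=> //. constructor=> //. apply: Forall_impl H3 => z; lra.
- constructor; first exact: IH. rewrite Forall_forall => z Hz.
  have := Permutation_in _ (insert_desc_perm x l) Hz. case=> [<-|]; first by lra.
  rewrite Forall_forall in H3; exact: H3.
Qed.
Lemma sort_desc_sorted l : desc (sort_desc l).
Proof. elim: l => [|x l IH] /=; [constructor|exact: insert_desc_sorted]. Qed.

(** Two insertions into comparable lists may stop at different places; here the left one has already
    stopped, in [Forall2_insert_l] the right one. Sorting is thereby monotone, and so is the Lorentz
    norm in the moduli. *)
Lemma Forall2_insert_r y l x l' : Forall2 Rle l l' -> desc (y :: l) -> y <= x -> Forall2 Rle (y :: l) (insert_desc x l').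
Proof.
move=> H; elim: H y => {l l'} [|y1 y1' l l' Hy H IH] y Hs Hyx /=; first by constructor=> //; constructor.
inversion Hs; subst. inversion H3; subst. case: Rle_dec => Hd.
- constructor=> //. by constructor.
- constructor; first by lra. apply: IH => //; lra.
Qed.
Lemma Forall2_insert_l x l y l' : Forall2 Rle l l' -> desc (y :: l') -> x <= y -> Forall2 Rle (insert_desc x l) (y :: l').
Proof.
move=> H; elim: H y => {l l'} [|y1 y1' l l' Hy H IH] y Hs Hyx /=; first by constructor=> //; constructor.
inversion Hs; subst. inversion H3; subst. case: Rle_dec => Hd.
- constructor=> //. by constructor.
- constructor; first by lra. apply: IH => //; lra.
Qed.
Lemma Forall2_insert x x' l l' : x <= x' -> Forall2 Rle l l' -> desc l -> desc l' ->
  Forall2 Rle (insert_desc x l) (insert_desc x' l').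
Proof.
move=> Hx H; elim: H => {l l'} [|y y' l l' Hy H IH] Hs Hs' /=; first by constructor=> //; constructor.
inversion Hs; subst. inversion Hs'; subst.
case: Rle_dec => Hd; case: Rle_dec => Hd'.
- by constructor=> //; constructor.
- constructor; first by lra. apply: Forall2_insert_r => //; lra.
- constructor; first by lra. apply: Forall2_insert_l => //; lra.
- constructor=> //. exact: IH.
Qed.
Lemma Forall2_sort l l' : Forall2 Rle l l' -> Forall2 Rle (sort_desc l) (sort_desc l').
Proof. elim=> [|x y {}l {}l' Hxy _ IH] /=; first by constructor. apply: Forall2_insert => //; exact: sort_desc_sorted. Qed.

Lemma zstar_le n z w k : (forall i, (i < n)%nat -> Cmod (z i) <= Cmod (w i)) -> zstar n z k <= zstar n w k.
Proof.
move=> H. rewrite /zstar.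
have : Forall2 Rle (sort_desc (map (fun i => Cmod (z i)) (seq 0 n))) (sort_desc (map (fun i => Cmod (w i)) (seq 0 n))).
  apply: Forall2_sort. have : forall i, In i (seq 0 n) -> Cmod (z i) <= Cmod (w i) by move=> i /in_seq Hi; apply: H; lia.
  elim: (seq 0 n) => [|a s IH] H' /=; constructor; first by apply: H'; left.
  by apply: IH => i Hi; apply: H'; right.
elim: (k - 1)%nat (sort_desc _) (sort_desc _) => [|j IH] l l' [|x y {}l {}l' Hxy Hl] /=; try lra.
exact: IH.
Qed.
Lemma length_sort_desc l : length (sort_desc l) = length l.
Proof. exact/Permutation_length/sort_desc_perm. Qed.
Lemma zstar_in n z k : (1 <= k <= n)%nat -> exists i, (i < n)%nat /\ zstar n z k = Cmod (z i).
Proof.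
move=> Hk. have : In (zstar n z k) (sort_desc (map (fun i => Cmod (z i)) (seq 0 n))).
  apply: nth_In. rewrite length_sort_desc length_map length_seq; lia.
move/(Permutation_in _ (sort_desc_perm _))/in_map_iff => [i [<- /in_seq Hi]]. exists i; split=> //; lia.
Qed.
Lemma zstar_ge0 n z k : 0 <= zstar n z k.
Proof.
rewrite /zstar. case: (Nat.lt_ge_cases (k - 1) (length (sort_desc (map (fun i => Cmod (z i)) (seq 0 n))))) => H.
- have := nth_In _ 0 H. move/(Permutation_in _ (sort_desc_perm _))/in_map_iff => [i [<- _]]. exact: Cmod_ge_0.
- rewrite nth_overflow //; lra.
Qed.
Lemma zstar_1 n z i : (i < n)%nat -> Cmod (z i) <= zstar n z 1.
Proof.
move=> Hi. rewrite /zstar.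
have := sort_desc_sorted (map (fun i => Cmod (z i)) (seq 0 n)).
have : In (Cmod (z i)) (sort_desc (map (fun i => Cmod (z i)) (seq 0 n))).
  apply: (Permutation_in _ (Permutation_sym (sort_desc_perm _))). apply/in_map_iff; exists i; split=> //. apply/in_seq; lia.
case: (sort_desc _) => [|x l] //= [->|H] Hs; first by lra.
inversion Hs; subst. move/Forall_forall: H3 => H3. exact: H3.
Qed.
Lemma zstar_desc n z j k : (j <= k)%nat -> zstar n z k <= zstar n z j.
Proof.
move=> Hjk. rewrite /zstar.
have : (forall l j k, desc l -> (j <= k)%nat -> (forall x, In x l -> 0 <= x) -> nth k l 0 <= nth j l 0).
  elim=> [|x l IH] [|a] [|b] Hs Hab H /=; try lra; try lia; inversion Hs; subst.
  - case: (Nat.lt_ge_cases b (length l)) => Hb; last by rewrite nth_overflow //; apply: H; left.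
    move/Forall_forall: H3 => H3; apply: H3; exact: nth_In.
  - apply: IH => //; first lia. by move=> y Hy; apply: H; right.
apply; [exact: sort_desc_sorted|lia|].
move=> x /(Permutation_in _ (sort_desc_perm _))/in_map_iff [i [<- _]]. exact: Cmod_ge_0.
Qed.
Lemma zstar_sum n z f : sumR (seq 1 n) (fun k => f (zstar n z k)) = sumR (seq 0 n) (fun i => f (Cmod (z i))).
Proof.
rewrite -(sumR_map (fun i => Cmod (z i))) -(sumR_perm _ _ f (sort_desc_perm _)).
have -> : seq 1 n = map S (seq 0 n) by rewrite seq_shift.
rewrite sumR_map /zstar. set l := sort_desc _.
have : length l = n by rewrite /l length_sort_desc length_map length_seq.
move: l => l Hl. rewrite (sumR_ext _ _ (fun i => f (nth i l 0))); last by move=> i _; congr f; congr nth; lia.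
elim: l n Hl => [|x l IH] [|n] // [Hl]. by rewrite sumR_seq_S sumR_cons /= IH.
Qed.

(** * The Lorentz norm: monotonicity, constant vectors, decay of the rearrangement *)

Lemma rpow0_ge0 x y : 0 <= rpow0 x y.
Proof. rewrite /rpow0; case: Rle_dec => _; [lra|apply/Rlt_le/exp_pos]. Qed.
Lemma rpow0_pos x y : 0 < x -> rpow0 x y = Rpower x y.
Proof. move=> H; rewrite /rpow0; case: Rle_dec => // ?; lra. Qed.
Lemma rpow0_le x y p : 0 < p -> x <= y -> rpow0 x p <= rpow0 y p.
Proof.
move=> Hp Hxy. rewrite {1}/rpow0; case: Rle_dec => Hx; first exact: rpow0_ge0.
rewrite rpow0_pos; last lra. apply: Rle_Rpower_l; lra.
Qed.
Lemma Rpower_pos x y : 0 < Rpower x y.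
Proof. exact: exp_pos. Qed.
Lemma rpow0_inv x s : 0 <= x -> 0 < s -> rpow0 (rpow0 x s) (/ s) = x.
Proof.
move=> Hx Hs; case: (Rle_lt_or_eq_dec _ _ Hx) => [H|<-].
- rewrite (rpow0_pos x) // rpow0_pos; last exact: Rpower_pos. rewrite Rpower_mult Rinv_r; last lra. exact: Rpower_1.
- rewrite {2}/rpow0; case: Rle_dec => // ?; last lra. rewrite /rpow0; case: Rle_dec => // ?; lra.
Qed.

Lemma maxl_ge0 {A} (l : list A) f : 0 <= fold_right Rmax 0 (map f l).
Proof. elim: l => [|x l IH] /=; first by lra. apply: Rle_trans IH _; exact: Rmax_r. Qed.
Lemma maxl_le {A} (l : list A) f M : 0 <= M -> (forall x, In x l -> f x <= M) -> fold_right Rmax 0 (map f l) <= M.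
Proof.
move=> HM; elim: l => [|x l IH] H //=. apply: Rmax_lub; first by apply: H; left.
by apply: IH => y Hy; apply: H; right.
Qed.
Lemma maxl_in {A} (l : list A) f x : In x l -> f x <= fold_right Rmax 0 (map f l).
Proof.
elim: l => [|y l IH] // [->|H] /=; first exact: Rmax_l. apply: Rle_trans (IH H) _; exact: Rmax_r.
Qed.

Lemma lorentz_finE r s0 n z : lorentz r (Finite s0) n z =
  rpow0 (sumR (seq 1 n) (fun k => rpow0 (zstar n z k * Rpower (INR k) (/ r - / s0)) s0)) (/ s0).
Proof. by []. Qed.

Lemma lorentz_le r s n z w : Rbar_le (Finite 1) s ->
  (forall i, (i < n)%nat -> Cmod (z i) <= Cmod (w i)) -> lorentz r s n z <= lorentz r s n w.
Proof.
move=> Hs H. case: s Hs => [s0|_|] //.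
- move=> Hs; change (1 <= s0) in Hs. rewrite !lorentz_finE. apply: rpow0_le; first by apply: Rinv_0_lt_compat; lra.
  apply: sumR_le => k _. apply: rpow0_le; first by lra.
  apply: Rmult_le_compat_r; [apply/Rlt_le/Rpower_pos|exact: zstar_le].
- rewrite /lorentz. apply: maxl_le; first exact: maxl_ge0. move=> k Hk.
  apply: Rle_trans (maxl_in _ (fun k => zstar n w k * Rpower (INR k) (/ r)) k Hk).
  apply: Rmult_le_compat_r; [apply/Rlt_le/Rpower_pos|exact: zstar_le].
Qed.

Lemma Rpower_one_l y : Rpower 1 y = 1.
Proof. by rewrite /Rpower ln_1 Rmult_0_r exp_0. Qed.

(** The weight at [k = 1] is 1, so the norm dominates the largest modulus: the ball lies in the
    polydisc. *)
Lemma Cmod_le_lorentz r s n z i : Rbar_le (Finite 1) s -> (i < n)%nat -> Cmod (z i) <= lorentz r s n z.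
Proof.
move=> Hs Hi. apply: Rle_trans (zstar_1 n z i Hi) _.
have H1 : In 1%nat (seq 1 n) by apply/in_seq; lia.
case: s Hs => [s0|_|] //.
- move=> Hs; change (1 <= s0) in Hs. rewrite lorentz_finE -{1}(rpow0_inv (zstar n z 1) s0); [|exact: zstar_ge0|lra].
  apply: rpow0_le; first by apply: Rinv_0_lt_compat; lra.
  have := sumR_term_le (seq 1 n) (fun k => rpow0 (zstar n z k * Rpower (INR k) (/ r - / s0)) s0) 1%nat (fun _ _ => rpow0_ge0 _ _) H1.
  by rewrite /= Rpower_one_l Rmult_1_r.
- have := maxl_in (seq 1 n) (fun k => zstar n z k * Rpower (INR k) (/ r)) 1%nat H1.
  by rewrite /= Rpower_one_l Rmult_1_r.
Qed.

Lemma Rpower_mvt a x y : 0 < x < y -> exists c, x < c < y /\ Rpower y a - Rpower x a = a * Rpower c (a - 1) * (y - x).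
Proof.
move=> Hxy. have [c [Hc1 Hc2]] := MVT_cor2 (fun t => Rpower t a) (fun t => a * Rpower t (a - 1)) x y (proj2 Hxy)
  ltac:(move=> c Hc; apply: derivable_pt_lim_power; lra).
by exists c.
Qed.

(** Each inequality comes from the mean value theorem for one of [a >= 1], [a < 1] and from
    [t ^ a = t * t ^ (a - 1)] for the other, because [t ^ (a - 1)] changes its monotonicity at
    [a = 1]. *)
Lemma Rpower_increment a x : 0 < a -> 0 < x ->
  Rpower (x + 1) a - Rpower x a <= (1 + a) * Rpower (x + 1) (a - 1) /\
  Rpower (x + 1) (a - 1) <= (1 + / a) * (Rpower (x + 1) a - Rpower x a).
Proof.
move=> Ha Hx; have Ha' : 0 < / a by apply: Rinv_0_lt_compat.
have [c [Hc1 Hc2]] := Rpower_mvt a x (x + 1) ltac:(lra).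
have HP := Rpower_pos (x + 1) (a - 1). have Hc := Rpower_pos c (a - 1).
have E y : 0 < y -> Rpower y a = y * Rpower y (a - 1).
  by move=> Hy; rewrite -{2}(Rpower_1 y) // -Rpower_plus; congr Rpower; lra.
have Hanti y z : a < 1 -> 0 < y <= z -> Rpower z (a - 1) <= Rpower y (a - 1).
  move=> H Hyz. have -> : a - 1 = - (1 - a) by lra. rewrite !Rpower_Ropp.
  apply: Rinv_le_contravar; [exact: Rpower_pos|apply: Rle_Rpower_l; lra].
case: (Rle_lt_dec 1 a) => H; split.
- have H2 : Rpower c (a - 1) <= Rpower (x + 1) (a - 1) by apply: Rle_Rpower_l; lra.
  rewrite Hc2; nra.
- have H2 : Rpower x (a - 1) <= Rpower (x + 1) (a - 1) by apply: Rle_Rpower_l; lra.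
  rewrite !E; try lra.
  have H3 : Rpower (x + 1) (a - 1) <= (x + 1) * Rpower (x + 1) (a - 1) - x * Rpower x (a - 1) by nra. nra.
- have H2 := Hanti x (x + 1) H ltac:(lra). rewrite !E; try lra. nra.
- have H2 := Hanti c (x + 1) H ltac:(lra). rewrite Hc2.
  have -> : (1 + / a) * (a * Rpower c (a - 1) * (x + 1 - x)) = (a + 1) * Rpower c (a - 1) by field; lra. nra.
Qed.

Lemma sum_power_S b n : sumR (seq 1 (S (S n))) (fun j => Rpower (INR j) b) =
  sumR (seq 1 (S n)) (fun j => Rpower (INR j) b) + Rpower (INR (S n) + 1) b.
Proof. rewrite seq_S sumR_app -S_INR; congr Rplus. exact: Rplus_0_r. Qed.

(** [Rpower_increment] summed. It serves with [a = s / r] for Lorentz norms and with [a = 1 - 2 / r]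
    for sums of squares. *)
Lemma sum_power_bounds a n : 0 < a ->
  Rpower (INR (S n)) a <= (1 + a) * sumR (seq 1 (S n)) (fun j => Rpower (INR j) (a - 1)) /\
  sumR (seq 1 (S n)) (fun j => Rpower (INR j) (a - 1)) <= (1 + / a) * Rpower (INR (S n)) a.
Proof.
move=> Ha; have Ha' : 0 < / a by apply: Rinv_0_lt_compat.
elim: n => [|n [IH1 IH2]]; first by rewrite /sumR /= !Rpower_one_l; lra.
have [H1 H2] := Rpower_increment a (INR (S n)) Ha (lt_0_INR (S n) ltac:(lia)).
rewrite sum_power_S (S_INR (S n)). lra.
Qed.

Lemma Rpower_lt1_inv x p : 0 < p -> rpow0 x p < 1 -> x < 1.
Proof.
move=> Hp H. apply: Rnot_le_lt => Hx. have := rpow0_le 1 x p Hp Hx.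
rewrite rpow0_pos; last lra. rewrite Rpower_one_l; lra.
Qed.

Lemma zstar_const n (x : C) k : (1 <= k <= n)%nat -> zstar n (fun _ => x) k = Cmod x.
Proof. by move=> Hk; have [i [_ ->]] := zstar_in n (fun _ => x) k Hk. Qed.

(** For finite [s] the weights add up to [sum_k k ^ (s / r - 1)], of order [n ^ (s / r)]; for
    infinite [s] the weight at [k = n] is the largest. So a constant vector of height of order
    [n ^ (- 1 / r)] lies in the ball. *)
Lemma lorentz_const r s : 2 <= r -> Rbar_le (Finite 1) s ->
  exists A, 0 < A /\ forall n (x : R), (0 < n)%nat -> 0 < x ->
    lorentz r s n (fun _ => RtoC x) <= A * x * Rpower (INR n) (/ r).
Proof.
move=> Hr Hs. have Hir : 0 < / r by apply: Rinv_0_lt_compat; lra.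
case: s Hs => [s0|_|] //.
- move=> Hs; change (1 <= s0) in Hs. have His : 0 < / s0 by apply: Rinv_0_lt_compat; lra.
  have Ha : 0 < s0 / r by apply: Rmult_lt_0_compat; lra.
  exists (Rpower (1 + / (s0 / r)) (/ s0)); split; first exact: Rpower_pos.
  move=> n x Hn Hx.
  have Hn0 : 0 < INR n by apply: lt_0_INR.
  have Hb : 0 < 1 + / (s0 / r) by have := Rinv_0_lt_compat _ Ha; lra.
  rewrite -(rpow0_inv (_ * _) s0); [|by do ?apply: Rmult_le_pos; try exact: Rlt_le; apply/Rlt_le/Rpower_pos|lra].
  rewrite lorentz_finE. apply: rpow0_le => //.
  have E1 : rpow0 (Rpower (1 + / (s0 / r)) (/ s0) * x * Rpower (INR n) (/ r)) s0 =
     Rpower x s0 * ((1 + / (s0 / r)) * Rpower (INR n) (s0 / r)).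
    rewrite rpow0_pos; last by do ?apply: Rmult_lt_0_compat => //; exact: Rpower_pos.
    rewrite -!Rpower_mult_distr //; try exact: Rpower_pos; last by apply: Rmult_lt_0_compat => //; exact: Rpower_pos.
    rewrite !Rpower_mult Rinv_l; last lra. rewrite Rpower_1 //.
    have -> : / r * s0 = s0 / r by rewrite /Rdiv; ring. ring.
  rewrite E1.
  rewrite (sumR_ext _ _ (fun k => Rpower x s0 * Rpower (INR k) (s0 / r - 1))).
  + rewrite sumR_scal. apply: Rmult_le_compat_l; first by apply/Rlt_le/Rpower_pos.
    case: n Hn {Hn0 E1} => [|n] Hn; first by lia. by case: (sum_power_bounds (s0 / r) n Ha).
  + move=> k /in_seq Hk. rewrite zstar_const; last lia. rewrite Cmod_R Rabs_pos_eq; last lra.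
    rewrite rpow0_pos; last by apply: Rmult_lt_0_compat => //; exact: Rpower_pos.
    rewrite -Rpower_mult_distr //; last exact: Rpower_pos. rewrite Rpower_mult; congr (_ * Rpower _ _). field; lra.
- exists 1; split; first lra. move=> n x Hn Hx. apply: maxl_le; first by have := Rpower_pos (INR n) (/ r) => ?; nra.
  move=> k /in_seq Hk. rewrite zstar_const; last lia. rewrite Cmod_R Rabs_pos_eq; last lra. rewrite Rmult_1_l.
  apply: Rmult_le_compat_l; first lra. apply: Rle_Rpower_l; first lra.
  split; [apply: lt_0_INR; lia|apply: le_INR; lia].
Qed.

(** The inclusion into the weak space. As the rearrangement decreases, its first [k] terms in the
    norm are at least [(zstar k) ^ s * j ^ (s / r - 1)] for [j <= k], and they sum to less than
    1. *)
Lemma zstar_weak r s : 2 <= r -> Rbar_le (Finite 1) s ->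
  exists D, 0 < D /\ forall n z k, lorentz r s n z < 1 -> (1 <= k <= n)%nat ->
    zstar n z k <= D * Rpower (INR k) (- / r).
Proof.
move=> Hr Hs. have Hir : 0 < / r by apply: Rinv_0_lt_compat; lra.
case: s Hs => [s0|_|] //.
- move=> Hs; change (1 <= s0) in Hs. have His : 0 < / s0 by apply: Rinv_0_lt_compat; lra.
  have Ha : 0 < s0 / r by apply: Rmult_lt_0_compat; lra.
  exists (Rpower (1 + s0 / r) (/ s0)); split; first exact: Rpower_pos.
  move=> n z k Hz Hk. have Hk0 : 0 < INR k by apply: lt_0_INR; lia.
  case: (Rle_lt_or_eq_dec _ _ (zstar_ge0 n z k)) => [Hzk|<-]; last first.
    by apply: Rmult_le_pos; apply/Rlt_le/Rpower_pos.
  rewrite -[X in X <= _](rpow0_inv _ s0); [|lra|lra].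
  rewrite -[X in _ <= X](rpow0_inv _ s0); [|by apply: Rmult_le_pos; apply/Rlt_le/Rpower_pos|lra].
  apply: rpow0_le => //. rewrite !rpow0_pos //; last by apply: Rmult_lt_0_compat; exact: Rpower_pos.
  rewrite -Rpower_mult_distr; try exact: Rpower_pos. rewrite !Rpower_mult Rinv_l; last lra. rewrite Rpower_1; last lra.
  have -> : - / r * s0 = - (s0 / r) by rewrite /Rdiv; ring.
  rewrite Rpower_Ropp. apply: (Rmult_le_reg_r (Rpower (INR k) (s0 / r))); first exact: Rpower_pos.
  rewrite Rmult_assoc Rinv_l; last by apply/Rgt_not_eq/Rpower_pos. rewrite Rmult_1_r.
  rewrite lorentz_finE in Hz. have Hz1 := Rpower_lt1_inv _ _ His Hz.
  have H1 : Rpower (zstar n z k) s0 * sumR (seq 1 k) (fun j => Rpower (INR j) (s0 / r - 1)) <= 1.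
    apply: Rle_trans (Rlt_le _ _ Hz1).
    have -> : n = (k + (n - k))%nat by lia. rewrite seq_app sumR_app.
    have H0 : 0 <= sumR (seq (1 + k) (n - k)) (fun k0 => rpow0 (zstar (k + (n - k)) z k0 * Rpower (INR k0) (/ r - / s0)) s0).
      by apply: sumR_ge0 => j _; apply: rpow0_ge0.
    have -> : (k + (n - k))%nat = n by lia.
    apply: (Rle_trans _ (sumR (seq 1 k) (fun k0 => rpow0 (zstar n z k0 * Rpower (INR k0) (/ r - / s0)) s0))); last first.
      have E : (k + (n - k))%nat = n by lia. rewrite E in H0. lra.
    rewrite -sumR_scal; apply: sumR_le => j /in_seq Hj.
    have -> : s0 / r - 1 = (/ r - / s0) * s0 by field; lra.
    rewrite -Rpower_mult Rpower_mult_distr //; last exact: Rpower_pos.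
    rewrite -rpow0_pos; last by apply: Rmult_lt_0_compat => //; exact: Rpower_pos.
    apply: rpow0_le; first lra. apply: Rmult_le_compat_r; first by apply/Rlt_le/Rpower_pos.
    apply: zstar_desc; lia.
  have [k' Ek] : exists k', k = S k' by case: k Hk {Hk0 Hzk H1} => [|k'] Hk; [lia|exists k'].
  have [H2 _] := sum_power_bounds (s0 / r) k' Ha. rewrite -Ek in H2.
  have HP := Rpower_pos (zstar n z k) s0.
  apply: (Rle_trans _ (Rpower (zstar n z k) s0 * ((1 + s0 / r) * sumR (seq 1 k) (fun j => Rpower (INR j) (s0 / r - 1))))).
    by apply: Rmult_le_compat_l => //; lra.
  have : (1 + s0 / r) * (Rpower (zstar n z k) s0 * sumR (seq 1 k) (fun j => Rpower (INR j) (s0 / r - 1))) <= (1 + s0 / r) * 1.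
    by apply: Rmult_le_compat_l => //; lra.
  lra.
- exists 1; split; first lra. move=> n z k Hz Hk.
  have := maxl_in (seq 1 n) (fun k => zstar n z k * Rpower (INR k) (/ r)) k ltac:(apply/in_seq; lia).
  rewrite /lorentz in Hz => H. rewrite Rpower_Ropp Rmult_1_l.
  have HP := Rpower_pos (INR k) (/ r). apply: (Rmult_le_reg_r (Rpower (INR k) (/ r))) => //.
  rewrite Rinv_l; lra.
Qed.

Lemma pow2_Rpower x : 0 < x -> x ^ 2 = Rpower x 2.
Proof. by move=> Hx; rewrite -(Rpower_pow 2 x Hx). Qed.

(** For [r > 2] this follows from [zstar_weak] and the size of [sum_k k ^ (- 2 / r)]. At [r = 2]
    that sum is logarithmic; instead [x ^ 2 = x ^ s * x ^ (2 - s)] with the weak bound on the second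
    factor, which restores the Lorentz weight and uses [s <= 2]. This is where the cases (A) and (B)
    enter. *)
Lemma sum_sq_bound r s : 2 <= r -> Rbar_le (Finite 1) s -> (2 < r \/ (r = 2 /\ Rbar_le s (Finite 2))) ->
  exists A, 0 < A /\ forall n z, (0 < n)%nat -> lorentz r s n z < 1 ->
    sumR (seq 0 n) (fun i => Cmod (z i) ^ 2) <= A * Rpower (INR n) (1 - 2 / r).
Proof.
move=> Hr Hs Hc. have [D [HD HD']] := zstar_weak r s Hr Hs.
have Hir : 0 < / r by apply: Rinv_0_lt_compat; lra.
case: Hc => [H2|[E H2]].
- have Ha : 0 < 1 - 2 / r.
    have : 2 / r < 1 by apply: (Rmult_lt_reg_r r); [lra|]; rewrite /Rdiv Rmult_assoc Rinv_l; lra. lra.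
  exists (D ^ 2 * (1 + / (1 - 2 / r))); split.
    by apply: Rmult_lt_0_compat; [apply: pow_lt|have := Rinv_0_lt_compat _ Ha; lra].
  move=> n z Hn Hz. rewrite -(zstar_sum n z (fun x => x ^ 2)).
  apply: (Rle_trans _ (D ^ 2 * sumR (seq 1 n) (fun k => Rpower (INR k) ((1 - 2 / r) - 1)))).
  + rewrite -sumR_scal; apply: sumR_le => k /in_seq Hk.
    have H := HD' n z k Hz ltac:(lia). have -> : 1 - 2 / r - 1 = - / r + - / r by field; lra.
    rewrite Rpower_plus. have := zstar_ge0 n z k. nra.
  + rewrite Rmult_assoc; apply: Rmult_le_compat_l; first exact: pow2_ge_0.
    case: n Hn {Hz} => [|n] Hn; first by lia. by case: (sum_power_bounds (1 - 2 / r) n Ha).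
- subst r. case: s Hs H2 HD' => [s0|_|] //. move=> Hs H2 HD'; change (1 <= s0) in Hs; change (s0 <= 2) in H2.
  have His : 0 < / s0 by apply: Rinv_0_lt_compat; lra.
  exists (Rpower D (2 - s0)); split; first exact: Rpower_pos.
  move=> n z Hn Hz. rewrite -(zstar_sum n z (fun x => x ^ 2)).
  have -> : 1 - 2 / 2 = 0 by field. rewrite Rpower_O; last by apply: lt_0_INR.
  rewrite Rmult_1_r.
  have Hz1 := Hz. rewrite lorentz_finE in Hz1. have Hz2 := Rpower_lt1_inv _ _ His Hz1.
  apply: (Rle_trans _ (Rpower D (2 - s0) * sumR (seq 1 n) (fun k => rpow0 (zstar n z k * Rpower (INR k) (/ 2 - / s0)) s0))); last first.
    have := Rpower_pos D (2 - s0). nra.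
  rewrite -sumR_scal; apply: sumR_le => k /in_seq Hk.
  have Hk0 : 0 < INR k by apply: lt_0_INR; lia.
  have H := HD' n z k Hz ltac:(lia).
  case: (Rle_lt_or_eq_dec _ _ (zstar_ge0 n z k)) => [Hzk|<-]; last first.
    rewrite pow_ne_zero //. apply: Rmult_le_pos; [apply/Rlt_le/Rpower_pos|exact: rpow0_ge0].
  rewrite rpow0_pos; last by apply: Rmult_lt_0_compat => //; exact: Rpower_pos.
  rewrite -Rpower_mult_distr //; last exact: Rpower_pos.
  rewrite pow2_Rpower // Rpower_mult. have {1}-> : 2 = s0 + (2 - s0) by lra.
  rewrite Rpower_plus.
  have H3 : Rpower (zstar n z k) (2 - s0) <= Rpower (D * Rpower (INR k) (- / 2)) (2 - s0) by apply: Rle_Rpower_l; lra.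
  rewrite -Rpower_mult_distr // in H3; last exact: Rpower_pos. rewrite Rpower_mult in H3.
  have E : - / 2 * (2 - s0) = (/ 2 - / s0) * s0 by field; lra.
  rewrite E in H3. have := Rpower_pos (zstar n z k) s0. nra.
Qed.

(** * The sup norm *)

Lemma lorentz_0 r s n : Rbar_le (Finite 1) s -> lorentz r s n (fun _ => RtoC 0) = 0.
Proof.
have Hz k : In k (seq 1 n) -> zstar n (fun _ => RtoC 0) k = 0.
  move=> /in_seq Hk. rewrite zstar_const ?Cmod_0 //; lia.
case: s => [s0|_|] //.
- move=> Hs; change (1 <= s0) in Hs. rewrite lorentz_finE sumR_0.
  + rewrite /rpow0; case: Rle_dec => // ?; lra.
  + move=> k Hk. rewrite Hz // Rmult_0_l /rpow0; case: Rle_dec => // ?; lra.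
- apply: Rle_antisym; last exact: maxl_ge0. apply: maxl_le; first lra. move=> k Hk. rewrite Hz // Rmult_0_l; lra.
Qed.

(** A point off the coordinate hyperplanes: no monomial vanishes there, so the maximisation in
    [design] starts from a positive value. *)
Lemma ball_interior r s n : 2 <= r -> Rbar_le (Finite 1) s ->
  exists x0, lorentz r s n x0 < 1 /\ forall i, (i < n)%nat -> x0 i <> RtoC 0.
Proof.
move=> Hr Hs. case: (Nat.eq_dec n 0) => [->|Hn].
  exists (fun _ => RtoC 0); split; last by move=> i; lia. rewrite lorentz_0 //; lra.
have [A [HA H]] := lorentz_const r s Hr Hs.
have HP := Rpower_pos (INR n) (/ r).
have H2 : 0 < 2 * A * Rpower (INR n) (/ r) by nra.
exists (fun _ => RtoC (/ (2 * A * Rpower (INR n) (/ r)))); split.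
- apply: Rle_lt_trans (H n _ _ _) _; [lia|exact: Rinv_0_lt_compat|].
  have -> : A * / (2 * A * Rpower (INR n) (/ r)) * Rpower (INR n) (/ r) = / 2 by field; lra. lra.
- move=> i _ /RtoC_inj E. have := Rinv_0_lt_compat _ H2; lra.
Qed.

Lemma peval_mpoly n m c z : peval n m c z = mpoly n (mindices n m) (fun l => c (ext l)) z.
Proof. by []. Qed.

Lemma Cmod_mpoly_le n L c z : (forall i, (i < n)%nat -> Cmod (z i) <= 1) ->
  Cmod (mpoly n L c z) <= sumR L (fun l => Cmod (c l)).
Proof.
move=> Hz. apply: Rle_trans (Cmod_sum _ _) _. apply: sumR_le => l _. rewrite Cmod_mult.
have := Cmod_mono_le1 n z (ext l) Hz. have := Cmod_ge_0 (c l). nra.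
Qed.

Lemma Lub_Rbar_is_lub E : bound E -> (exists x, E x) -> is_lub E (real (Lub_Rbar E)).
Proof.
move=> Hb [x0 Hx0]. have [S [H1 H2]] := completeness E Hb (ex_intro _ x0 Hx0).
have -> : Lub_Rbar E = Finite S; last by [].
apply: is_lub_Rbar_unique; split; first by move=> x Hx; apply: H1.
case=> [b|//|] Hb'; last by case: (Hb' _ Hx0). apply: H2 => x Hx. exact: (Hb' x).
Qed.

Section Supnorm.
Variables (r : R) (s : Rbar) (n m : nat).
Hypothesis Hs : Rbar_le (Finite 1) s.

Lemma ball_le1 z i : lorentz r s n z < 1 -> (i < n)%nat -> Cmod (z i) <= 1.
Proof. move=> Hz Hi. have := Cmod_le_lorentz r s n z i Hs Hi; lra. Qed.

Lemma ball_shrink z w : lorentz r s n z < 1 -> (forall i, (i < n)%nat -> Cmod (w i) <= Cmod (z i)) ->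
  lorentz r s n w < 1.
Proof. move=> Hz H. have := lorentz_le r s n w z Hs H; lra. Qed.

Lemma ball_scale z w : lorentz r s n z < 1 -> (forall i, (i < n)%nat -> Cmod (w i) <= 1) ->
  lorentz r s n (fun i => Cmult (z i) (w i)) < 1.
Proof.
move=> Hz H. apply: (ball_shrink z) => // i Hi. rewrite Cmod_mult. have := H i Hi. have := Cmod_ge_0 (z i). nra.
Qed.

Lemma supnorm_is_lub c : is_lub (fun t => exists z, lorentz r s n z < 1 /\ t = Cmod (peval n m c z)) (supnorm r s n m c).
Proof.
apply: Lub_Rbar_is_lub.
- exists (sumR (mindices n m) (fun l => Cmod (c (ext l)))) => t [z [Hz ->]].
  rewrite peval_mpoly; apply: Cmod_mpoly_le => i Hi. exact: (ball_le1 z).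
- eexists; exists (fun _ => RtoC 0); split; last by []. rewrite lorentz_0 //; lra.
Qed.

Lemma supnorm_ub c z : lorentz r s n z < 1 -> Cmod (peval n m c z) <= supnorm r s n m c.
Proof. move=> Hz. case: (supnorm_is_lub c) => H _. by apply: H; exists z. Qed.
Lemma supnorm_lub c M : (forall z, lorentz r s n z < 1 -> Cmod (peval n m c z) <= M) -> supnorm r s n m c <= M.
Proof. move=> H. case: (supnorm_is_lub c) => _ H'. by apply: H' => t [z [Hz ->]]; apply: H. Qed.
Lemma supnorm_ge0 c : 0 <= supnorm r s n m c.
Proof.
apply: Rle_trans (supnorm_ub c (fun _ => RtoC 0) _); first exact: Cmod_ge_0. rewrite lorentz_0 //; lra.
Qed.
Lemma supnorm_ext c c' : (forall l, In l (mindices n m) -> c (ext l) = c' (ext l)) -> supnorm r s n m c = supnorm r s n m c'.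
Proof.
move=> H. have E z : peval n m c z = peval n m c' z by apply: sumC_ext => l Hl; rewrite H.
apply: Rle_antisym; apply: supnorm_lub => z Hz; [rewrite E|rewrite -E]; exact: supnorm_ub.
Qed.

Lemma avgC_bound k N F K : (0 < N)%nat -> (forall g, Cmod (F (tor N g)) <= K) -> Cmod (avgC k N F) <= K.
Proof.
move=> HN H. apply: Rle_trans (Cmod_avg _ _ _) _. rewrite -[X in _ <= X](avgR_const k N K HN). exact: avgR_le.
Qed.

Lemma coeff_le_supnorm c z l : lorentz r s n z < 1 -> In l (mindices n m) ->
  Cmod (c (ext l)) * Cmod (mono n z (ext l)) <= supnorm r s n m c.
Proof.
move=> Hz Hl. rewrite -Cmod_mult.
rewrite -(torus_coeff n m (S m) (mindices n m) (fun l => Cmult (c (ext l)) (mono n z (ext l))) l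
  (Nat.lt_succ_diag_r m) (NoDup_mindices n m) (incl_refl _) Hl).
apply: avgC_bound; first by lia. move=> g. rewrite Cmod_mult Cmod_conj (Cmod_mono_1 n (tor _ g)); last by move=> i _; apply: Cmod_tor.
rewrite Rmult_1_r -mpoly_scale -peval_mpoly. apply: supnorm_ub. apply: ball_scale => // i _. rewrite Cmod_tor; lra.
Qed.

End Supnorm.

(** * Homogeneous parts and the degree of the index set *)

Lemma list_sum_pow (x : C) l : prodC (seq 0 (length l)) (fun i => Cpow x (nth i l 0%nat)) = Cpow x (list_sum l).
Proof.
elim: l => [|k l IH] //. change (list_sum (k :: l)) with (k + list_sum l)%nat.
by rewrite [length _]/= prodC_seq_S Cpow_add_r -IH.
Qed.

Lemma mono_dilate n x z l : length l = n ->
  mono n (fun i => Cmult x (z i)) (ext l) = Cmult (Cpow x (list_sum l)) (mono n z (ext l)).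
Proof. move=> <-. by rewrite mono_mult -list_sum_pow. Qed.

(** The average of [x ^ (- k) * P (x z)] over the [(m + 1)]-th roots of unity [x], as a one-variable
    torus average; the degree bound excludes aliasing. *)
Lemma hom_part_le n m L c z k K :
  (forall l, In l L -> length l = n /\ (list_sum l <= m)%nat) -> (k <= m)%nat ->
  (forall x, Cmod x = 1 -> Cmod (mpoly n L c (fun i => Cmult x (z i))) <= K) ->
  Cmod (mpoly n L (fun l => Cmult (c l) (RtoC (indic (list_sum l = k)))) z) <= K.
Proof.
move=> HL Hk HK.
have -> : mpoly n L (fun l => Cmult (c l) (RtoC (indic (list_sum l = k)))) z =
  avgC 1 (S m) (fun w => Cmult (Cconj (Cpow (w 0%nat) k)) (mpoly n L c (fun i => Cmult (w 0%nat) (z i)))).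
- rewrite (avgC_ext _ _ _ (fun w => sumC L (fun l => Cmult (Cmult (c l) (mono n z (ext l)))
      (Cmult (mono 1 w (fun _ => list_sum l)) (Cconj (mono 1 w (fun _ => k))))))).
  + rewrite avgC_sum; apply: sumC_ext => l Hl. rewrite avgC_scal torus_orth.
    * rewrite (indic_ext (forall i, (i < 1)%nat -> list_sum l = k) (list_sum l = k)); first ring.
      split; [by move=> H; apply: (H 0%nat); lia|by []].
    * by move=> i _; have := HL l Hl; lia.
    * by move=> i _; lia.
  + move=> g. rewrite /mpoly -sumC_scal; apply: sumC_ext => l Hl.
    rewrite mono_dilate; last by case: (HL l Hl). rewrite /mono /= !Cmult_1_r; ring.
- apply: avgC_bound; first lia. move=> g. rewrite Cmod_mult Cmod_conj Cmod_pow Cmod_tor pow1 Rmult_1_l.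
  apply: HK. exact: Cmod_tor.
Qed.

Lemma psum_ext l : psum (ext l) (length l) = list_sum l.
Proof.
rewrite /psum /ext. congr list_sum. elim: l => [|x l IH] //. rewrite [length _]/= [seq _ _]/= [map _ _]/= -seq_shift map_map.
by rewrite -{3}IH.
Qed.

Lemma psum_tail a N k : (forall i, (N <= i)%nat -> a i = 0%nat) -> psum a (N + k) = psum a N.
Proof.
move=> H. rewrite /psum seq_app map_app list_sum_app.
have : forall i, In i (seq (0 + N) k) -> a i = 0%nat by move=> i /in_seq Hi; apply: H; lia.
elim: (seq _ k) => [|i s IH] Hs; first by rewrite /=; lia.
change (list_sum (map a (seq 0 N)) + (a i + list_sum (map a s)) = list_sum (map a (seq 0 N)))%nat.
rewrite (Hs i); [apply: IH => j Hj; apply: Hs; by right|by left].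
Qed.

Lemma supp_degree J n m c l : deg_le J m -> suppJ J c -> In l (mindices n m) -> c (ext l) <> RtoC 0 -> In l (deg_list n m).
Proof.
move=> HJ Hc /in_mindices [Hl _] H. apply/in_deg_list; split=> //. rewrite -psum_ext. exact: (HJ _ (Hc _ H)).
Qed.

Lemma sumC_filter_zero {A} (P : A -> bool) L f : (forall x, In x L -> P x = false -> f x = RtoC 0) ->
  sumC L f = sumC (filter P L) f.
Proof.
elim: L => [|x L IH] H //. rewrite [filter _ _]/= sumC_cons IH; last by move=> y Hy; apply: H; right.
case E : (P x); first by rewrite sumC_cons.
rewrite H ?Cplus_0_l //; by left.
Qed.

(** [peval] runs over a grid of [(m + 1) ^ n] exponents; the degree of [J] cuts it down to
    [deg_list n m], whose size is under control. *)
Lemma peval_deg J n m c z : deg_le J m -> suppJ J c -> peval n m c z = mpoly n (deg_list n m) (fun l => c (ext l)) z.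
Proof.
move=> HJ Hc. apply: sumC_filter_zero => l Hl HP.
case: (classic (c (ext l) = RtoC 0)) => [->|H]; first ring.
have := supp_degree J n m c l HJ Hc Hl H. by rewrite /deg_list filter_In HP => -[].
Qed.

(** * Bohr inequality on the polydisc *)

(** There are at most [a_i + 1 <= 2 ^ a_i] choices per variable. *)
Lemma count_below n M a : sumR (mindices n M) (fun l => indic (forall i, (i < n)%nat -> (nth i l 0 <= a i)%nat))
  <= prodR (seq 0 n) (fun i => 2 ^ a i).
Proof.
pose phi := fun (i k : nat) => indic (k <= a i)%nat.
apply: (Rle_trans _ (sumR (mindices n M) (fun l => prodR (seq 0 n) (fun i => phi i (nth i l 0%nat))))).
- apply: sumR_le => l _. case: (classic (forall i, (i < n)%nat -> (nth i l 0 <= a i)%nat)) => H.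
  + rewrite indic_T // (prodR_ext _ _ (fun _ => 1)); first by rewrite prodR_const pow1; lra.
    move=> i /in_seq Hi; rewrite /phi indic_T //; apply: H; lia.
  + rewrite indic_F //; apply: prodR_ge0 => i _; exact: indic_ge0.
- rewrite sumR_mindices; apply: prodR_le => i _; split.
    by apply: sumR_ge0 => k _; exact: indic_ge0.
  rewrite /phi. move: (a i) (S M) => b k.
  apply: (Rle_trans _ (INR (S b))).
  + have -> : sumR (seq 0 k) (fun k0 => indic (k0 <= b)%nat) = INR (Nat.min k (S b)).
      elim: k => [|k IH] //. rewrite sumR_seq_Sr IH. case: (Nat.le_gt_cases k b) => H.
      * rewrite indic_T // -S_INR; congr INR; lia.
      * rewrite indic_F; last lia. rewrite Rplus_0_r; congr INR; lia.
    apply: le_INR; lia.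
  + elim: b => [|b IH]; first by rewrite /=; lra. rewrite S_INR [2 ^ S b]/=.
    have : 1 <= 2 ^ b by apply: pow_R1_Rle; lra. lra.
Qed.

Lemma prodR_pow_list_sum x l : prodR (seq 0 (length l)) (fun i => x ^ ext l i) = x ^ list_sum l.
Proof. by rewrite pow_list_sum. Qed.

Lemma sumC_list_prod {A B} (L : list A) (K : list B) F :
  sumC (list_prod L K) F = sumC L (fun x => sumC K (fun y => F (x, y))).
Proof. elim: L => [|x L IH] //. by rewrite [list_prod _ _]/= sumC_app sumC_map sumC_cons IH. Qed.
Lemma sumR_list_prod {A B} (L : list A) (K : list B) F :
  sumR (list_prod L K) F = sumR L (fun x => sumR K (fun y => F (x, y))).
Proof. elim: L => [|x L IH] //. by rewrite [list_prod _ _]/= sumR_app sumR_map sumR_cons IH. Qed.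

(** [2 * D p * D q <= D p ^ 2 + D q ^ 2], and by symmetry of [E] the two squares contribute the same
    row sums. *)
Lemma schur_test {A} (L : list A) (D : A -> R) (E : A -> A -> R) K :
  (forall p q, 0 <= E p q) -> (forall p q, E p q = E q p) -> (forall p, In p L -> sumR L (E p) <= K) ->
  sumR L (fun p => sumR L (fun q => D p * D q * E p q)) <= K * sumR L (fun p => D p ^ 2).
Proof.
move=> HE Hsym HK. pose T := sumR L (fun p => sumR L (fun q => D p ^ 2 * E p q)).
have HT : T <= K * sumR L (fun p => D p ^ 2).
  rewrite -sumR_scal; apply: sumR_le => p Hp. rewrite sumR_scal Rmult_comm.
  apply: Rmult_le_compat_r; [exact: pow2_ge_0|exact: HK].
apply: Rle_trans HT. have -> : T = / 2 * (T + T) by field.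
have {2}-> : T = sumR L (fun p => sumR L (fun q => D q ^ 2 * E p q)).
  rewrite sumR_swap; apply: sumR_ext => p _; apply: sumR_ext => q _; by rewrite Hsym.
rewrite /T -sumR_plus -sumR_scal; apply: sumR_le => p _.
rewrite -sumR_plus -sumR_scal; apply: sumR_le => q _.
rewrite -Rmult_plus_distr_r -Rmult_assoc. apply: Rmult_le_compat_r => //.
have := pow2_ge_0 (D p - D q). lra.
Qed.

(* In the expansion of [|p ^ 2| ^ 2] only quadruples with [l1 + l2 = l3 + l4] survive, and
   [l1, l2] belong to at most [2 ^ (|l1| + |l2|) <= 4 ^ M] of them. *)
Lemma L4_le_L2 n M d : let L := deg_list n M in
  avgR n (S (2 * M)) (fun w => Cmod (mpoly n L d w) ^ 4) <= 4 ^ M * (sumR L (fun l => Cmod (d l) ^ 2)) ^ 2.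
Proof.
move=> L. set N := S (2 * M). set P := list_prod L L.
pose e (p : list nat * list nat) i := (ext (fst p) i + ext (snd p) i)%nat.
pose D (p : list nat * list nat) := Cmult (d (fst p)) (d (snd p)).
pose E p q := indic (forall i, (i < n)%nat -> e p i = e q i).
have HeN p : In p P -> forall i, (e p i < N)%nat.
  case: p => l1 l2 /in_prod_iff [H1 H2] i.
  move/incl_deg_list/in_mindices: H1 => [_ H1]. move/incl_deg_list/in_mindices: H2 => [_ H2].
  have := H1 i. have := H2 i. rewrite /e /ext /N /=; lia.
have HP : 4 ^ M * (sumR L (fun l => Cmod (d l) ^ 2)) ^ 2 = 4 ^ M * sumR P (fun p => Cmod (D p) ^ 2).
  rewrite sumR_list_prod [_ ^ 2]/= Rmult_1_r sumR_mult. congr Rmult. apply: sumR_ext => l1 _; apply: sumR_ext => l2 _.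
  rewrite /D Cmod_mult; cbn [fst snd]; ring.
rewrite HP. apply: Rle_trans (schur_test P (fun p => Cmod (D p)) E (4 ^ M) _ _ _).
- have -> : avgR n N (fun w => Cmod (mpoly n L d w) ^ 4) = Cmod (avgC n N (fun w => RtoC (Cmod (mpoly n L d w) ^ 4))).
    rewrite -RtoC_avg Cmod_R Rabs_pos_eq //. apply: avgR_ge0 => g. apply: pow_le; exact: Cmod_ge_0.
  rewrite (avgC_ext _ _ _ (fun w => sumC P (fun p => sumC P (fun q =>
    Cmult (Cmult (D p) (Cconj (D q))) (Cmult (mono n w (e p)) (Cconj (mono n w (e q)))))))); last first.
    move=> g. set z := mpoly n L d _.
    have -> : RtoC (Cmod z ^ 4) = Cmult (Cmult z z) (Cconj (Cmult z z)).
      have -> : Cmod z ^ 4 = Cmod z ^ 2 * Cmod z ^ 2 by ring. rewrite RtoC_mult RtoC_Cmod2 Cmult_conj; ring.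
    have -> : Cmult z z = sumC P (fun p => Cmult (D p) (mono n (tor N g) (e p))).
      rewrite /z /mpoly sumC_mult sumC_list_prod. apply: sumC_ext => l1 _; apply: sumC_ext => l2 _.
      rewrite mono_add /D /=; ring.
    rewrite sumC_conj sumC_mult. apply: sumC_ext => p _; apply: sumC_ext => q _. rewrite Cmult_conj; ring.
  rewrite avgC_sum. apply: Rle_trans (Cmod_sum _ _) _. apply: sumR_le => p Hp.
  rewrite avgC_sum. apply: Rle_trans (Cmod_sum _ _) _. apply: sumR_le => q Hq.
  rewrite avgC_scal torus_orth; try by move=> i _; apply: HeN.
  rewrite Cmod_mult (Cmod_mult (D p)) Cmod_conj Cmod_R Rabs_pos_eq; [exact: Rle_refl|exact: indic_ge0].
- move=> p q; exact: indic_ge0.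
- move=> p q. by apply: indic_ext; split=> H i Hi; rewrite H.
- move=> [l1 l2] /in_prod_iff [/in_deg_list [H1 H1'] /in_deg_list [H2 H2']]. rewrite sumR_list_prod.
  apply: (Rle_trans _ (sumR L (fun l3 => indic (forall i, (i < n)%nat -> (nth i l3 0 <= e (l1, l2) i)%nat)))).
  + apply: sumR_le => l3 H3.
    (* Given [l1], [l2] and [l3], at most one [l4] fits; if one does, then [l3 <= l1 + l2]
       entrywise, and [count_below] counts such [l3]. *)
    case: (classic (exists l4, In l4 L /\ forall i, (i < n)%nat -> e (l1, l2) i = e (l3, l4) i)) => [[l4 [H4 H4']]|H].
    * rewrite indic_T; last by move=> i Hi; rewrite (H4' i Hi) /e /ext /=; lia.
      rewrite (sumR_ext _ _ (fun l => 1 * indic (l4 = l))).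
        by apply: (sumR_indic_le L (fun _ => 1)); [exact: NoDup_deg_list|lra].
      move=> l Hl. rewrite Rmult_1_l. apply: indic_ext; split; last by move=> <-.
      move=> H. apply: (ext_inj n M); try by apply: incl_deg_list.
      move=> i Hi. have := H i Hi. rewrite (H4' i Hi) /e /=; lia.
    * rewrite sumR_0; first exact: indic_ge0.
      move=> l4 H4. rewrite /E indic_F // => H'. by apply: H; exists l4.
  + apply: Rle_trans (sumR_filter_le _ _ _ (fun l => indic_ge0 _)) _.
    apply: Rle_trans (count_below n M (e (l1, l2))) _.
    rewrite (prodR_ext _ _ (fun i => 2 ^ ext l1 i * 2 ^ ext l2 i)); last by move=> i _; exact: pow_add.
    rewrite prodR_mult -{1}H1 -{1}H2 !prodR_pow_list_sum.
    have -> : 4 = 2 * 2 by ring. rewrite Rpow_mult_distr.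
    apply: Rmult_le_compat; try (by apply: pow_le; lra); by apply: Rle_pow; [lra|].
Qed.

(* Interpolates [L2] between [L1] and [L4] through [a^2 <= th * a + a^4 / th^2]. *)
Lemma L2_le_L1 n M d : let L := deg_list n M in
  sqrt (sumR L (fun l => Cmod (d l) ^ 2)) <= 3 * 2 ^ M * avgR n (S (2 * M)) (fun w => Cmod (mpoly n L d w)).
Proof.
move=> L. set N := S (2 * M). set Q := sumR L _. set A := avgR _ _ _.
have HQ : 0 <= Q by apply: sumR_ge0 => l _; exact: pow2_ge_0.
have HA : 0 <= A by apply: avgR_ge0 => g; exact: Cmod_ge_0.
have H2M : 1 <= 2 ^ M by apply: pow_R1_Rle; lra.
case: (Rle_lt_or_eq_dec _ _ HQ) => [HQ0|<-]; last by rewrite sqrt_0; nra.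
have Hq0 := sqrt_lt_R0 _ HQ0. have Hq2 : sqrt Q ^ 2 = Q by apply: pow2_sqrt.
have H42 : 4 ^ M = (2 ^ M) ^ 2 by rewrite -pow_mult Nat.mul_comm pow_mult; congr pow; ring.
(* This threshold makes the fourth moment term equal to [4 / 9 * Q], leaving [5 / 9 * Q <= th * A];
   the constant becomes [27 / 10 <= 3]. *)
pose th := 3 / 2 * 2 ^ M * sqrt Q.
have Hth : 0 < th by rewrite /th; nra.
have Hth2 : th ^ 2 = 9 / 4 * 4 ^ M * Q by rewrite H42 -Hq2 /th; field.
have H1 : Q <= th * A + / th ^ 2 * (4 ^ M * Q ^ 2).
  rewrite {1}/Q -(parseval n M N) //; [|lia|exact: NoDup_deg_list|exact: incl_deg_list].
  apply: (Rle_trans _ (avgR n N (fun w => th * Cmod (mpoly n L d w) + / th ^ 2 * Cmod (mpoly n L d w) ^ 4))).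
  - apply: avgR_le => g. move: (Cmod _) (Cmod_ge_0 (mpoly n L d (tor N g))) => a Ha.
    case: (Rle_lt_dec a th) => Hat.
    + have : 0 <= / th ^ 2 * a ^ 4 by apply: Rmult_le_pos; [apply/Rlt_le/Rinv_0_lt_compat/pow_lt|apply: pow_le].
      nra.
    + have : a ^ 2 <= / th ^ 2 * a ^ 4.
        apply: (Rmult_le_reg_l (th ^ 2)); first exact: pow_lt.
        rewrite -Rmult_assoc Rinv_r; last by apply/Rgt_not_eq/pow_lt.
        have : th ^ 2 <= a ^ 2 by apply: pow_incr; lra.
        have := pow2_ge_0 a. nra.
      nra.
  - rewrite avgR_plus !avgR_scal -/A. have := L4_le_L2 n M d. rewrite -/L -/N -/Q => H.
    have : / th ^ 2 * avgR n N (fun w => Cmod (mpoly n L d w) ^ 4) <= / th ^ 2 * (4 ^ M * Q ^ 2).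
      by apply: Rmult_le_compat_l => //; apply/Rlt_le/Rinv_0_lt_compat/pow_lt.
    lra.
have H2 : / th ^ 2 * (4 ^ M * Q ^ 2) = 4 / 9 * Q.
  rewrite Hth2; field; split; [lra|]. apply: pow_nonzero; lra.
have H3 : 5 / 9 * Q <= th * A by lra.
have H4 : 5 / 9 * sqrt Q <= 3 / 2 * 2 ^ M * A.
  apply: (Rmult_le_reg_l (sqrt Q)) => //. rewrite -Hq2 /th in H3. lra.
nra.
Qed.

(** Built one linear factor at a time, [step] tracking the lowest coefficients and the degree. The
    coefficient of [t] in [prod_i (1 + t v_i) ^ l_i] is what brings in the weights [l_i] of the
    Euler operators. *)
Lemma one_plus_tv_expand n v l : length l = n ->
  exists a : nat -> C, (forall t, mono n (fun i => Cplus 1 (Cmult t (v i))) (ext l) =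
     sumC (seq 0 (S (list_sum l))) (fun k => Cmult (a k) (Cpow t k))) /\ a 0%nat = RtoC 1 /\
   a 1%nat = sumC (seq 0 n) (fun i => Cmult (RtoC (INR (ext l i))) (v i)) /\ (forall k, (list_sum l < k)%nat -> a k = RtoC 0).
Proof.
move=> <-.
have step (F : C -> C) dg a (x : C) : (forall t, F t = sumC (seq 0 (S dg)) (fun k => Cmult (a k) (Cpow t k))) ->
  a 0%nat = RtoC 1 -> (forall k, (dg < k)%nat -> a k = RtoC 0) ->
  exists a' : nat -> C, (forall t, Cmult (Cplus 1 (Cmult t x)) (F t) = sumC (seq 0 (S (S dg))) (fun k => Cmult (a' k) (Cpow t k))) /\
   a' 0%nat = RtoC 1 /\ a' 1%nat = Cplus (a 1%nat) x /\ (forall k, (S dg < k)%nat -> a' k = RtoC 0).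
  move=> HF H0 Hd. exists (fun k => match k with O => a 0%nat | S k' => Cplus (a (S k')) (Cmult x (a k')) end).
  split; last split; last split=> //.
  - move=> t. rewrite Cmult_plus_distr_r Cmult_1_l HF -Cmult_assoc -!sumC_scal.
    have E0 : sumC (seq 0 (S dg)) (fun k => Cmult (a k) (Cpow t k)) = sumC (seq 0 (S (S dg))) (fun k => Cmult (a k) (Cpow t k)).
      by rewrite (sumC_seq_Sr (S dg)) Hd; [ring|lia].
    rewrite E0. have E1 f : sumC (seq 0 (S (S dg))) f = Cplus (f 0%nat) (sumC (seq 0 (S dg)) (fun k => f (S k))).
      by rewrite [seq _ _]/= sumC_cons -(sumC_map S) -seq_shift.
    rewrite !E1 -Cplus_assoc -sumC_plus. congr Cplus. apply: sumC_ext => k _. rewrite Cpow_S; ring.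
  - exact: H0.
  - rewrite H0; ring.
  - case=> [|k] Hk; first lia. rewrite !Hd; try lia. ring.
elim: l v => [|e l IH] v.
- exists (fun k => match k with O => RtoC 1 | S _ => RtoC 0 end); split; last split=> //; last split=> //.
  + move=> t. rewrite /mono /sumC /=; ring.
  + by case=> [|k] //; rewrite /=; lia.
- change (list_sum (e :: l)) with (e + list_sum l)%nat.
  have E t : mono (length (e :: l)) (fun i => Cplus 1 (Cmult t (v i))) (ext (e :: l)) =
    Cmult (Cpow (Cplus 1 (Cmult t (v 0%nat))) e) (mono (length l) (fun i => Cplus 1 (Cmult t (v (S i)))) (ext l)).
    by rewrite {1}/mono [length _]/= -/(prodC _ _) prodC_seq_S.
  have E' : sumC (seq 0 (length (e :: l))) (fun i => Cmult (RtoC (INR (ext (e :: l) i))) (v i)) =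
    Cplus (Cmult (RtoC (INR e)) (v 0%nat)) (sumC (seq 0 (length l)) (fun i => Cmult (RtoC (INR (ext l i))) (v (S i)))).
    by rewrite [length _]/= [seq _ _]/= sumC_cons -seq_shift sumC_map.
  rewrite E'. have [a0 [Ha1 [Ha2 [Ha3 Ha4]]]] := IH (fun i => v (S i)).
  have : exists a : nat -> C, (forall t, Cmult (Cpow (Cplus 1 (Cmult t (v 0%nat))) e) (mono (length l) (fun i => Cplus 1 (Cmult t (v (S i)))) (ext l)) =
     sumC (seq 0 (S (e + list_sum l))) (fun k => Cmult (a k) (Cpow t k))) /\ a 0%nat = RtoC 1 /\
   a 1%nat = Cplus (Cmult (RtoC (INR e)) (v 0%nat)) (sumC (seq 0 (length l)) (fun i => Cmult (RtoC (INR (ext l i))) (v (S i)))) /\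
   (forall k, (e + list_sum l < k)%nat -> a k = RtoC 0).
    elim: e {E E'} => [|e [a [Hb1 [Hb2 [Hb3 Hb4]]]]].
    + exists a0; split; last split=> //; last split=> //.
      * move=> t. rewrite [Cpow _ 0]/= Cmult_1_l. exact: Ha1.
      * rewrite Ha3 /=; ring.
    + have [a' [Hc1 [Hc2 [Hc3 Hc4]]]] := step _ _ a (v 0%nat) Hb1 Hb2 Hb4.
      exists a'; split; last split=> //; last split=> //.
      * move=> t. rewrite Cpow_S -Cmult_assoc Hc1 //.
      * rewrite Hc3 Hb3 S_INR RtoC_plus; ring.
  move=> [a [Hb1 Hb2]]. exists a; split=> // t. by rewrite E Hb1.
Qed.

Lemma mono1 t a : mono 1 t a = Cpow (t 0%nat) (a 0%nat).
Proof. by rewrite /mono /= Cmult_1_r. Qed.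

(* The sum of [v_i G_i w] is the coefficient of [t] in the polynomial evaluated at [w (1 + t v) / 2]. *)
Lemma euler_bound n m (b : list nat -> C) K :
  (forall u, (forall i, (i < n)%nat -> Cmod (u i) <= 1) -> Cmod (mpoly n (deg_list n m) b u) <= K) ->
  (1 <= m)%nat ->
  forall w, (forall i, (i < n)%nat -> Cmod (w i) = 1) ->
  sumR (seq 0 n) (fun i => Cmod (mpoly n (deg_list n m) (fun l => Cmult (b l) (RtoC (INR (ext l i) * (/ 2) ^ list_sum l))) w)) <= K.
Proof.
move=> HK Hm w Hw.
pose G i := mpoly n (deg_list n m) (fun l => Cmult (b l) (RtoC (INR (ext l i) * (/ 2) ^ list_sum l))) w.
change (sumR (seq 0 n) (fun i => Cmod (G i)) <= K).
(* [v i] is the conjugate phase of [G i], so that [sum_i v_i G_i] is the sum of the moduli. *)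
have Hph i : exists v : C, Cmod v <= 1 /\ Cmult (G i) v = RtoC (Cmod (G i)).
  case: (classic (G i = RtoC 0)) => H.
  - exists (RtoC 1); rewrite H Cmod_1 Cmod_0; split; [lra|ring].
  - exists (Cdiv (Cconj (G i)) (RtoC (Cmod (G i)))).
    have Hp : 0 < Cmod (G i) by apply/Cmod_gt_0.
    have Hp' : RtoC (Cmod (G i)) <> RtoC 0 by move/RtoC_inj; lra.
    split.
    + rewrite Cmod_div // Cmod_conj Cmod_R Rabs_pos_eq; last lra. right; field; lra.
    + rewrite /Cdiv Cmult_assoc -RtoC_Cmod2 /= Rmult_1_r RtoC_mult -Cmult_assoc Cinv_r //; ring.
have [v Hv] := choice_fun _ Hph.
have E : RtoC (sumR (seq 0 n) (fun i => Cmod (G i))) =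
  avgC 1 (S m) (fun t => Cmult (Cconj (t 0%nat)) (mpoly n (deg_list n m) b
     (fun i => Cmult (Cmult (RtoC (/ 2)) (w i)) (Cplus 1 (Cmult (t 0%nat) (v i)))))).
- have Ha l : exists a : nat -> C, length l = n -> (forall t, mono n (fun i => Cplus 1 (Cmult t (v i))) (ext l) =
     sumC (seq 0 (S (list_sum l))) (fun k => Cmult (a k) (Cpow t k))) /\ a 0%nat = RtoC 1 /\
     a 1%nat = sumC (seq 0 n) (fun i => Cmult (RtoC (INR (ext l i))) (v i)) /\ (forall k, (list_sum l < k)%nat -> a k = RtoC 0).
    case: (classic (length l = n)) => H; last by exists (fun _ => RtoC 0).
    have [a Ha] := one_plus_tv_expand n v l H. by exists a.
  have {Ha}[a Ha] := choice_fun _ Ha.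
  rewrite (avgC_ext _ _ _ (fun t => sumC (deg_list n m) (fun l => Cmult (b l) (Cmult (mono n (fun i => Cmult (RtoC (/ 2)) (w i)) (ext l))
     (sumC (seq 0 (S m)) (fun k => Cmult (a l k)
        (Cmult (mono 1 t (fun _ => k)) (Cconj (mono 1 t (fun _ => 1%nat)))))))))); last first.
    move=> g. rewrite /mpoly -sumC_scal; apply: sumC_ext => l /in_deg_list [Hl Hl'].
    rewrite mono_mult. have [-> [_ [_ Ha4]]] := Ha l Hl.
    have -> : sumC (seq 0 (S (list_sum l))) (fun k => Cmult (a l k) (Cpow (tor (S m) g 0%nat) k)) =
      sumC (seq 0 (S m)) (fun k => Cmult (a l k) (Cpow (tor (S m) g 0%nat) k)).
      have -> : S m = (S (list_sum l) + (m - list_sum l))%nat by lia. rewrite seq_app sumC_app.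
      rewrite [X in _ = Cplus _ X]sumC_0; first by rewrite Cplus_0_r.
      move=> k /in_seq Hk. rewrite Ha4; [ring|lia].
    rewrite -!sumC_scal. apply: sumC_ext => k _. rewrite !mono1 [Cpow _ 1]/= Cmult_1_r; ring.
  rewrite avgC_sum RtoC_sum.
  rewrite (sumC_ext (seq 0 n) _ (fun i => sumC (deg_list n m) (fun l => Cmult (Cmult (b l) (mono n (fun i => Cmult (RtoC (/ 2)) (w i)) (ext l)))
     (Cmult (RtoC (INR (ext l i))) (v i))))); last first.
    move=> i _. case: (Hv i) => _ <-. rewrite /G /mpoly -sumC_scal_r. apply: sumC_ext => l /in_deg_list [Hl _].
    rewrite mono_dilate // RtoC_mult RtoC_pow; ring.
  rewrite sumC_swap. apply: sumC_ext => l /in_deg_list [Hl _]. rewrite sumC_scal.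
  rewrite avgC_scal avgC_scal avgC_sum Cmult_assoc. congr Cmult.
  have [_ [_ [<- _]]] := Ha l Hl.
  rewrite -(sumC_indic_eq (seq 0 (S m)) (a l) 1%nat (seq_NoDup _ _)); last by apply/in_seq; lia.
  apply: sumC_ext => k /in_seq Hk. rewrite avgC_scal torus_orth.
  + congr Cmult; congr RtoC; apply: indic_ext; split; first by move=> <-. by move=> H; rewrite (H 0%nat) //; lia.
  + by move=> i _; lia.
  + by move=> i _; lia.
have -> : sumR (seq 0 n) (fun i => Cmod (G i)) = Cmod (RtoC (sumR (seq 0 n) (fun i => Cmod (G i)))).
  rewrite Cmod_R Rabs_pos_eq //. apply: sumR_ge0 => i _; exact: Cmod_ge_0.
rewrite E. apply: avgC_bound; first lia. move=> g. rewrite Cmod_mult Cmod_conj Cmod_tor Rmult_1_l.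
(* [|1 + t v_i| <= 2] is compensated by the dilation by 1/2, which accounts for the weights
   [(/ 2) ^ |l|] in the statement. *)
apply: HK => i Hi. rewrite !Cmod_mult Hw // Cmod_R Rabs_pos_eq; last lra.
have := Cmod_triangle (RtoC 1) (Cmult (tor (S m) g 0%nat) (v i)). rewrite Cmod_mult Cmod_tor Cmod_1.
case: (Hv i) => H _. lra.
Qed.

Lemma sumR_le_sqrt {A} (L : list A) f g : (forall x, In x L -> 0 <= f x) -> (forall x, In x L -> 0 <= g x) ->
  sumR L (fun x => f x * g x) <= sqrt (sumR L (fun x => f x ^ 2)) * sqrt (sumR L (fun x => g x ^ 2)).
Proof.
move=> Hf Hg. rewrite -sqrt_mult; try by apply: sumR_ge0 => x _; exact: pow2_ge_0.
rewrite -(sqrt_pow2 (sumR L (fun x => f x * g x))).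
- apply: sqrt_le_1_alt. exact: cauchy_schwarz.
- apply: sumR_ge0 => x Hx. apply: Rmult_le_pos; [exact: Hf|exact: Hg].
Qed.

Lemma list_sum_INR l : INR (list_sum l) = sumR (seq 0 (length l)) (fun i => INR (ext l i)).
Proof.
elim: l => [|x l IH] //. change (list_sum (x :: l)) with (x + list_sum l)%nat.
by rewrite plus_INR IH [length _]/= sumR_seq_S.
Qed.

(** For [l <> 0], [|b_l| <= sum_i l_i |b_l|], and the summands are coefficients of Euler
    derivatives. For each [i], Cauchy-Schwarz runs only over the [l] with [l_i >= 1], whose count
    has one power of [1 + n / m] less; the L2 norm is bounded by the L1 norm, and [euler_bound] sums
    the L1 norms over all [i] at the cost of a single [K]. In [4 ^ m] one [2 ^ m] comes from
    [L2_le_L1], the other undoes [(/ 2) ^ |l|]. *)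
Lemma bohr_polydisc n m (b : list nat -> C) K : (1 <= m)%nat ->
  (forall u, (forall i, (i < n)%nat -> Cmod (u i) <= 1) -> Cmod (mpoly n (deg_list n m) b u) <= K) ->
  sumR (deg_list n m) (fun l => Cmod (b l)) <=
    (1 + 3 * 4 ^ m * sqrt (exp (INR m) * (1 + INR n / INR m) ^ (m - 1))) * K.
Proof.
move=> Hm HK. set L := deg_list n m. set N' := exp _ * _.
have HK0 : 0 <= K.
  apply: Rle_trans (HK (fun _ => RtoC 0) _); first exact: Cmod_ge_0. move=> i _; rewrite Cmod_0; lra.
pose dd i l := Cmult (b l) (RtoC (INR (ext l i) * (/ 2) ^ list_sum l)).
have Hpd l i : 0 <= INR (ext l i) * (/ 2) ^ list_sum l.
  apply: Rmult_le_pos; [exact: pos_INR|apply: pow_le; lra].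
have Hdd i l : Cmod (dd i l) = Cmod (b l) * (INR (ext l i) * (/ 2) ^ list_sum l).
  by rewrite Cmod_mult Cmod_R Rabs_pos_eq.
have HE : sumR (seq 0 n) (fun i => sumR L (fun l => Cmod (dd i l))) <= sqrt N' * (3 * 2 ^ m * K).
  apply: (Rle_trans _ (sumR (seq 0 n) (fun i => sqrt N' * (3 * 2 ^ m *
     avgR n (S (2 * m)) (fun w => Cmod (mpoly n L (dd i) w)))))).
  - apply: sumR_le => i /in_seq Hi.
    apply: (Rle_trans _ (sqrt N' * sqrt (sumR L (fun l => Cmod (dd i l) ^ 2)))); last first.
      apply: Rmult_le_compat_l; [exact: sqrt_pos|exact: L2_le_L1].
    (* The coefficient [dd i l] vanishes for [l_i = 0], so the indicator may be inserted;
       Cauchy-Schwarz then counts its support. *)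
    apply: (Rle_trans _ (sumR L (fun l => indic (1 <= nth i l 0)%nat * Cmod (dd i l)))).
      right; apply: sumR_ext => l _. case: (classic (1 <= nth i l 0)%nat) => H; first by rewrite indic_T // Rmult_1_l.
      rewrite Hdd /ext. have -> : nth i l 0%nat = 0%nat by lia. rewrite /=; ring.
    apply: Rle_trans (sumR_le_sqrt _ _ _ _ _) _.
    + by move=> l _; exact: indic_ge0.
    + by move=> l _; exact: Cmod_ge_0.
    + apply: Rmult_le_compat_r; first exact: sqrt_pos. apply: sqrt_le_1_alt.
      apply: Rle_trans (count_deg_list_pos n m i _ _); [|lia|lia].
      apply: sumR_le => l _. have := indic_01 (1 <= nth i l 0)%nat. nra.
  - rewrite sumR_scal sumR_scal. apply: Rmult_le_compat_l; first exact: sqrt_pos.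
    apply: Rmult_le_compat_l; first by apply: Rmult_le_pos; [lra|apply: pow_le; lra].
    rewrite -avgR_sum -[X in _ <= X](avgR_const n (S (2 * m)) K ltac:(lia)).
    apply: avgR_le => g. apply: euler_bound => // i _; exact: Cmod_tor.
(* The constant term is annihilated by the Euler operators and is bounded by [K] separately. *)
pose l0 := repeat 0%nat n.
have Hl0 : In l0 L := zero_in_deg_list n m.
have Hb0 : Cmod (b l0) <= K.
  rewrite -(torus_coeff n m (S m) L b l0 ltac:(lia) (NoDup_deg_list _ _) (incl_deg_list _ _) Hl0).
  apply: avgC_bound; first lia. move=> g. rewrite Cmod_mult Cmod_conj (Cmod_mono_1 n (tor _ g)); last by move=> i _; apply: Cmod_tor.
  rewrite Rmult_1_r. apply: HK => i _. rewrite Cmod_tor; lra.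
have H2m : 2 ^ m * (/ 2) ^ m = 1 by rewrite -Rpow_mult_distr Rinv_r ?pow1; lra.
apply: (Rle_trans _ (sumR L (fun l => Cmod (b l) * indic (l0 = l) + 2 ^ m * sumR (seq 0 n) (fun i => Cmod (dd i l))))).
- apply: sumR_le => l /in_deg_list [Hl Hl'].
  rewrite (sumR_ext _ _ (fun i => Cmod (b l) * (/ 2) ^ list_sum l * INR (ext l i))); last by move=> i _; rewrite Hdd; ring.
  rewrite sumR_scal -Hl -list_sum_INR. have Hb := Cmod_ge_0 (b l).
  case: (Nat.eq_dec (list_sum l) 0) => Hz.
  + rewrite indic_T; first by rewrite Hz /=; lra.
    apply: (nth_ext _ _ 0%nat 0%nat); first by rewrite repeat_length.
    move=> i _. have := nth_le_list_sum i l. rewrite Hz nth_repeat; lia.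
  + have H1 : 1 <= INR (list_sum l) by apply: (le_INR 1); lia.
    have H2 : 1 <= 2 ^ m * (/ 2) ^ list_sum l.
      have := pow_inv_ge1 (/ 2) (list_sum l) m ltac:(lra) Hl'. by rewrite Rinv_inv.
    have H3 := indic_01 (l0 = l).
    have H4 : 1 <= 2 ^ m * (/ 2) ^ list_sum l * INR (list_sum l) by nra.
    nra.
- rewrite sumR_plus sumR_scal (sumR_indic_eq _ (fun l => Cmod (b l))) //; last exact: NoDup_deg_list.
  rewrite sumR_swap.
  have : 2 ^ m * sumR (seq 0 n) (fun i => sumR L (fun l => Cmod (dd i l))) <= 2 ^ m * (sqrt N' * (3 * 2 ^ m * K)).
    by apply: Rmult_le_compat_l => //; apply: pow_le; lra.
  have -> : 4 ^ m = 2 ^ m * 2 ^ m by rewrite -Rpow_mult_distr; congr pow; ring. lra.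
Qed.

(** * Complex Hahn-Banach theorem *)

Section HahnBanach.
Variable Y : NormedModule C_AbsRing.

Local Notation YR := (NormedModule.sort C_AbsRing Y * R)%type.

Definition rscal (t : R) (y : Y) : Y := scal (RtoC t : C_AbsRing) y.

Lemma rscal_assoc a b y : rscal a (rscal b y) = rscal (a * b) y.
Proof. rewrite /rscal scal_assoc RtoC_mult //. Qed.
Lemma rscal_one y : rscal 1 y = y.
Proof. exact: (scal_one y). Qed.
Lemma rscal_zero_l y : rscal 0 y = zero.
Proof. exact: (scal_zero_l y). Qed.
Lemma rscal_distr_l t (x y : Y) : rscal t (plus x y) = plus (rscal t x) (rscal t y).
Proof. exact: scal_distr_l. Qed.
Lemma rscal_distr_r a b (y : Y) : rscal (a + b) y = plus (rscal a y) (rscal b y).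
Proof. rewrite /rscal RtoC_plus; exact: (@scal_distr_r C_AbsRing Y). Qed.
Lemma rscal_opp_one (y : Y) : rscal (-1) y = opp y.
Proof.
rewrite /rscal. have -> : (RtoC (-1) : C_AbsRing) = opp one; last exact: scal_opp_one.
apply: injective_projections; rewrite /= /opp /one /=; ring.
Qed.
Lemma norm_cscal_le (c : C) (y : Y) : norm (scal (c : C_AbsRing) y) <= Cmod c * norm y.
Proof. exact: norm_scal. Qed.
Lemma norm_rscal_pos t y : 0 < t -> norm (rscal t y) = t * norm y.
Proof.
move=> Ht. have H s z : 0 < s -> norm (rscal s z) <= s * norm z.
  move=> Hs'. have := norm_cscal_le (RtoC s) z. rewrite Cmod_R Rabs_pos_eq //; lra.
apply: Rle_antisym; first exact: H.
have Ht' : 0 < / t by apply: Rinv_0_lt_compat.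
have := H (/ t) (rscal t y) Ht'. rewrite rscal_assoc Rinv_l ?rscal_one; last lra.
move=> H1. have := Rmult_le_compat_l t _ _ (Rlt_le _ _ Ht) H1. rewrite -Rmult_assoc Rinv_r; lra.
Qed.

(** The graph of a real functional on a subspace, so that Zorn's lemma applies to inclusion;
    domination by the norm already forces the relation to be single valued. *)
Definition dominated (G : YR -> Prop) : Prop :=
  (forall x a y b, G (x, a) -> G (y, b) -> G (plus x y, a + b)) /\
  (forall t x a, G (x, a) -> G (rscal t x, t * a)) /\
  (forall x a, G (x, a) -> a <= norm x).

Lemma dominated_fun G x a b : dominated G -> G (x, a) -> G (x, b) -> a = b.
Proof.
move=> [H1 [H2 H3]].
have H c d : G (x, c) -> G (x, d) -> c <= d.
  move=> Hc Hd. have := H3 _ _ (H1 _ _ _ _ Hc (H2 (-1) _ _ Hd)). rewrite rscal_opp_one plus_opp_r norm_zero. lra.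
move=> Ha Hb. by apply: Rle_antisym; apply: H.
Qed.

Lemma norm_plus_le (x y : Y) : norm (plus x y) <= norm x + norm y.
Proof. exact: norm_triangle. Qed.

(** The value at [y0] must lie between all [a - norm (x - y0)] and all [norm (x' + y0) - a']; [Hsep]
    orders the two families, and [c] is the supremum of the first. *)
Lemma dominated_extend G y0 x0 a0 : dominated G -> G (x0, a0) -> exists c, dominated (fun p => exists x a t, G (x, a) /\ p = (plus x (rscal t y0), a + t * c)).
Proof.
move=> [H1 [H2 H3]] H0.
have Hsep x a x' a' : G (x, a) -> G (x', a') -> a - norm (plus x (opp y0)) <= norm (plus x' y0) - a'.
  move=> Hx Hx'. have := H3 _ _ (H1 _ _ _ _ Hx Hx').
  have -> : plus x x' = plus (plus x (opp y0)) (plus x' y0).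
    rewrite -plus_assoc. congr plus. by rewrite (plus_comm x' y0) plus_assoc plus_opp_l plus_zero_l.
  have := norm_plus_le (plus x (opp y0)) (plus x' y0). lra.
have [c [Hc1 Hc2]] : {c | is_lub (fun v => exists x a, G (x, a) /\ v = a - norm (plus x (opp y0))) c}.
  apply: completeness; last by exists (a0 - norm (plus x0 (opp y0))), x0, a0.
  exists (norm (plus x0 y0) - a0) => v [x [a [Hx ->]]]. exact: Hsep.
have Hlo x a : G (x, a) -> a - norm (plus x (opp y0)) <= c by move=> Hx; apply: Hc1; exists x, a.
have Hhi x a : G (x, a) -> c <= norm (plus x y0) - a by move=> Hx; apply: Hc2 => v [x' [a' [Hx' ->]]]; apply: Hsep.
exists c; split; last split.
- move=> x a y b [x1 [a1 [t1 [G1 [-> ->]]]]] [x2 [a2 [t2 [G2 [-> ->]]]]].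
  exists (plus x1 x2), (a1 + a2), (t1 + t2); split; first exact: H1.
  congr pair; last ring. rewrite rscal_distr_r -!plus_assoc. congr plus. rewrite !plus_assoc. congr plus. exact: plus_comm.
- move=> t x a [x1 [a1 [t1 [G1 [-> ->]]]]]. exists (rscal t x1), (t * a1), (t * t1); split; first exact: H2.
  congr pair; last ring. by rewrite rscal_distr_l rscal_assoc.
- move=> x a [x1 [a1 [t [G1 [-> ->]]]]].
  (* By homogeneity [t < 0] reduces to [Hlo] and [t > 0] to [Hhi], after division by [|t|]. *)
  case: (Rtotal_order t 0) => [Ht|[->|Ht]].
  + have Hu : 0 < - t by lra. have Hiu := Rinv_0_lt_compat _ Hu.
    have := Hlo _ _ (H2 (/ - t) _ _ G1).
    have -> : plus x1 (rscal t y0) = rscal (- t) (plus (rscal (/ - t) x1) (opp y0)).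
      rewrite rscal_distr_l rscal_assoc Rinv_r; last lra. rewrite rscal_one -rscal_opp_one rscal_assoc. by congr (plus _ (rscal _ _)); ring.
    rewrite norm_rscal_pos // => H. have := Rmult_le_compat_l (- t) _ _ (Rlt_le _ _ Hu) H.
    rewrite Rmult_minus_distr_l -Rmult_assoc Rinv_r; lra.
  + rewrite rscal_zero_l plus_zero_r. have := H3 _ _ G1. lra.
  + have Hit := Rinv_0_lt_compat _ Ht.
    have := Hhi _ _ (H2 (/ t) _ _ G1).
    have -> : plus x1 (rscal t y0) = rscal t (plus (rscal (/ t) x1) y0).
      rewrite rscal_distr_l rscal_assoc Rinv_r; last lra. by rewrite rscal_one.
    rewrite norm_rscal_pos // => H. have := Rmult_le_compat_l t _ _ (Rlt_le _ _ Ht) H.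
    rewrite Rmult_minus_distr_l -Rmult_assoc Rinv_r; lra.
Qed.

Lemma hahn_banach_real (G0 : YR -> Prop) : dominated G0 -> (exists p, G0 p) ->
  exists f : Y -> R, (forall x y, f (plus x y) = f x + f y) /\ (forall t x, f (rscal t x) = t * f x) /\
    (forall x, f x <= norm x) /\ (forall x a, G0 (x, a) -> f x = a).
Proof.
move=> HG0 [p0 Hp0].
(* [G0] is required to lie in [G] only for nonempty [G]: the empty chain has empty union, which must
   satisfy [P] too. *)
pose P (G : YR -> Prop) := dominated G /\ ((exists p, G p) -> forall p, G0 p -> G p).
have Hchain : forall F : (YR -> Prop) -> Prop, classical_sets.subset F P ->
    classical_sets.total_on F (@classical_sets.subset (YR)) -> P (classical_sets.bigcup F (fun X => X)).
  move=> F HF Htot.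
  have Hpair p q : classical_sets.bigcup F (fun X => X) p -> classical_sets.bigcup F (fun X => X) q ->
    exists X, F X /\ X p /\ X q.
    move=> [X HX Xp] [X' HX' Xq]. case: (Htot X X' HX HX') => H; [exists X'|exists X]; split=> //; split=> //; exact: H.
  split.
  - split; last split.
    + move=> x a y b Hx Hy. have [X [FX [Xx Xy]]] := Hpair _ _ Hx Hy. exists X => //.
      case: (HF X FX) => [[H1 _] _]. exact: H1.
    + move=> t x a [X FX Xx]. exists X => //. case: (HF X FX) => [[_ [H2 _]] _]. exact: H2.
    + move=> x a [X FX Xx]. case: (HF X FX) => [[_ [_ H3]] _]. exact: H3.
  - move=> [p [X FX Xp]] q Hq. exists X => //. case: (HF X FX) => _; apply=> //. by exists p.
have [A [[HA HA0] Hmax]] := classical_sets.Zorn_bigcup Hchain.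
have HPG0 : P G0 by split.
have HAne : exists p, A p.
  apply: NNPP => Hne. apply: (Hmax G0) => //. split; first by move=> p Hp; case: Hne; exists p.
  by move=> H; apply: Hne; exists p0; apply: H.
have HAG := HA0 HAne.
have Htotal y : exists a, A (y, a).
  case: (HAne) => -[x0 a0] Hx0. have [c Hc] := dominated_extend A y x0 a0 HA Hx0.
  set B := (fun p => _) in Hc.
  have HAB p : A p -> B p.
    case: p => x a Hx. exists x, a, 0; split=> //. rewrite rscal_zero_l plus_zero_r; congr pair; ring.
  apply: NNPP => Hy. apply: (Hmax B).
  - split=> // HBA. apply: Hy. case: (HA) => H1 [H2 _]. exists c. apply: HBA. exists (rscal 0 x0), (0 * a0), 1; split; first exact: H2.
    rewrite rscal_zero_l plus_zero_l rscal_one; congr pair; ring.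
  - split=> // _ p Hp. apply: HAB. exact: HAG.
have [f Hf] := choice_fun _ Htotal.
case: (HA) => H1 [H2 H3].
exists f; split; last split; last split.
- move=> x y. apply: (dominated_fun A (plus x y)) => //. exact: H1.
- move=> t x. apply: (dominated_fun A (rscal t x)) => //. exact: H2.
- move=> x. exact: H3.
- move=> x a Hx. apply: (dominated_fun A x) => //. exact: HAG.
Qed.

(** If [u] extends the real part, [f y = u y - i * u (i y)] is complex linear and extends the given
    functional. For the bound, [x] is multiplied by a phase that makes [f] equal to its modulus,
    hence to [u]. *)
Lemma hahn_banach_complex (G0 : Y -> C -> Prop) :
  (exists x a, G0 x a) ->
  (forall x a y b, G0 x a -> G0 y b -> G0 (plus x y) (Cplus a b)) ->
  (forall (t : C) x a, G0 x a -> G0 (scal (t : C_AbsRing) x) (Cmult t a)) ->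
  (forall x a, G0 x a -> Cmod a <= norm x) ->
  exists f : Y -> C, (forall x y, f (plus x y) = Cplus (f x) (f y)) /\ (forall (t : C) x, f (scal (t : C_AbsRing) x) = Cmult t (f x)) /\
    (forall x, Cmod (f x) <= norm x) /\ (forall x a, G0 x a -> f x = a).
Proof.
move=> [x0 [a0 Hx0]] Hp Hs Hb.
have Hdom : dominated (fun p : YR => exists a, G0 (fst p) a /\ snd p = Re a).
  split; last split.
  - move=> x a y b [a' [Ha1 Ha2]] [b' [Hb1 Hb2]]. exists (Cplus a' b'); split; first exact: Hp.
    by rewrite /= in Ha2 Hb2 *; rewrite Ha2 Hb2.
  - move=> t x a [a' [Ha1 Ha2]]. exists (Cmult (RtoC t) a'); split; first exact: Hs.
    rewrite /= in Ha2 *; rewrite Ha2 /Re /=; ring.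
  - move=> x a [a' [Ha1 Ha2]]. rewrite /= in Ha1 Ha2. rewrite Ha2. apply: Rle_trans (Hb _ _ Ha1).
    apply: Rle_trans (re_le_Cmod a'). exact: Rle_abs.
have [u [Hu1 [Hu2 [Hu3 Hu4]]]] := hahn_banach_real _ Hdom (ex_intro _ (x0, Re a0) (ex_intro _ a0 (conj Hx0 eq_refl))).
pose ci y : Y := scal (Ci : C_AbsRing) y.
pose f y : C := (u y, - u (ci y)).
have Hci2 y : ci (ci y) = opp y.
  rewrite /ci scal_assoc. have -> : (mult (Ci : C_AbsRing) Ci) = opp one; last exact: scal_opp_one.
  apply: injective_projections; rewrite /mult /opp /one /=; ring.
have Huo y : u (opp y) = - u y by rewrite -rscal_opp_one Hu2; ring.
have Hfp x y : f (plus x y) = Cplus (f x) (f y).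
  rewrite /f /ci scal_distr_l !Hu1. by apply: injective_projections => /=; ring.
have Hfr t x : f (rscal t x) = Cmult (RtoC t) (f x).
  rewrite /f Hu2. have -> : ci (rscal t x) = rscal t (ci x).
    rewrite /ci /rscal !scal_assoc; congr scal; exact: Cmult_comm.
  rewrite Hu2. by apply: injective_projections => /=; ring.
have Hfi x : f (ci x) = Cmult Ci (f x).
  rewrite /f Hci2 Huo. by apply: injective_projections => /=; ring.
have Hfs (t : C) x : f (scal (t : C_AbsRing) x) = Cmult t (f x).
  have -> : scal (t : C_AbsRing) x = plus (rscal (Re t) x) (rscal (Im t) (ci x)).
    rewrite /rscal /ci scal_assoc -scal_distr_r; congr scal.
    apply: injective_projections; rewrite /plus /mult /=; rewrite /Re /Im; ring.
  rewrite Hfp !Hfr Hfi. apply: injective_projections => /=; rewrite /Re /Im; ring.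
exists f; split=> //; split=> //; split.
- move=> x. case: (classic (f x = RtoC 0)) => H; first by rewrite H Cmod_0; apply: norm_ge_0.
  have Hm : 0 < Cmod (f x) by apply/Cmod_gt_0.
  have Hm' : RtoC (Cmod (f x)) <> RtoC 0 by move/RtoC_inj; lra.
  pose v := Cdiv (Cconj (f x)) (RtoC (Cmod (f x))).
  have Hv1 : Cmod v = 1 by rewrite /v Cmod_div // Cmod_conj Cmod_R Rabs_pos_eq; [field|]; lra.
  have Hv2 : Cmult v (f x) = RtoC (Cmod (f x)).
    rewrite /v /Cdiv (Cmult_comm (Cconj _)) -Cmult_assoc (Cmult_comm (Cconj _)) -RtoC_Cmod2 /= Rmult_1_r RtoC_mult Cmult_assoc Cinv_l //; ring.
  have E : u (scal (v : C_AbsRing) x) = Cmod (f x) by have := Hfs v x; rewrite Hv2 => /(f_equal fst).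
  rewrite -E. apply: Rle_trans (Hu3 _) _. have := norm_cscal_le v x. rewrite Hv1; lra.
- move=> x a Hx. rewrite /f (Hu4 x (Re a)); last by exists a.
  rewrite (Hu4 (ci x) (Re (Cmult Ci a))); last by exists (Cmult Ci a); split=> //; exact: Hs.
  apply: injective_projections => /=; rewrite /Re /=; ring.
Qed.

End HahnBanach.

(** * Projections of small norm *)

Lemma peval_plus n m c1 c2 z : peval n m (fun a => Cplus (c1 a) (c2 a)) z = Cplus (peval n m c1 z) (peval n m c2 z).
Proof. rewrite !peval_mpoly /mpoly -sumC_plus; apply: sumC_ext => l _; ring. Qed.
Lemma peval_scal n m t c z : peval n m (fun a => Cmult t (c a)) z = Cmult t (peval n m c z).
Proof. rewrite !peval_mpoly /mpoly -sumC_scal; apply: sumC_ext => l _; ring. Qed.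

Lemma suppJ_plus J c1 c2 : suppJ J c1 -> suppJ J c2 -> suppJ J (fun a => Cplus (c1 a) (c2 a)).
Proof.
move=> H1 H2 a Ha. apply: NNPP => HJ. apply: Ha.
have -> : c1 a = RtoC 0 by apply: NNPP => H; apply: HJ; exact: H1.
have -> : c2 a = RtoC 0 by apply: NNPP => H; apply: HJ; exact: H2. ring.
Qed.
Lemma suppJ_scal J t c : suppJ J c -> suppJ J (fun a => Cmult t (c a)).
Proof. move=> H a Ha. apply: H => E. apply: Ha. rewrite E; ring. Qed.

Section Embedding.
Variables (r : R) (s : Rbar) (n m : nat) (J : multi_index -> Prop).
Hypothesis Hs : Rbar_le (Finite 1) s.
Variables (Y : CompleteNormedModule C_AbsRing) (I : (multi_index -> C) -> Y).
Hypothesis HI : iso_embed r s n m J Y I.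

(** Two families that agree on the exponents in [n] variables differ by one of sup norm 0, which an
    isometry sends to 0. *)
Lemma embed_ext c1 c2 : suppJ J c1 -> suppJ J c2 ->
  (forall l, In l (mindices n m) -> c1 (ext l) = c2 (ext l)) -> I c1 = I c2.
Proof.
move=> H1 H2 H. case: HI => Hp [Hsc Hn].
have H3 : suppJ J (fun a => Cmult (RtoC (-1)) (c2 a)) by apply: suppJ_scal.
have E : plus (I c1) (opp (I c2)) = zero.
  rewrite -(scal_opp_one (I c2)).
  have -> : opp (one : C_AbsRing) = RtoC (-1) by apply: injective_projections; rewrite /opp /one /=; ring.
  rewrite -Hsc // -Hp //. apply: norm_eq_zero. rewrite Hn; last exact: suppJ_plus.
  apply: Rle_antisym; last exact: supnorm_ge0. apply: supnorm_lub => // z _.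
  rewrite peval_mpoly /mpoly sumC_0 ?Cmod_0; first lra.
  move=> l Hl. rewrite H //; ring.
rewrite -(plus_zero_r (I c1)) -(plus_opp_l (I c2)) plus_assoc E plus_zero_l //.
Qed.

Lemma point_evaluation_extends x : lorentz r s n x < 1 ->
  exists f : Y -> C, (forall y y', f (plus y y') = Cplus (f y) (f y')) /\
    (forall (t : C) y, f (scal (t : C_AbsRing) y) = Cmult t (f y)) /\
    (forall y, Cmod (f y) <= norm y) /\ (forall c, suppJ J c -> f (I c) = peval n m c x).
Proof.
move=> Hx. case: HI => Hp [Hsc Hn].
have [f [H1 [H2 [H3 H4]]]] := hahn_banach_complex Y (fun y a => exists c, suppJ J c /\ y = I c /\ a = peval n m c x)
  (ex_intro _ _ (ex_intro _ _ (ex_intro _ (fun _ => RtoC 0) (conj (fun a H => False_ind (J a) (H eq_refl)) (conj eq_refl eq_refl)))))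
  ltac:(move=> y a y' b [c [Hc [-> ->]]] [c' [Hc' [-> ->]]]; exists (fun a => Cplus (c a) (c' a)); split; [exact: suppJ_plus|split; [by rewrite Hp|by rewrite peval_plus]])
  ltac:(move=> t y a [c [Hc [-> ->]]]; exists (fun a => Cmult t (c a)); split; [exact: suppJ_scal|split; [by rewrite Hsc|by rewrite peval_scal]])
  ltac:(move=> y a [c [Hc [-> ->]]]; rewrite Hn //; exact: supnorm_ub).
exists f; split=> //; split=> //; split=> // c Hc. apply: H4. by exists c.
Qed.

End Embedding.

(** [Q y] has as coefficients the means of [psi x y * conj (x ^ a)] over the rotated design, divided
    by the moments [M a]. On the range this is the coefficient formula; in general the value at [z]
    is a mean of [psi x y] against the kernel [K] of [z], whose squared L2 norm is at most [6 * N],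
    for [N] monomials. *)
Lemma bounded_projection r s n m J (Y : CompleteNormedModule C_AbsRing) I :
  2 <= r -> Rbar_le (Finite 1) s -> deg_le J m -> iso_embed r s n m J Y I ->
  exists Q, is_proj J Y I Q /\ forall y, norm (Q y) <= sqrt (6 * INR (length (deg_list n m))) * norm y.
Proof.
move=> Hr Hs HJ HI. set L := deg_list n m. set N := S m.
have [mu [Hmu1 [Hmu2 [Hmu3 Hmu4]]]] := design_ball n L (fun z => lorentz r s n z < 1)
  (fun z Hz i => ball_le1 r s n Hs z i Hz) (ball_interior r s n Hr Hs).
(* The extensions are chosen point by point, without any regularity in [x]: all means are finite
   sums. *)
have Hpsi x : exists f : Y -> C, lorentz r s n x < 1 -> (forall y y', f (plus y y') = Cplus (f y) (f y')) /\
    (forall (t : C) y, f (scal (t : C_AbsRing) y) = Cmult t (f y)) /\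
    (forall y, Cmod (f y) <= norm y) /\ (forall c, suppJ J c -> f (I c) = peval n m c x).
  case: (classic (lorentz r s n x < 1)) => Hx; last by exists (fun _ => RtoC 0).
  have [f Hf] := point_evaluation_extends r s n m J Hs Y I HI x Hx. by exists f.
have [psi Hpsi'] := choice_fun _ Hpsi.
pose pt (p : R * (nat -> C)) (w : nat -> C) i := Cmult (snd p i) (w i).
have Hpt p g : In p mu -> lorentz r s n (pt p (tor N g)) < 1.
  move=> Hp. apply: ball_scale => //; first by case: (Hmu1 p Hp). move=> i _; rewrite Cmod_tor; lra.
pose M a := sumR mu (fun p => fst p * Cmod (mono n (snd p) a) ^ 2).
pose cq (y : Y) (a : multi_index) : C := Cmult (RtoC (indic (J a) * / M a))
  (sumC mu (fun p => Cmult (RtoC (fst p)) (avgC n N (fun w => Cmult (psi (pt p w) y) (Cconj (mono n (pt p w) a)))))).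
have Hcq y : suppJ J (cq y).
  move=> a Ha. apply: NNPP => HJa. apply: Ha. rewrite /cq indic_F // Rmult_0_l; ring.
case: (HI) => Hp [Hsc Hn].
exists (fun y => I (cq y)); split; [rewrite /is_proj; split; [|split; [|split]]|].
- move=> y1 y2. rewrite -Hp //. congr I. apply: functional_extensionality => a.
  rewrite /cq -Cmult_plus_distr_l -sumC_plus. congr Cmult. apply: sumC_ext => p Hpm.
  rewrite -Cmult_plus_distr_l; congr Cmult. rewrite /avgC -Cmult_plus_distr_l -sumC_plus; congr Cmult.
  apply: sumC_ext => g _. case: (Hpsi' (pt p (tor N g)) (Hpt p g Hpm)) => -> _. ring.
- move=> t y. rewrite -Hsc //. congr I. apply: functional_extensionality => a.
  rewrite /cq Cmult_assoc (Cmult_comm t) -Cmult_assoc; congr Cmult. rewrite -sumC_scal; apply: sumC_ext => p Hpm.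
  rewrite Cmult_assoc (Cmult_comm t) -Cmult_assoc; congr Cmult. rewrite -avgC_scal. rewrite /avgC; congr Cmult.
  apply: sumC_ext => g _. case: (Hpsi' (pt p (tor N g)) (Hpt p g Hpm)) => _ [-> _]. ring.
- move=> y. by exists (cq y).
- move=> c Hc. apply: (embed_ext r s n m J Hs Y I HI) => // l Hl.
  case: (classic (J (ext l))) => HJl; last first.
    have -> : c (ext l) = RtoC 0 by apply: NNPP => H; apply: HJl; exact: Hc.
    rewrite /cq indic_F // Rmult_0_l; ring.
  have HlL : In l L.
    apply/in_deg_list; move/in_mindices: Hl => [Hl _]; split=> //. rewrite -psum_ext. exact: HJ.
  have HM : 0 < M (ext l) by exact: Hmu3.
  rewrite /cq indic_T // Rmult_1_l.
  rewrite (sumC_ext _ _ (fun p => Cmult (c (ext l)) (RtoC (fst p * Cmod (mono n (snd p) (ext l)) ^ 2)))).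
    rewrite sumC_scal -RtoC_sum -/(M (ext l)) (Cmult_comm (c _)) Cmult_assoc -RtoC_mult Rinv_l; last lra. ring.
  move=> p Hpm. rewrite RtoC_mult RtoC_Cmod2 Cmult_assoc (Cmult_comm (c _)) -Cmult_assoc; congr Cmult.
  have -> : avgC n N (fun w => Cmult (psi (pt p w) (I c)) (Cconj (mono n (pt p w) (ext l)))) =
    avgC n N (fun w => Cmult (Cconj (mono n (snd p) (ext l))) (Cmult (mpoly n L (fun l => Cmult (c (ext l)) (mono n (snd p) (ext l))) w) (Cconj (mono n w (ext l))))).
    rewrite /avgC; congr Cmult; apply: sumC_ext => g _.
    case: (Hpsi' (pt p (tor N g)) (Hpt p g Hpm)) => _ [_ [_ ->]] //.
    rewrite (peval_deg J) // mpoly_scale mono_mult Cmult_conj -/L; ring.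
  rewrite avgC_scal (torus_coeff n m) //; [ring|exact: NoDup_deg_list|exact: incl_deg_list].
- move=> y. rewrite Hn //. set k := sqrt _. apply: supnorm_lub => // z Hz.
  have Hk2 : k ^ 2 = 6 * INR (length L) by apply: pow2_sqrt; have := pos_INR (length L); lra.
  have Hk : 0 < k.
    apply: sqrt_lt_R0. have : 0 < INR (length L); last lra.
    apply: lt_0_INR. have := zero_in_deg_list n m. rewrite -/L. by case: (L) => [|x l] //= _; lia.
  have Hy := norm_ge_0 y.
  pose K (p : R * (nat -> C)) w := mpoly n L (fun l => Cmult (Cmult (RtoC (indic (J (ext l)) * / M (ext l))) (Cconj (mono n z (ext l)))) (mono n (snd p) (ext l))) w.
  have HMl l : In l L -> 0 < M (ext l) by exact: Hmu3.
  have E : peval n m (cq y) z = sumC mu (fun p => Cmult (RtoC (fst p)) (avgC n N (fun w => Cmult (psi (pt p w) y) (Cconj (K p w))))).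
    rewrite (peval_deg J) // /mpoly.
    rewrite [RHS](sumC_ext _ _ (fun p => sumC L (fun l => Cmult (Cmult (RtoC (indic (J (ext l)) * / M (ext l))) (mono n z (ext l)))
       (Cmult (RtoC (fst p)) (avgC n N (fun w => Cmult (psi (pt p w) y) (Cconj (mono n (pt p w) (ext l))))))))).
    + rewrite sumC_swap; apply: sumC_ext => l _. rewrite sumC_scal /cq. ring.
    + move=> p _. rewrite (avgC_ext _ _ _ (fun w => sumC L (fun l => Cmult (Cmult (RtoC (indic (J (ext l)) * / M (ext l))) (mono n z (ext l)))
       (Cmult (psi (pt p w) y) (Cconj (mono n (pt p w) (ext l))))))).
      * rewrite avgC_sum -sumC_scal; apply: sumC_ext => l _. rewrite avgC_scal. ring.
      * move=> g. rewrite /K /mpoly sumC_conj -sumC_scal; apply: sumC_ext => l _.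
        rewrite /pt mono_mult !Cmult_conj Cconj_conj.
        have -> : forall x, Cconj (RtoC x) = RtoC x by move=> x; apply: injective_projections => /=; ring.
        ring.
  rewrite E. apply: Rle_trans (Cmod_sum _ _) _.
  have H1 : sumR mu (fun p => fst p * avgR n N (fun w => Cmod (K p w) ^ 2)) <= k ^ 2.
    rewrite Hk2. apply: Rle_trans (Hmu4 z Hz).
    rewrite (sumR_ext _ _ (fun p => sumR L (fun l => (indic (J (ext l)) * / M (ext l) * Cmod (mono n z (ext l))) ^ 2 * (fst p * Cmod (mono n (snd p) (ext l)) ^ 2)))).
    + rewrite sumR_swap; apply: sumR_le => l Hl. rewrite sumR_scal -/(M (ext l)).
      have HM := HMl l Hl. have Hi := indic_01 (J (ext l)).
      have -> : (indic (J (ext l)) * / M (ext l) * Cmod (mono n z (ext l))) ^ 2 * M (ext l) = indic (J (ext l)) ^ 2 * (Cmod (mono n z (ext l)) ^ 2 / M (ext l)).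
        field; lra.
      have : 0 <= Cmod (mono n z (ext l)) ^ 2 / M (ext l).
        apply: Rmult_le_pos; [exact: pow2_ge_0|apply/Rlt_le/Rinv_0_lt_compat; lra].
      have : indic (J (ext l)) ^ 2 <= 1 by nra. nra.
    + move=> p _. rewrite /K (parseval n m) //; [|exact: NoDup_deg_list|exact: incl_deg_list].
      rewrite -sumR_scal; apply: sumR_ext => l Hl. rewrite !Cmod_mult Cmod_conj Cmod_R Rabs_pos_eq; first ring.
      have HM := HMl l Hl. have Hi := indic_01 (J (ext l)). apply: Rmult_le_pos; [lra|apply/Rlt_le/Rinv_0_lt_compat; lra].
  apply: (Rle_trans _ (sumR mu (fun p => norm y * (fst p * avgR n N (fun w => Cmod (K p w)))))).
    apply: sumR_le => p Hpm. case: (Hmu1 p Hpm) => Hp0 _. rewrite Cmod_mult Cmod_R Rabs_pos_eq //.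
    rewrite -Rmult_assoc (Rmult_comm (norm y)) Rmult_assoc. apply: Rmult_le_compat_l => //.
    apply: Rle_trans (Cmod_avg _ _ _) _. rewrite -avgR_scal /avgR.
    apply: Rmult_le_compat_l; first exact: INR_pow_inv_ge0. apply: sumR_le => g _.
    rewrite Cmod_mult Cmod_conj. apply: Rmult_le_compat_r; first exact: Cmod_ge_0.
    by case: (Hpsi' (pt p (tor N g)) (Hpt p g Hpm)) => _ [_ [H _]].
  rewrite sumR_scal Rmult_comm. apply: Rmult_le_compat_r => //.
  (* [a <= a ^ 2 / (2 * k) + k / 2] compares the first moment with the second; this [k] makes both
     terms at most [k / 2]. *)
  have H2 : sumR mu (fun p => fst p * avgR n N (fun w => Cmod (K p w))) <= / (2 * k) * (sumR mu (fun p => fst p * avgR n N (fun w => Cmod (K p w) ^ 2))) + k / 2 * sumR mu fst.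
    rewrite -!sumR_scal -sumR_plus; apply: sumR_le => p Hpm. case: (Hmu1 p Hpm) => Hp0 _.
    have -> : / (2 * k) * (fst p * avgR n N (fun w => Cmod (K p w) ^ 2)) + k / 2 * fst p = fst p * (/ (2 * k) * avgR n N (fun w => Cmod (K p w) ^ 2) + k / 2) by ring.
    apply: Rmult_le_compat_l => //. rewrite -[X in _ <= _ + X](avgR_const n N (k / 2)); last by rewrite /N; lia.
    rewrite -avgR_scal -avgR_plus; apply: avgR_le => g. move: (Cmod _) => a.
    have -> : / (2 * k) * a ^ 2 + k / 2 = / (2 * k) * (a ^ 2 + k ^ 2) by field; lra.
    apply: (Rmult_le_reg_l (2 * k)); first lra. rewrite -Rmult_assoc Rinv_r; last lra. have := pow2_ge_0 (a - k). lra.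
  rewrite Hmu2 in H2. apply: Rle_trans H2 _.
  have H3 : / (2 * k) * sumR mu (fun p => fst p * avgR n N (fun w => Cmod (K p w) ^ 2)) <= / (2 * k) * k ^ 2.
    by apply: Rmult_le_compat_l => //; apply/Rlt_le/Rinv_0_lt_compat; lra.
  have E3 : / (2 * k) * k ^ 2 = k / 2 by field; lra. lra.
Qed.

(** * The Banach space of bounded functions *)

Section BoundedFunctions.
Variables (X : Type) (x0 : X).

(** With [X] the unit ball, this space of bounded functions receives the polynomials isometrically
    by evaluation, and it also contains functions of [z] and [conj z], such as Riesz products. *)
Record bfun := Bfun { bval : X -> C; bval_bounded : exists M, forall x, Cmod (bval x) <= M }.

Lemma bfun_eq f g : (forall x, bval f x = bval g x) -> f = g.
Proof.
case: f => f Hf; case: g => g Hg /= H. have E : f = g by apply: functional_extensionality.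
subst g. by rewrite (proof_irrelevance _ Hf Hg).
Qed.

Program Definition bplus f g := Bfun (fun x => Cplus (bval f x) (bval g x)) _.
Next Obligation.
case: (bval_bounded f) => M HM; case: (bval_bounded g) => M' HM'. exists (M + M') => x.
have := Cmod_triangle (bval f x) (bval g x). have := HM x. have := HM' x. lra.
Qed.
Program Definition bscal (t : C) f := Bfun (fun x => Cmult t (bval f x)) _.
Next Obligation.
case: (bval_bounded f) => M HM. exists (Cmod t * M) => x. rewrite Cmod_mult.
apply: Rmult_le_compat_l; [exact: Cmod_ge_0|exact: HM].
Qed.
Program Definition bzero := Bfun (fun _ => RtoC 0) _.
Next Obligation. exists 0 => _. rewrite Cmod_0; lra. Qed.
Definition bopp f := bscal (RtoC (-1)) f.

Definition bnorm f : R := real (Lub_Rbar (fun t => exists x, t = Cmod (bval f x))).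

Lemma bnorm_is_lub f : is_lub (fun t => exists x, t = Cmod (bval f x)) (bnorm f).
Proof.
apply: Lub_Rbar_is_lub; last by eexists; exists x0.
case: (bval_bounded f) => M HM. exists M => t [x ->]. exact: HM.
Qed.
Lemma bnorm_ub f x : Cmod (bval f x) <= bnorm f.
Proof. case: (bnorm_is_lub f) => H _. apply: H. by exists x. Qed.
Lemma bnorm_le f M : (forall x, Cmod (bval f x) <= M) -> bnorm f <= M.
Proof. move=> H. case: (bnorm_is_lub f) => _ H'. by apply: H' => t [x ->]. Qed.

(** Transparent, like the mixins below, so that [plus], [scal] and [norm] reduce to the operations
    on bounded functions. *)
Definition bfun_AbelianMonoid_mixin : AbelianMonoid.mixin_of bfun.
Proof.
apply: (AbelianMonoid.Mixin _ bplus bzero).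
- by move=> f g; apply: bfun_eq => x /=; ring.
- by move=> f g h; apply: bfun_eq => x /=; ring.
- by move=> f; apply: bfun_eq => x /=; ring.
Defined.
Definition bfun_AbelianMonoid := AbelianMonoid.Pack bfun bfun_AbelianMonoid_mixin bfun.
Definition bfun_AbelianGroup_mixin : AbelianGroup.mixin_of bfun_AbelianMonoid.
Proof.
apply: (AbelianGroup.Mixin bfun_AbelianMonoid bopp).
by move=> f; apply: bfun_eq => x /=; ring.
Defined.
Definition bfun_AbelianGroup := AbelianGroup.Pack bfun (AbelianGroup.Class _ _ bfun_AbelianGroup_mixin) bfun.
Definition bfun_ModuleSpace_mixin : ModuleSpace.mixin_of C_Ring bfun_AbelianGroup.
Proof.
apply: (ModuleSpace.Mixin C_Ring bfun_AbelianGroup bscal).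
- by move=> a b f; apply: bfun_eq => x /=; rewrite /mult /=; ring.
- by move=> f; apply: bfun_eq => x /=; rewrite /one /=; ring.
- by move=> a f g; apply: bfun_eq => x /=; ring.
- by move=> a b f; apply: bfun_eq => x /=; rewrite {1}/plus /=; ring.
Defined.
Definition bfun_ModuleSpace_class := ModuleSpace.Class C_Ring bfun _ bfun_ModuleSpace_mixin.

Definition bdist f g := bnorm (bplus g (bopp f)).
Lemma bdist_ub f g x : Cmod (Cminus (bval g x) (bval f x)) <= bdist f g.
Proof.
have := bnorm_ub (bplus g (bopp f)) x. rewrite -/(bdist f g) /=.
have -> // : Cplus (bval g x) (Cmult (RtoC (-1)) (bval f x)) = Cminus (bval g x) (bval f x) by ring.
Qed.
Lemma bdist_le f g M : (forall x, Cmod (Cminus (bval g x) (bval f x)) <= M) -> bdist f g <= M.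
Proof.
move=> H; apply: bnorm_le => x /=. have -> : Cplus (bval g x) (Cmult (RtoC (-1)) (bval f x)) = Cminus (bval g x) (bval f x) by ring.
exact: H.
Qed.
Lemma Cmod_minus_sym a b : Cmod (Cminus a b) = Cmod (Cminus b a).
Proof. by rewrite -Cmod_opp; congr Cmod; ring. Qed.
Lemma Cmod_minus_triangle a b c : Cmod (Cminus a c) <= Cmod (Cminus a b) + Cmod (Cminus b c).
Proof. have -> : Cminus a c = Cplus (Cminus a b) (Cminus b c) by ring. exact: Cmod_triangle. Qed.

Definition bfun_UniformSpace_mixin : UniformSpace.mixin_of bfun.
Proof.
apply: (UniformSpace.Mixin _ bzero (fun f e g => bdist f g < e)).
- move=> f e. apply: Rle_lt_trans (cond_pos e). apply: bdist_le => x.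
  have -> : Cminus (bval f x) (bval f x) = RtoC 0 by ring. rewrite Cmod_0; lra.
- move=> f g e H. apply: Rle_lt_trans H. apply: bdist_le => x. rewrite Cmod_minus_sym. exact: bdist_ub.
- move=> f g h e1 e2 H1 H2. apply: Rle_lt_trans (Rplus_lt_compat _ _ _ _ H1 H2). apply: bdist_le => x.
  have := Cmod_minus_triangle (bval h x) (bval g x) (bval f x). have := bdist_ub f g x. have := bdist_ub g h x. lra.
Defined.
Definition bfun_UniformSpace := UniformSpace.Pack bfun bfun_UniformSpace_mixin bfun.
Definition bfun_NormedModuleAux_class := NormedModuleAux.Class C_AbsRing bfun bfun_ModuleSpace_class bfun_UniformSpace_mixin.
Definition bfun_NormedModuleAux := NormedModuleAux.Pack C_AbsRing bfun bfun_NormedModuleAux_class bfun.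
Definition bfun_NormedModule_mixin : NormedModule.mixin_of C_AbsRing bfun_NormedModuleAux.
Proof.
apply: (NormedModule.Mixin C_AbsRing bfun_NormedModuleAux bnorm 1).
- move=> f g. apply: bnorm_le => x /=. have := Cmod_triangle (bval f x) (bval g x).
  have := bnorm_ub f x. have := bnorm_ub g x. rewrite /plus /=. lra.
- move=> t f. apply: bnorm_le => x. rewrite /scal /= Cmod_mult. apply: Rmult_le_compat_l; [exact: Cmod_ge_0|exact: bnorm_ub].
- by move=> f g e.
- move=> f g e; by rewrite Rmult_1_l.
- move=> f Hf. apply: bfun_eq => x. apply: Cmod_eq_0. apply: Rle_antisym; last exact: Cmod_ge_0. rewrite -Hf; exact: bnorm_ub.
Defined.
Definition bfun_NormedModule_class := NormedModule.Class C_AbsRing bfun bfun_NormedModuleAux_class bfun_NormedModule_mixin.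

(** The limit is taken pointwise in the complex plane. At a point [x], a member of the filter that
    is close to [f0] uniformly and to the limit at [x] transfers the uniform estimate; [sqrt 2]
    appears because complex balls are squares here. *)
Lemma bfun_complete (F : (bfun -> Prop) -> Prop) : ProperFilter F -> @cauchy bfun_UniformSpace F ->
  exists g, forall eps : posreal, F (fun f => bdist g f < eps).
Proof.
move=> HF Hc.
pose Fx x := filtermap (fun f => bval f x) F.
have HFx x : ProperFilter (Fx x) by exact: filtermap_proper_filter.
have Hcx x : @cauchy C_UniformSpace (Fx x).
  move=> e. have [f0 Hf0] := Hc e. exists (bval f0 x). rewrite /Fx /filtermap.
  apply: (@filter_imp _ F _ _ _ _ Hf0) => f Hf. apply: C_NormedModule_mixin_compat1.
  apply: Rle_lt_trans Hf. exact: (bdist_ub f0 f x).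
pose g x : C := @lim C_CompleteNormedModule (Fx x).
have Hg x (e : posreal) : F (fun f => Cmod (Cminus (bval f x) (g x)) < sqrt 2 * e).
  have H := @complete_cauchy C_CompleteNormedModule (Fx x) (HFx x) (Hcx x) e.
  change (F (fun f => @ball C_UniformSpace (g x) e (bval f x))) in H.
  apply: (@filter_imp _ F _ _ _ _ H) => f Hf. exact: (C_NormedModule_mixin_compat2 (g x) (bval f x) e Hf).
have Hunif (e : posreal) f0 : F (fun f => bdist f0 f < e) -> forall x, Cmod (Cminus (g x) (bval f0 x)) <= 3 * e.
  move=> H x. have [f [H1 H2]] := filter_ex _ (filter_and _ _ H (Hg x e)).
  have H3 := bdist_ub f0 f x. have H4 := Cmod_minus_triangle (g x) (bval f x) (bval f0 x).
  rewrite (Cmod_minus_sym (g x) (bval f x)) in H4. have Hs : sqrt 2 <= 2.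
    rewrite -[X in _ <= X](sqrt_pow2 2); last lra. apply: sqrt_le_1_alt; lra.
  have He := cond_pos e. nra.
have Hgb : exists M, forall x, Cmod (g x) <= M.
  have [f0 Hf0] := Hc (mkposreal 1 Rlt_0_1). case: (bval_bounded f0) => M HM. exists (M + 3) => x.
  have := Hunif _ _ Hf0 x. have := HM x. have := Cmod_triangle (Cminus (g x) (bval f0 x)) (bval f0 x).
  have -> : Cplus (Cminus (g x) (bval f0 x)) (bval f0 x) = g x by ring. rewrite /=; lra.
exists (Bfun g Hgb) => eps.
have He5 : 0 < eps / 5 by have := cond_pos eps; lra.
have [f0 Hf0] := Hc (mkposreal _ He5).
apply: (@filter_imp _ F _ _ _ _ Hf0) => f Hf. apply: (Rle_lt_trans _ (4 * (eps / 5))); last by have := cond_pos eps; lra.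
apply: bdist_le => x /=.
have H1 := Hunif _ _ Hf0 x. have H2 := bdist_ub f0 f x. have H3 := Cmod_minus_triangle (bval f x) (bval f0 x) (g x).
rewrite (Cmod_minus_sym (bval f0 x) (g x)) in H3. rewrite /ball /= in Hf. rewrite /= in H1. lra.
Qed.

(** The limit is a choice depending on the filter. Filters finer than each other are equal by
    extensionality, so the same limit is chosen for both. *)
Definition bfun_CompleteSpace_mixin : CompleteSpace.mixin_of bfun_UniformSpace.
Proof.
apply: (CompleteSpace.Mixin bfun_UniformSpace
  (fun F => epsilon (inhabits bzero) (fun g => forall eps : posreal, F (fun f => bdist g f < eps)))).
- move=> F HF Hc eps. exact: (epsilon_spec (inhabits bzero) _ (bfun_complete F HF Hc) eps).
- move=> F1 F2 H12 H21. have -> : F1 = F2.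
    apply: functional_extensionality => P. apply: propositional_extensionality; split; [exact: H21|exact: H12].
  move=> eps. exact: (@ball_center bfun_UniformSpace).
Defined.

Definition bfun_space : CompleteNormedModule C_AbsRing :=
  CompleteNormedModule.Pack C_AbsRing bfun (CompleteNormedModule.Class C_AbsRing bfun bfun_NormedModule_class bfun_CompleteSpace_mixin) bfun.

End BoundedFunctions.

(** * Riesz products *)

(** Tetrahedral, that is squarefree, exponents. *)
Definition tetra (l : list nat) : Prop := forall i, (nth i l 0 <= 1)%nat.
Definition tetra_count n m : R := sumR (deg_list n m) (fun l => indic (tetra l /\ list_sum l = m)).

Lemma om_conj N k : (0 < N)%nat -> Cpow (om N k) (N - 1) = Cconj (om N k).
Proof.
move=> HN.
have H : Cmult (Cpow (om N k) (N - 1)) (om N k) = RtoC 1.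
  rewrite Cmult_comm -Cpow_S. have -> : S (N - 1) = N by lia.
  by rewrite om_pow -Cpow_mult_r Nat.mul_comm Cpow_mult_r -om_pow om_N // Cpow_1_l.
by rewrite -[LHS]Cmult_1_r -(Cconj_om_mul N k) Cmult_assoc H Cmult_1_l.
Qed.

Lemma tetra_LambdaT n m l : length l = n -> tetra l -> list_sum l = m -> LambdaT m (ext l).
Proof.
move=> Hl Ht Hm. split=> //. exists (length l); split; last by rewrite psum_ext.
move=> i Hi. by rewrite /ext nth_overflow.
Qed.

Section Riesz.
Variables (r : R) (s : Rbar) (n m : nat) (J : multi_index -> Prop).
Hypotheses (Hr : 2 <= r) (Hs : Rbar_le (Finite 1) s) (HJ : deg_le J m) (Hm : (1 <= m)%nat).

Definition ball_type := {z : nat -> C | lorentz r s n z < 1}.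
Definition ball_0 : ball_type.
Proof. exists (fun _ => RtoC 0). rewrite lorentz_0 //; lra. Defined.
Definition linf_ball := bfun_space ball_type ball_0.

Definition eval_embed (c : multi_index -> C) : linf_ball.
Proof.
refine (Bfun ball_type (fun z => peval n m c (proj1_sig z)) _).
exists (supnorm r s n m c) => z. apply: supnorm_ub => //. exact: (proj2_sig z).
Defined.

Lemma eval_embed_iso : iso_embed r s n m J linf_ball eval_embed.
Proof.
split; last split.
- move=> c1 c2 _ _. apply: bfun_eq => z /=. exact: peval_plus.
- move=> t c _. apply: bfun_eq => z /=. exact: peval_scal.
- move=> c _. apply: Rle_antisym.
  + apply: (bnorm_le ball_type ball_0) => z /=. apply: supnorm_ub => //. exact: (proj2_sig z).
  + apply: supnorm_lub => // z Hz. exact: (bnorm_ub ball_type ball_0 (eval_embed c) (exist _ z Hz)).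
Qed.

Variables (Q : linf_ball -> linf_ball) (k : R).
Hypothesis HQ : is_proj J linf_ball eval_embed Q.
Hypothesis Hk : forall y, norm (Q y) <= k * norm y.
Hypothesis HT : forall a, LambdaT m a -> J a.
Variables (S2 rho t : R).
Hypothesis HS2 : forall z, lorentz r s n z < 1 -> sumR (seq 0 n) (fun i => Cmod (z i) ^ 2) <= S2.
Hypothesis Hrho : 0 < rho.
Hypothesis Hrho1 : lorentz r s n (fun _ => RtoC rho) < 1.
Hypothesis Ht : 0 <= t.

Let N := S (S m).
(** The three terms of [1 + i t (x + conj x)], numbered 0, 1, 2. *)
Let psi (x : C) (e : nat) : C :=
  match e with O => RtoC 1 | S O => Cmult (Cmult Ci (RtoC t)) x | _ => Cmult (Cmult Ci (RtoC t)) (Cconj x) end.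
(* The exponent of [w] in the [l]-th term of the Riesz product.  As [conj w = w ^ (N - 1)] for
   [N]-th roots of unity, [-1] is encoded by [N - 1 = m + 1], which is no exponent of [J]. *)
Let nu (l : list nat) (i : nat) : nat := match nth i l 0%nat with O => 0%nat | S O => 1%nat | _ => (N - 1)%nat end.

Definition riesz_monomial (l : list nat) : linf_ball.
Proof.
refine (Bfun ball_type (fun z => prodC (seq 0 n) (fun i => psi (proj1_sig z i) (nth i l 0%nat))) _).
exists (prodR (seq 0 n) (fun _ => 1 + t)) => z. rewrite Cmod_prod. apply: prodR_le => i /in_seq Hi.
split; first exact: Cmod_ge_0. have Hz := ball_le1 r s n Hs _ i (proj2_sig z) (proj2 Hi).
have Hz0 := Cmod_ge_0 (proj1_sig z i).
rewrite /psi; case: (nth i l 0%nat) => [|[|e]]; first by rewrite Cmod_1; lra.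
- rewrite !Cmod_mult Cmod_Ci Cmod_R Rabs_pos_eq //. nra.
- rewrite !Cmod_mult Cmod_Ci Cmod_conj Cmod_R Rabs_pos_eq //. nra.
Defined.

(** The imaginary coefficient removes the linear term: [|1 + 2 i t Re x| ^ 2 = 1 + 4 t ^ 2 (Re x) ^
    2]. Hence only the sum of squares over the ball enters the bound of the product. *)
Lemma riesz_factor (x : C) : Cmod (Cplus 1 (Cmult (Cmult Ci (RtoC t)) (Cplus x (Cconj x)))) <= exp (2 * t ^ 2 * Cmod x ^ 2).
Proof.
set w := Cplus _ _.
have H : Cmod w ^ 2 = 1 + 4 * t ^ 2 * Re x ^ 2.
  rewrite Cmod2_alt /w /Re /Im /=. ring.
have H1 : Re x ^ 2 <= Cmod x ^ 2 by rewrite Cmod2_alt; have := pow2_ge_0 (Im x); lra.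
have H2 : Cmod w ^ 2 <= exp (2 * t ^ 2 * Cmod x ^ 2) ^ 2.
  rewrite exp_pow H. apply: Rle_trans (one_plus_le_exp _). rewrite /=. have := pow2_ge_0 t. rewrite /= in H1 *. nra.
have H3 := exp_pos (2 * t ^ 2 * Cmod x ^ 2). have H4 := Cmod_ge_0 w.
apply: Rnot_lt_le => H5. nra.
Qed.

Lemma riesz_product_bound (w z : nat -> C) : lorentz r s n z < 1 -> (forall i, (i < n)%nat -> Cmod (w i) = 1) ->
  Cmod (prodC (seq 0 n) (fun i => Cplus 1 (Cmult (Cmult Ci (RtoC t)) (Cplus (Cmult (z i) (w i)) (Cconj (Cmult (z i) (w i)))))))
   <= exp (2 * t ^ 2 * S2).
Proof.
move=> Hz Hw. rewrite Cmod_prod.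
apply: (Rle_trans _ (prodR (seq 0 n) (fun i => exp (2 * t ^ 2 * Cmod (z i) ^ 2)))).
- apply: prodR_le => i /in_seq Hi. split; first exact: Cmod_ge_0.
  have := riesz_factor (Cmult (z i) (w i)). rewrite Cmod_mult Hw ?Rmult_1_r //; lia.
- rewrite prodR_exp sumR_scal. apply: exp_le_compat.
  apply: Rmult_le_compat_l; [have := pow2_ge_0 t; lra|exact: HS2].
Qed.

Definition riesz_product (g : list nat) : linf_ball.
Proof.
refine (Bfun ball_type (fun z => prodC (seq 0 n) (fun i => Cplus 1 (Cmult (Cmult Ci (RtoC t))
   (Cplus (Cmult (proj1_sig z i) (tor N g i)) (Cconj (Cmult (proj1_sig z i) (tor N g i))))))) _).
exists (exp (2 * t ^ 2 * S2)) => z. apply: riesz_product_bound; [exact: (proj2_sig z)|]. move=> i _; exact: Cmod_tor.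
Defined.

Definition sumY (L : list (list nat)) (f : list nat -> linf_ball) : linf_ball :=
  fold_right (fun l y => plus (f l) y) zero L.

Lemma bval_sumY L f z : bval _ (sumY L f) z = sumC L (fun l => bval _ (f l) z).
Proof. by elim: L => [|l L IH] //; rewrite sumC_cons -IH. Qed.

Lemma riesz_product_expand g : riesz_product g =
  sumY (mindices n 2) (fun l => scal (mono n (tor N g) (nu l) : C_AbsRing) (riesz_monomial l)).
Proof.
apply: bfun_eq => z. rewrite bval_sumY.
pose phi i e := Cmult (Cpow (tor N g i) (match e with O => 0%nat | S O => 1%nat | _ => (N - 1)%nat end)) (psi (proj1_sig z i) e).
rewrite (sumC_ext _ _ (fun l => prodC (seq 0 n) (fun i => phi i (nth i l 0%nat)))); last first.
  move=> l _. by rewrite /phi prodC_mult.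
rewrite sumC_mindices. apply: prodC_ext => i _.
have E : Cpow (tor N g i) (N - 1) = Cconj (tor N g i) by apply: om_conj; rewrite /N; lia.
have -> : sumC (seq 0 3) (phi i) = Cplus (phi i 0%nat) (Cplus (phi i 1%nat) (phi i 2%nat)) by rewrite /sumC /= Cplus_0_r.
rewrite /phi E Cmult_conj /psi [Cpow _ 0]/= [Cpow _ 1]/=. ring.
Qed.

(* Averaging over the torus kills every [Q (riesz_monomial l)] except for the [l] with entries
   in [{0, 1}], where [riesz_monomial l] is a multiple of a monomial and [Q] is the identity. *)
Lemma riesz_lower : tetra_count n m * (t * rho) ^ m <= k * exp (2 * t ^ 2 * S2).
Proof.
have [HIp [HIs HIn]] := eval_embed_iso.
have [HQp [HQs [HQr HQi]]] := HQ.
pose delta l (a : multi_index) : C := RtoC (indic (a = ext l)).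
(* The coefficients of [Q (riesz_monomial l)] are identified only for 0/1 lists [l] of degree [m];
   for all other [l] they stay unspecified. *)
have Hc l : exists c, suppJ J c /\ Q (riesz_monomial l) = eval_embed c /\
   (length l = n -> tetra l -> list_sum l = m -> c (ext l) = Cpow (Cmult Ci (RtoC t)) m).
  case: (classic (length l = n /\ tetra l /\ list_sum l = m)) => [[H1 [H2 H3]]|H]; last first.
    have [c [Hc1 Hc2]] := HQr (riesz_monomial l). exists c; split=> //; split=> // H1 H2 H3. case: H; tauto.
  have Hd : suppJ J (delta l).
    move=> a Ha. have -> : a = ext l by apply: NNPP => E; apply: Ha; rewrite /delta indic_F.
    apply: HT. exact: (tetra_LambdaT n).
  exists (fun a => Cmult (Cpow (Cmult Ci (RtoC t)) m) (delta l a)); split; first exact: suppJ_scal.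
  split; last by move=> _ _ _; rewrite /delta indic_T //; ring.
  have E : riesz_monomial l = scal (Cpow (Cmult Ci (RtoC t)) m : C_AbsRing) (eval_embed (delta l)).
    apply: bfun_eq => z. change (bval _ (scal (Cpow (Cmult Ci (RtoC t)) m : C_AbsRing) (eval_embed (delta l))) z)
      with (Cmult (Cpow (Cmult Ci (RtoC t)) m) (peval n m (delta l) (proj1_sig z))).
    have -> : peval n m (delta l) (proj1_sig z) = mono n (proj1_sig z) (ext l).
      have Hl : In l (mindices n m) by apply/incl_deg_list/in_deg_list; split=> //; lia.
      rewrite -[RHS](sumC_indic_eq (mindices n m) (fun l => mono n (proj1_sig z) (ext l)) l (NoDup_mindices _ _) Hl).
      rewrite peval_mpoly; apply: sumC_ext => l' Hl'. rewrite Cmult_comm; congr Cmult; congr RtoC.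
      apply: indic_ext; split; last by move=> ->. move=> E; apply: (ext_inj n m) => // i _. by rewrite E.
    rewrite -{1}H3 -list_sum_pow H1 -[RHS](prodC_mult (seq 0 n)). apply: prodC_ext => i _.
    rewrite /psi /ext. have := H2 i. case: (nth i l 0%nat) => [|[|e]] He; last lia; rewrite /=; ring.
  by rewrite E HQs HQi // HIs.
have [c Hc'] := choice_fun _ Hc.
have Hsum (w : nat -> C) L : suppJ J (fun a => sumC L (fun l => Cmult (mono n w (nu l)) (c l a))) /\
  Q (sumY L (fun l => scal (mono n w (nu l) : C_AbsRing) (riesz_monomial l))) =
  eval_embed (fun a => sumC L (fun l => Cmult (mono n w (nu l)) (c l a))).
  elim: L => [|l L [IH1 IH2]].
  - split; first by move=> a; case.
    have -> : sumY [] (fun l => scal (mono n w (nu l) : C_AbsRing) (riesz_monomial l)) = scal (RtoC 0 : C_AbsRing) (zero : linf_ball).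
      by rewrite scal_zero_r.
    rewrite HQs. apply: bfun_eq => z. rewrite [RHS]/= peval_mpoly /mpoly sumC_0; last by move=> l _; rewrite /sumC /=; ring.
    rewrite /=; ring.
  - have [Hc1 [Hc2 _]] := Hc' l. split.
    + apply: (suppJ_plus J (fun a => Cmult (mono n w (nu l)) (c l a))) => //. exact: suppJ_scal.
    + rewrite [sumY _ _]/= HQp IH2 HQs Hc2 -HIs // -HIp //. exact: suppJ_scal.
pose cw (w : nat -> C) (a : multi_index) := sumC (mindices n 2) (fun l => Cmult (mono n w (nu l)) (c l a)).
set K := k * exp (2 * t ^ 2 * S2).
have Hsup g : supnorm r s n m (cw (tor N g)) <= K.
  have [H1 H2] := Hsum (tor N g) (mindices n 2). rewrite -HIn // -H2 -riesz_product_expand.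
  apply: Rle_trans (Hk _) _.
  (* A negative [k] contradicts the norm inequality, the product having the value 1 at the
     origin. *)
  have Hk0 : 0 <= k \/ k < 0 by lra.
  have Hn1 : norm (riesz_product g) <= exp (2 * t ^ 2 * S2).
    apply: (bnorm_le ball_type ball_0) => z. apply: riesz_product_bound; [exact: (proj2_sig z)|]. move=> i _; exact: Cmod_tor.
  case: Hk0 => Hk0; first by apply: Rmult_le_compat_l.
  have := Hk (riesz_product g). have := norm_ge_0 (Q (riesz_product g)). have := norm_ge_0 (riesz_product g).
  have Hn2 : 1 <= norm (riesz_product g).
    have := bnorm_ub ball_type ball_0 (riesz_product g) ball_0. rewrite [bval _ _ _]prodC_1 ?Cmod_1 //.
    move=> i _. rewrite [proj1_sig _ _]/=. apply: injective_projections => /=; ring.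
  nra.
(* The part of degree [m] at [rho * conj w]: the conjugate undoes the rotation by [w], so the 0/1
   terms survive the average, and they add up because their coefficients are equal. *)
pose H w := mpoly n (deg_list n m) (fun l => Cmult (cw w (ext l)) (RtoC (indic (list_sum l = m)))) (fun i => Cmult (RtoC rho) (Cconj (w i))).
have HH g : Cmod (H (tor N g)) <= K.
  apply: (hom_part_le n m); [by move=> l /in_deg_list|lia|]. move=> x Hx.
  have [H1 _] := Hsum (tor N g) (mindices n 2).
  rewrite -(peval_deg J) //. apply: Rle_trans (Hsup g). apply: supnorm_ub => //.
  apply: (ball_shrink r s n Hs (fun _ => RtoC rho)) => // i _.
  rewrite !Cmod_mult Hx Cmod_conj Cmod_tor; lra.
have Havg : avgC n N H = Cmult (RtoC (tetra_count n m * rho ^ m)) (Cpow (Cmult Ci (RtoC t)) m).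
  rewrite (avgC_ext _ _ _ (fun w => sumC (deg_list n m) (fun l => sumC (mindices n 2) (fun l' =>
     Cmult (Cmult (c l' (ext l)) (RtoC (indic (list_sum l = m) * rho ^ list_sum l))) (Cmult (mono n w (nu l')) (Cconj (mono n w (ext l)))))))); last first.
    move=> g. rewrite /H /mpoly /cw. apply: sumC_ext => l /in_deg_list [Hl _]. rewrite mono_dilate // -mono_conj.
    rewrite -!sumC_scal_r. apply: sumC_ext => l' _. rewrite RtoC_mult RtoC_pow; ring.
  rewrite avgC_sum /tetra_count -sumR_scal_r RtoC_sum -sumC_scal_r. apply: sumC_ext => l Hl.
  have /in_deg_list [Hl1 Hl2] := Hl.
  have Hnu l' i : (nu l' i < N)%nat by rewrite /nu; case: (nth i l' 0%nat) => [|[|e]]; rewrite /N; lia.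
  have Hln i : (ext l i <= m)%nat by have := nth_le_list_sum i l; rewrite /ext; lia.
  rewrite avgC_sum (sumC_ext _ _ (fun l' => Cmult (Cmult (c l' (ext l)) (RtoC (indic (list_sum l = m) * rho ^ list_sum l)))
     (RtoC (indic (forall i, (i < n)%nat -> nu l' i = ext l i))))); last first.
    move=> l' _. rewrite avgC_scal torus_orth //. by move=> i _; have := Hln i; rewrite /N; lia.
  case: (Nat.eq_dec (list_sum l) m) => Hlm; last first.
    rewrite (indic_F (tetra l /\ list_sum l = m)); last by move=> [].
    rewrite sumC_0; first by rewrite Rmult_0_l; ring. move=> l' _. rewrite indic_F // Rmult_0_l; ring.
  have Heq l' : In l' (mindices n 2) -> (forall i, (i < n)%nat -> nu l' i = ext l i) -> l = l' /\ tetra l.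
    move=> Hl' E. have Hnth i : (i < n)%nat -> nth i l 0%nat = nth i l' 0%nat /\ (nth i l 0 <= 1)%nat.
      move=> Hi. have := E i Hi. have := Hln i. rewrite /nu /ext. case: (nth i l' 0%nat) => [|[|e]]; rewrite /N; lia.
    have Hll' : length l = length l' by move/in_mindices: Hl' => [-> _].
    split; first by apply: (nth_ext _ _ 0%nat 0%nat) => // i Hi; case: (Hnth i); [lia|].
    move=> i. case: (Nat.lt_ge_cases i n) => Hi; first by case: (Hnth i Hi).
    rewrite nth_overflow; lia.
  case: (classic (tetra l)) => Htl; last first.
    rewrite (indic_F (tetra l /\ list_sum l = m)); last by move=> [].
    rewrite sumC_0; first by rewrite Rmult_0_l; ring. move=> l' Hl'. rewrite (indic_F (forall i, _)); first ring.
    by move=> E; case: (Heq l' Hl' E).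
  have Hl2' : In l (mindices n 2) by apply/in_mindices; split=> // i; have := Htl i; lia.
  rewrite (sumC_ext _ _ (fun l' => Cmult (Cmult (c l' (ext l)) (RtoC (indic (list_sum l = m) * rho ^ list_sum l))) (RtoC (indic (l = l'))))); last first.
    move=> l' Hl'. congr Cmult; congr RtoC. apply: indic_ext; split; first by move=> E; case: (Heq l' Hl' E).
    move=> <- i Hi. rewrite /nu /ext. have := Htl i. case: (nth i l 0%nat) => [|[|e]]; lia.
  rewrite (sumC_indic_eq _ (fun l' => Cmult (c l' (ext l)) (RtoC (indic (list_sum l = m) * rho ^ list_sum l)))) //; last exact: NoDup_mindices.
  case: (Hc' l) => _ [_ ->] //. rewrite !indic_T // Hlm !Rmult_1_l; ring.
have HK := avgC_bound n N H K ltac:(rewrite /N; lia) HH.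
have Hcnt : 0 <= tetra_count n m by apply: sumR_ge0 => l _; exact: indic_ge0.
rewrite Havg Cmod_mult Cmod_R Cmod_pow Cmod_mult Cmod_Ci Cmod_R Rmult_1_l (Rabs_pos_eq t) // Rabs_pos_eq in HK.
- rewrite Rpow_mult_distr. lra.
- apply: Rmult_le_pos => //. apply: pow_le; lra.
Qed.
End Riesz.

(** * Polynomials with small sup norm *)

Definition binary_count n m : R := sumR (mindices n 1) (fun l => indic (list_sum l = m)).

Lemma binary_count_S n m : binary_count (S n) m =
  binary_count n m + sumR (mindices n 1) (fun l => indic (S (list_sum l) = m)).
Proof.
rewrite /binary_count /mindices -/mindices [flat_map _ _]/= app_nil_r sumR_app !sumR_map. by [].
Qed.
Lemma binary_count_0 n : binary_count n 0 = 1.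
Proof.
elim: n => [|n IH]; first by rewrite /binary_count /sumR /= indic_T //; ring.
rewrite binary_count_S IH sumR_0; first ring. move=> l _; by rewrite indic_F.
Qed.
Lemma binary_count_SS n m : binary_count (S n) (S m) = binary_count n (S m) + binary_count n m.
Proof.
rewrite binary_count_S; congr Rplus. apply: sumR_ext => l _. apply: indic_ext; lia.
Qed.
Lemma binary_count_0S m : binary_count 0 (S m) = 0.
Proof. rewrite /binary_count /sumR /= indic_F //; ring. Qed.

(** The absorption identity of binomial coefficients, by induction from Pascal's rule. *)
Lemma binary_count_absorb n m : INR (S m) * binary_count (S n) (S m) = INR (S n) * binary_count n m.
Proof.
elim: n m => [|n IH] m.
- rewrite binary_count_SS binary_count_0S Rplus_0_l. case: m => [|m] //. rewrite binary_count_0S; ring.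
- rewrite binary_count_SS Rmult_plus_distr_l IH. case: m => [|m].
  + rewrite !binary_count_0 (S_INR (S n)) /=; ring.
  + rewrite {1}(S_INR (S m)) Rmult_plus_distr_r (IH m) (binary_count_SS n m) (S_INR (S n)); ring.
Qed.

(** When both arguments grow by 1 the count is multiplied by [(n + 1) / (m + 1)], which is at most
    [n / m] for [m <= n]; so every factor of the resulting product is at least the outermost one. *)
Lemma binary_count_lower n m : (m <= n)%nat -> (1 <= m)%nat -> (INR n / INR m) ^ m <= binary_count n m.
Proof.
elim: m n => [|m IH] [|n] Hmn H1; try lia.
have Hm0 : 0 < INR (S m) by apply: lt_0_INR; lia.
have E : binary_count (S n) (S m) = INR (S n) / INR (S m) * binary_count n m.
  apply: (Rmult_eq_reg_l (INR (S m))); last lra. rewrite binary_count_absorb; field; lra.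
rewrite E -tech_pow_Rmult. apply: Rmult_le_compat_l; first by apply: Rmult_le_pos; [exact: pos_INR|apply/Rlt_le/Rinv_0_lt_compat].
case: m IH Hmn Hm0 {H1 E} => [|m] IH Hmn Hm0; first by rewrite binary_count_0 /=; lra.
apply: Rle_trans (IH n _ _); try lia.
apply: pow_incr; split; first by apply: Rmult_le_pos; [exact: pos_INR|apply/Rlt_le/Rinv_0_lt_compat].
have Hm1 : 0 < INR (S m) by apply: lt_0_INR; lia.
have Hnm : INR (S m) <= INR n by apply: le_INR; lia.
apply: (Rmult_le_reg_r (INR (S m) * INR (S (S m)))); first by nra.
have -> : INR (S n) / INR (S (S m)) * (INR (S m) * INR (S (S m))) = INR (S n) * INR (S m) by field; lra.
have -> : INR n / INR (S m) * (INR (S m) * INR (S (S m))) = INR n * INR (S (S m)) by field; lra.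
rewrite (S_INR n) (S_INR (S m)). nra.
Qed.

Lemma tetra_count_lower n m : (m <= n)%nat -> (1 <= m)%nat -> (INR n / INR m) ^ m <= tetra_count n m.
Proof.
move=> H1 H2. apply: Rle_trans (binary_count_lower n m H1 H2) _. rewrite /binary_count /tetra_count.
apply: (Rle_trans _ (sumR (mindices n 1) (fun l => sumR (deg_list n m) (fun l' => indic (tetra l' /\ list_sum l' = m) * indic (l = l'))))).
- apply: sumR_le => l Hl. case: (classic (list_sum l = m)) => E; last first.
    rewrite indic_F //. apply: sumR_ge0 => l' _. have := indic_01 (tetra l' /\ list_sum l' = m). have := indic_01 (l = l'). nra.
  have /in_mindices [Hl1 Hl2] := Hl.
  rewrite (sumR_indic_eq _ (fun l' => indic (tetra l' /\ list_sum l' = m))); [|exact: NoDup_deg_list|by apply/in_deg_list; split=> //; lia].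
  rewrite !indic_T //; lra.
- rewrite sumR_swap; apply: sumR_le => l _.
  rewrite (sumR_ext _ _ (fun l' => indic (tetra l /\ list_sum l = m) * indic (l = l'))); last by move=> l' _; congr Rmult; apply: indic_ext; split=> ->.
  apply: (sumR_indic_le _ (fun _ => indic (tetra l /\ list_sum l = m))); first exact: NoDup_mindices.
  exact: indic_ge0.
Qed.

(* [e_m (y) * x ^ m <= prod_i (1 + x * y_i) <= exp (x * T)] with [x = m / T]. *)
Lemma elem_sym_bound n m (y : nat -> R) T : (1 <= m)%nat -> 0 < T -> (forall i, (i < n)%nat -> 0 <= y i) ->
  sumR (seq 0 n) y <= T ->
  sumR (deg_list n m) (fun l => indic (tetra l /\ list_sum l = m) * prodR (seq 0 n) (fun i => y i ^ nth i l 0%nat)) <= (exp 1 * T / INR m) ^ m.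
Proof.
move=> Hm HT Hy HyT. have Hm0 : 0 < INR m by apply: lt_0_INR.
set x := INR m / T. have Hx : 0 < x by apply: Rdiv_lt_0_compat.
pose phi (i e : nat) := match e with O => 1 | 1%nat => x * y i | _ => 0 end.
have Hphi i e : (i < n)%nat -> 0 <= phi i e.
  move=> Hi. have := Hy i Hi. rewrite /phi. case: e => [|[|e]] H; try lra. apply: Rmult_le_pos; lra.
have H1 : sumR (deg_list n m) (fun l => x ^ m * (indic (tetra l /\ list_sum l = m) * prodR (seq 0 n) (fun i => y i ^ nth i l 0%nat)))
  <= sumR (mindices n m) (fun l => prodR (seq 0 n) (fun i => phi i (nth i l 0%nat))).
  have Hpos l : 0 <= prodR (seq 0 n) (fun i => phi i (nth i l 0%nat)) by apply: prodR_ge0 => i /in_seq Hi; apply: Hphi; lia.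
  apply: (Rle_trans _ (sumR (deg_list n m) (fun l => prodR (seq 0 n) (fun i => phi i (nth i l 0%nat))))).
  - apply: sumR_le => l /in_deg_list [Hl _]. case: (classic (tetra l /\ list_sum l = m)) => H; last by rewrite indic_F // Rmult_0_l Rmult_0_r.
    rewrite indic_T // Rmult_1_l. case: H => H1 H2. rewrite -H2 pow_list_sum Hl -prodR_mult. right; apply: prodR_ext => i _.
    have := H1 i. rewrite /phi. case: (nth i l 0%nat) => [|[|e]] He; try lia; rewrite /=; ring.
  - exact: sumR_filter_le.
have H2 : sumR (mindices n m) (fun l => prodR (seq 0 n) (fun i => phi i (nth i l 0%nat))) <= exp 1 ^ m.
  rewrite sumR_mindices. apply: (Rle_trans _ (prodR (seq 0 n) (fun i => exp (x * y i)))).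
  - apply: prodR_le => i /in_seq Hi; split; first by apply: sumR_ge0 => e _; apply: Hphi; lia.
    apply: Rle_trans (one_plus_le_exp _). rewrite sumR_seq_S {1}/phi; apply: Rplus_le_compat_l.
    have -> : m = S (m - 1) by lia.
    rewrite sumR_seq_S sumR_0 //; right; rewrite Rplus_0_r //.
  - rewrite prodR_exp sumR_scal exp_pow Rmult_1_r. have -> : INR m = x * T by rewrite /x; field; lra.
    apply: exp_le_compat. apply: Rmult_le_compat_l; lra.
rewrite sumR_scal in H1.
have Hxm : 0 < x ^ m by apply: pow_lt.
apply: (Rmult_le_reg_l (x ^ m)) => //. rewrite -Rpow_mult_distr.
have -> : x * (exp 1 * T / INR m) = exp 1 by rewrite /x; field; lra. lra.
Qed.

(** The constant 2 exceeds the optimal 1/2 but leaves an elementary proof: [|x| <= 2 * x ^ 2] for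
    [|x| >= 1 / 2], and otherwise [exp y <= / (1 - y)] averages to
    [/ (1 - x ^ 2) <= 1 + 2 * x ^ 2]. *)
Lemma cosh_le_exp x : cosh x <= exp (2 * x ^ 2).
Proof.
rewrite /cosh. case: (Rle_lt_dec (1 / 2) (Rabs x)) => Hx.
- have H0 : x ^ 2 = Rabs x ^ 2 by rewrite RPow_abs Rabs_pos_eq //; exact: pow2_ge_0.
  have H1 : exp x <= exp (2 * x ^ 2) by apply: exp_le_compat; rewrite H0; have := Rle_abs x; nra.
  have H2 : exp (- x) <= exp (2 * x ^ 2) by apply: exp_le_compat; rewrite H0; have := Rle_abs (- x); rewrite Rabs_Ropp; nra.
  lra.
- have [Hx2 Hx1] := Rabs_def2 _ _ Hx.
  have H y : -(1 / 2) < y < 1 / 2 -> exp y <= / (1 - y).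
    move=> Hy. have H := one_plus_le_exp (- y). rewrite exp_Ropp in H. have Hp := exp_pos y.
    rewrite -(Rinv_inv (exp y)). apply: Rinv_le_contravar; lra.
  have H1 := H x ltac:(lra). have H2 := H (- x) ltac:(lra).
  apply: Rle_trans (one_plus_le_exp _).
  have E : (/ (1 - x) + / (1 - - x)) / 2 = / (1 - x ^ 2) by field; nra.
  have H3 : / (1 - x ^ 2) <= 1 + 2 * x ^ 2.
    have Hy : 0 <= x ^ 2 <= 1 / 4 by nra.
    apply: (Rmult_le_reg_l (1 - x ^ 2)); first lra. rewrite Rinv_r; nra.
  lra.
Qed.
Lemma cosh_pos x : 0 < cosh x.
Proof. rewrite /cosh. have := exp_pos x. have := exp_pos (- x). lra. Qed.
Lemma cosh_add x y : cosh (x + y) + cosh (x + - y) = 2 * (cosh x * cosh y).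
Proof.
rewrite /cosh. have -> : - (x + y) = - x + - y by ring. have -> : - (x + - y) = - x + y by ring.
rewrite !exp_plus; field.
Qed.

(* Method of conditional expectations, the potential being [sum q cosh (b + sum eps a)]. *)
Lemma derandomized_signs {W A} (O : list W) (q : W -> R) (a : W -> A -> R) (L : list A) (b : W -> R) :
  (forall w, In w O -> 0 <= q w) -> NoDup L ->
  exists eps : A -> R, (forall x, eps x = 1 \/ eps x = -1) /\
   sumR O (fun w => q w * cosh (b w + sumR L (fun x => eps x * a w x))) <=
   sumR O (fun w => q w * (cosh (b w) * exp (2 * sumR L (fun x => a w x ^ 2)))).
Proof.
move=> Hq. elim: L b => [|x L IH] b HL.
  exists (fun _ => 1); split; first by left. apply: sumR_le => w Hw. rewrite /sumR /= Rplus_0_r Rmult_0_r exp_0 Rmult_1_r; lra.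
inversion HL; subst.
pose Phi sg := sumR O (fun w => q w * (cosh (b w + sg * a w x) * exp (2 * sumR L (fun x => a w x ^ 2)))).
have Hsum : Phi 1 + Phi (-1) <= 2 * sumR O (fun w => q w * (cosh (b w) * exp (2 * sumR (x :: L) (fun x => a w x ^ 2)))).
  rewrite /Phi -sumR_plus -sumR_scal; apply: sumR_le => w Hw.
  rewrite sumR_cons Rmult_plus_distr_l exp_plus. set E := exp (2 * sumR L _). have HE : 0 < E by apply: exp_pos.
  have := cosh_add (b w) (a w x). have -> : 1 * a w x = a w x by ring. have -> : -1 * a w x = - a w x by ring.
  have := cosh_le_exp (a w x). have Hc := cosh_pos (b w). have Hqw := Hq w Hw. move=> H7 H4.
  have H5 : cosh (b w) * cosh (a w x) <= cosh (b w) * exp (2 * a w x ^ 2) by apply: Rmult_le_compat_l; lra.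
  have H6 : q w * E * (cosh (b w + a w x) + cosh (b w + - a w x)) <= q w * E * (2 * (cosh (b w) * exp (2 * a w x ^ 2))).
    apply: Rmult_le_compat_l; [apply: Rmult_le_pos; lra|lra].
  lra.
(* One of the two signs does no worse than their mean, which [Hsum] bounds. *)
have [sg [Hsg Hphi]] : exists sg, (sg = 1 \/ sg = -1) /\ Phi sg <= sumR O (fun w => q w * (cosh (b w) * exp (2 * sumR (x :: L) (fun x => a w x ^ 2)))).
  case: (Rle_lt_dec (Phi 1) (sumR O (fun w => q w * (cosh (b w) * exp (2 * sumR (x :: L) (fun x => a w x ^ 2)))))) => H.
  - exists 1; split; [by left|exact: H].
  - exists (-1); split; [by right|lra].
have [eps [He1 He2]] := IH (fun w => b w + sg * a w x) H2.
exists (fun y => match excluded_middle_informative (x = y) with left _ => sg | right _ => eps y end); split.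
  by move=> y; case: excluded_middle_informative.
apply: Rle_trans Hphi. apply: Rle_trans He2. right. apply: sumR_ext => w _.
congr (_ * cosh _). rewrite sumR_cons. case: excluded_middle_informative => // _.
rewrite Rplus_assoc; congr (_ + (_ + _)). apply: sumR_ext => y Hy. case: excluded_middle_informative => // E; by subst.
Qed.

(** The coefficients are left existential: [nikolskii] is applied to a high power whose coefficients
    never have to be known. *)
Definition is_mpoly n d (F : (nat -> C) -> C) : Prop := exists c, forall z, F z = mpoly n (deg_list n d) c z.

Lemma is_mpoly_mono n d t l : length l = n -> (list_sum l <= d)%nat -> is_mpoly n d (fun z => Cmult t (mono n z (ext l))).
Proof.
move=> H1 H2. exists (fun l' => Cmult t (RtoC (indic (l = l')))) => z.
have Hl : In l (deg_list n d) by apply/in_deg_list.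
rewrite -(sumC_indic_eq _ (fun l => Cmult t (mono n z (ext l))) l (NoDup_deg_list n d) Hl).
apply: sumC_ext => l' _; ring.
Qed.
Lemma is_mpoly_sum {A} n d (L : list A) F : (forall x, In x L -> is_mpoly n d (F x)) -> is_mpoly n d (fun z => sumC L (fun x => F x z)).
Proof.
elim: L => [|x L IH] H.
  exists (fun _ => RtoC 0) => z. rewrite /mpoly [RHS]sumC_0 // => l _; ring.
have [c1 Hc1] := H x (or_introl eq_refl). have [c2 Hc2] := IH (fun y Hy => H y (or_intror Hy)).
exists (fun l => Cplus (c1 l) (c2 l)) => z. rewrite sumC_cons Hc1 Hc2 /mpoly -sumC_plus; apply: sumC_ext => l _; ring.
Qed.
Lemma is_mpoly_mult n d1 d2 F G : is_mpoly n d1 F -> is_mpoly n d2 G -> is_mpoly n (d1 + d2) (fun z => Cmult (F z) (G z)).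
Proof.
move=> [c1 H1] [c2 H2].
have [c Hc] : is_mpoly n (d1 + d2) (fun z => sumC (deg_list n d1) (fun l1 => sumC (deg_list n d2) (fun l2 =>
   Cmult (Cmult (c1 l1) (mono n z (ext l1))) (Cmult (c2 l2) (mono n z (ext l2)))))).
  apply: is_mpoly_sum => l1 /in_deg_list [Hl1 Hl1']. apply: is_mpoly_sum => l2 /in_deg_list [Hl2 Hl2'].
  pose l := map (fun i => (ext l1 i + ext l2 i)%nat) (seq 0 n).
  have Hl : length l = n by rewrite length_map length_seq.
  have Hls : list_sum l = (list_sum l1 + list_sum l2)%nat.
    rewrite -(psum_ext l1) -(psum_ext l2) Hl1 Hl2 /l /psum. elim: (seq 0 n) => [|i L IH] //.
    change ((ext l1 i + ext l2 i + list_sum (map (fun i => (ext l1 i + ext l2 i)%nat) L))%nat =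
      ((ext l1 i + list_sum (map (ext l1) L)) + (ext l2 i + list_sum (map (ext l2) L)))%nat). lia.
  have [c Hc] := is_mpoly_mono n (d1 + d2) (Cmult (c1 l1) (c2 l2)) l Hl ltac:(lia).
  exists c => z. rewrite -Hc. have -> : mono n z (ext l) = Cmult (mono n z (ext l1)) (mono n z (ext l2)); last ring.
  rewrite -mono_add. apply: mono_ext => // i Hi. rewrite {1}/ext /l (nth_indep _ _ ((fun i => (ext l1 i + ext l2 i)%nat) 0%nat)); last by rewrite length_map length_seq.
  by rewrite map_nth seq_nth.
exists c => z. rewrite H1 H2 /mpoly sumC_mult. exact: Hc.
Qed.
Lemma is_mpoly_pow n d F k : is_mpoly n d F -> is_mpoly n (k * d) (fun z => Cpow (F z) k).
Proof.
move=> H. elim: k => [|k IH]; last exact: is_mpoly_mult.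
have := is_mpoly_mono n (0 * d) (RtoC 1) (repeat 0%nat n) (repeat_length _ _).
have := zero_in_deg_list n 0. move/in_deg_list => [_ H0] /(_ H0) [c Hc]. exists c => z. rewrite -Hc.
rewrite [Cpow _ _]/= Cmult_1_l. rewrite /mono. rewrite [RHS]prodC_1 // => i _. by rewrite /ext nth_repeat.
Qed.

(** * From exponential moments to high powers *)

Lemma pow_le_exp y k : 0 <= y -> (0 < k)%nat -> y ^ k <= INR k ^ k * exp y.
Proof.
move=> Hy Hk. have Hk0 : 0 < INR k by apply: lt_0_INR.
have -> : exp y = exp (y / INR k) ^ k by rewrite exp_pow; congr exp; field; lra.
rewrite -Rpow_mult_distr. apply: pow_incr; split=> //.
have := one_plus_le_exp (y / INR k). have -> : y = INR k * (y / INR k) by field; lra.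
have -> : INR k * (y / INR k) / INR k = y / INR k by field; lra. nra.
Qed.
Lemma pow_le_inv a b k : 0 <= a -> 0 <= b -> (0 < k)%nat -> a ^ k <= b ^ k -> a <= b.
Proof.
move=> Ha Hb Hk H. apply: Rnot_lt_le => Hlt. case: k Hk H => [|k] Hk /=; first lia.
have H1 : b ^ k <= a ^ k by apply: pow_incr; lra. have H2 : 0 < a ^ k by apply: pow_lt; lra.
nra.
Qed.
Lemma even_pow_le_cosh y k : (0 < k)%nat -> (y ^ 2) ^ k <= INR (2 * k) ^ (2 * k) * (2 * cosh y).
Proof.
move=> Hk. rewrite -pow_mult. have -> : y ^ (2 * k) = Rabs y ^ (2 * k).
  rewrite !pow_mult. congr pow. rewrite RPow_abs Rabs_pos_eq //; exact: pow2_ge_0.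
apply: Rle_trans (pow_le_exp (Rabs y) (2 * k) (Rabs_pos y) ltac:(lia)) _.
apply: Rmult_le_compat_l; first by apply: pow_le; exact: pos_INR.
rewrite /cosh. have := exp_pos y. have := exp_pos (- y). rewrite /Rabs. case: Rcase_abs => _; lra.
Qed.
(** After the [k]-th root the loss is of order [k ^ 2]. Applied with [k = n] to a polynomial scaled
    by [t], with [t ^ 2] proportional to [n], this leaves a single factor [n]. *)
Lemma Cmod_pow_le_cosh (z : C) k : (0 < k)%nat ->
  (Cmod z ^ 2) ^ k <= (2 * INR (2 * k) ^ 2) ^ k * (2 * (cosh (Re z) + cosh (Im z))).
Proof.
move=> Hk. rewrite Cmod2_alt.
have H1 := even_pow_le_cosh (Re z) k Hk. have H2 := even_pow_le_cosh (Im z) k Hk.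
have H : (Re z ^ 2 + Im z ^ 2) ^ k <= 2 ^ k * ((Re z ^ 2) ^ k + (Im z ^ 2) ^ k).
  have Hgen a b : 0 <= a -> a <= b -> (a + b) ^ k <= 2 ^ k * (a ^ k + b ^ k).
    move=> Ha Hab. apply: (Rle_trans _ ((2 * b) ^ k)); first by apply: pow_incr; lra.
    rewrite Rpow_mult_distr. apply: Rmult_le_compat_l; first by apply: pow_le; lra.
    have : 0 <= a ^ k by apply: pow_le. lra.
  have Ha := pow2_ge_0 (Re z). have Hb := pow2_ge_0 (Im z).
  case: (Rle_lt_dec (Re z ^ 2) (Im z ^ 2)) => Hab; first exact: Hgen.
  rewrite Rplus_comm (Rplus_comm ((Re z ^ 2) ^ k)). apply: Hgen; lra.
apply: Rle_trans H _. rewrite Rpow_mult_distr -(pow_mult (INR (2 * k))) Rmult_assoc.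
apply: Rmult_le_compat_l; first by apply: pow_le; lra. lra.
Qed.

(* Kahane-Salem-Zygmund with constants exponential in the degree.  The supremum is
   reduced to an average by applying [nikolskii] to the [n]-th power of the polynomial. *)
Lemma small_tetra_polynomial n m (B : (nat -> C) -> Prop) S2 : (1 <= m)%nat -> (1 <= n)%nat -> 0 < S2 ->
  (forall z, B z -> forall i, (i < n)%nat -> Cmod (z i) <= 1) ->
  (exists x0, B x0 /\ forall i, (i < n)%nat -> x0 i <> RtoC 0) ->
  (forall z w, B z -> (forall i, (i < n)%nat -> Cmod (w i) = 1) -> B (fun i => Cmult (z i) (w i))) ->
  (forall z, B z -> sumR (seq 0 n) (fun i => Cmod (z i) ^ 2) <= S2) ->
  exists eps : list nat -> R, (forall l, eps l = 1 \/ eps l = -1) /\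
   forall z, B z -> Cmod (mpoly n (deg_list n m) (fun l => RtoC (eps l * indic (tetra l /\ list_sum l = m))) z) ^ 2 <=
     192 * exp 2 * (2 * exp 1) ^ m * INR n * (exp 1 * S2 / INR m) ^ m.
Proof.
move=> Hm Hn HS2 HB1 HB0 HBr HBS.
have Hm0 : 0 < INR m by apply: lt_0_INR. have Hn0 : 0 < INR n by apply: lt_0_INR.
set sg := (exp 1 * S2 / INR m) ^ m.
have Hsg : 0 < sg.
  apply: pow_lt. apply: Rdiv_lt_0_compat => //. apply: Rmult_lt_0_compat => //. exact: exp_pos.
(* A degree bound for the [n]-th power. Polynomials of degree at most [M] form a space of dimension
   at most [(2 * exp 1) ^ (m * n)], and the [n]-th root at the end leaves [(2 * exp 1) ^ m]. *)
pose M := (n * m)%nat.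
have [mu [Hmu1 [Hmu2 Hmu3]]] := nikolskii n M (S M) (deg_list n M) B ltac:(lia) (NoDup_deg_list n M) (incl_deg_list n M) HB1 HB0.
(* [elem_sym_bound] bounds the squares of the unscaled terms by [sg], so the scaled ones sum to at
   most [n]; the exponential moment is then exponential in [n], which the [n]-th root turns into a
   constant. *)
pose t := sqrt (INR n / sg).
have Ht0 : 0 < t by apply/sqrt_lt_R0/Rdiv_lt_0_compat.
have Ht2 : t ^ 2 = INR n / sg by apply: pow2_sqrt; apply/Rlt_le/Rdiv_lt_0_compat.
(* Sample points: the rotated points of the design, with a flag for real or imaginary part, since
   the choice of signs controls real forms only. *)
pose O := list_prod mu (list_prod (mindices n M) [true; false]).
pose pt (w : (R * (nat -> C)) * (list nat * bool)) i := Cmult (snd (fst w) i) (tor (S M) (fst (snd w)) i).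
pose q (w : (R * (nat -> C)) * (list nat * bool)) := fst (fst w) * / INR (S M) ^ n.
pose part (w : (R * (nat -> C)) * (list nat * bool)) (z : C) := if snd (snd w) then Re z else Im z.
pose P l := indic (tetra l /\ list_sum l = m).
pose a w l := t * part w (Cmult (RtoC (P l)) (mono n (pt w) (ext l))).
have HO F : sumR O F = sumR mu (fun p => sumR (mindices n M) (fun g => F (p, (g, true)) + F (p, (g, false)))).
  rewrite /O. elim: mu {Hmu1 Hmu2 Hmu3 O} => [|p mu IH] //. rewrite [list_prod _ _]/= sumR_app sumR_cons IH; congr Rplus.
  rewrite sumR_map. elim: (mindices n M) => [|g G IHG] //. rewrite [list_prod _ _]/= !sumR_cons IHG; ring.
have HOin w : In w O -> In (fst w) mu.
  case: w => p gb. by rewrite /O in_prod_iff => -[].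
have Hq w : In w O -> 0 <= q w.
  move=> /HOin Hw. apply: Rmult_le_pos; [by case: (Hmu1 _ Hw)|exact: INR_pow_inv_ge0].
have [eps [Heps1 Heps2]] := derandomized_signs O q a (deg_list n m) (fun _ => 0) Hq (NoDup_deg_list n m).
exists eps; split=> // z Hz.
pose f z := mpoly n (deg_list n m) (fun l => RtoC (eps l * P l)) z.
change (Cmod (f z) ^ 2 <= 192 * exp 2 * (2 * exp 1) ^ m * INR n * sg).
have Hpart w : sumR (deg_list n m) (fun l => eps l * a w l) = t * part w (f (pt w)).
  rewrite /f /mpoly /a. elim: (deg_list n m) => [|l L IH].
  - rewrite /sumR /sumC /= /part. case: (snd (snd w)); rewrite /Re /Im /=; ring.
  - rewrite sumR_cons sumC_cons IH /part. case: (snd (snd w)); rewrite /Re /Im /=; ring.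
have Hqsum : sumR O q = 2.
  rewrite HO /q.
  rewrite (sumR_ext _ _ (fun p => fst p * avgR n (S M) (fun _ => 2))).
    rewrite (sumR_ext _ _ (fun p => fst p * 2)); last by move=> p _; rewrite avgR_const //; lia.
    rewrite sumR_scal_r Hmu2; ring.
  move=> p _. rewrite /avgR. have -> : (S M - 1)%nat = M by lia. rewrite -Rmult_assoc -sumR_scal; apply: sumR_ext => g _. cbn [fst]; ring.
have Hup : sumR O (fun w => q w * cosh (t * part w (f (pt w)))) <= 2 * exp (2 * INR n).
  rewrite (sumR_ext _ _ (fun w => q w * cosh (0 + sumR (deg_list n m) (fun l => eps l * a w l)))); last first.
    by move=> w _; rewrite Hpart Rplus_0_l.
  apply: Rle_trans Heps2 _. rewrite -[X in _ <= X * exp _]Hqsum Rmult_comm -sumR_scal. apply: sumR_le => w Hw.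
  rewrite Rmult_comm. apply: Rmult_le_compat_r; first exact: Hq. rewrite cosh_0 Rmult_1_l.
  have HBpt : B (pt w).
    apply: HBr; first by case: (Hmu1 _ (HOin w Hw)). move=> i _; exact: Cmod_tor.
  have H : 2 * sumR (deg_list n m) (fun l => a w l ^ 2) <= 2 * INR n.
    apply: Rmult_le_compat_l; first lra.
    apply: (Rle_trans _ (t ^ 2 * sg)); last by rewrite Ht2; right; field; lra.
    apply: Rle_trans (Rmult_le_compat_l _ _ _ (pow2_ge_0 t) (elem_sym_bound n m (fun i => Cmod (pt w i) ^ 2) S2 Hm HS2 (fun i _ => pow2_ge_0 _) (HBS _ HBpt))).
    rewrite -sumR_scal; apply: sumR_le => l _. rewrite /a Rpow_mult_distr. apply: Rmult_le_compat_l; first exact: pow2_ge_0.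
    apply: (Rle_trans _ (Cmod (Cmult (RtoC (P l)) (mono n (pt w) (ext l))) ^ 2)).
      rewrite Cmod2_alt /part. case: (snd (snd w)); set u := Re _; set v := Im _; have := pow2_ge_0 u; have := pow2_ge_0 v; lra.
    rewrite Cmod_mult Cmod_R Rabs_pos_eq; last exact: indic_ge0.
    rewrite Rpow_mult_distr Cmod_mono.
    have -> : prodR (seq 0 n) (fun i => Cmod (pt w i) ^ ext l i) ^ 2 = prodR (seq 0 n) (fun i => (Cmod (pt w i) ^ 2) ^ nth i l 0%nat).
      rewrite /= Rmult_1_r -prodR_mult. apply: prodR_ext => i _. rewrite Rmult_1_r Rpow_mult_distr //.
    apply: Rmult_le_compat_r; first by apply: prodR_ge0 => i _; apply: pow_le; exact: pow2_ge_0.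
    rewrite /P. have := indic_01 (tetra l /\ list_sum l = m). nra.
  exact: exp_le_compat.
have [c Hc] : is_mpoly n M (fun z => Cpow (f z) n).
  apply: is_mpoly_pow. by exists (fun l => RtoC (eps l * P l)).
have Hmain := Hmu3 c z Hz. rewrite -Hc Cmod_pow in Hmain.
have Hpow2 (x : R) : (x ^ n) ^ 2 = (x ^ 2) ^ n by rewrite -!pow_mult Nat.mul_comm.
rewrite Hpow2 in Hmain.
set A := 2 * INR (2 * n) ^ 2 / t ^ 2.
have HA : A = 8 * INR n * sg.
  rewrite /A Ht2 mult_INR. have -> : INR 2 = 2 by []. field; lra.
have HA0 : 0 < A by rewrite HA; do 2 (apply: Rmult_lt_0_compat => //); lra.
have Hmom : sumR mu (fun p => fst p * avgR n (S M) (fun w => Cmod (mpoly n (deg_list n M) c (fun i => Cmult (snd p i) (w i))) ^ 2)) <=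
   A ^ n * (2 * (2 * exp (2 * INR n))).
  apply: (Rle_trans _ (A ^ n * (2 * sumR O (fun w => q w * cosh (t * part w (f (pt w))))))); last first.
    apply: Rmult_le_compat_l; first by apply: pow_le; lra. lra.
  rewrite HO -!sumR_scal. apply: sumR_le => p Hp. case: (Hmu1 p Hp) => Hp0 _.
  rewrite /avgR. have -> : (S M - 1)%nat = M by lia. rewrite -!sumR_scal. apply: sumR_le => g _.
  rewrite -Hc Cmod_pow Hpow2 /q /part. cbn [fst snd].
  change (pt (p, (g, false))) with (pt (p, (g, true))).
  change (fun i => Cmult (snd p i) (tor (S M) g i)) with (pt (p, (g, true))).
  set u := f _.
  have H := Cmod_pow_le_cosh (Cmult (RtoC t) u) n Hn.
  have Er : Re (Cmult (RtoC t) u) = t * Re u by rewrite /Re /=; ring.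
  have Ei : Im (Cmult (RtoC t) u) = t * Im u by rewrite /Im /=; ring.
  rewrite Er Ei Cmod_mult Cmod_R (Rabs_pos_eq t) in H; last lra.
  have HAn : A ^ n = (2 * INR (2 * n) ^ 2) ^ n * (/ t ^ 2) ^ n by rewrite -Rpow_mult_distr.
  have Hu : (Cmod u ^ 2) ^ n = ((t * Cmod u) ^ 2) ^ n * (/ t ^ 2) ^ n.
    rewrite -Rpow_mult_distr; congr pow; field; lra.
  have Htn : 0 <= (/ t ^ 2) ^ n by apply/pow_le/Rlt_le/Rinv_0_lt_compat/pow_lt.
  have Hqq : 0 <= fst p * / INR (S M) ^ n by apply: Rmult_le_pos => //; exact: INR_pow_inv_ge0.
  have H2 : (Cmod u ^ 2) ^ n <= A ^ n * (2 * (cosh (t * Re u) + cosh (t * Im u))).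
    rewrite Hu HAn. have := Rmult_le_compat_r _ _ _ Htn H. lra.
  have := Rmult_le_compat_l _ _ _ Hqq H2. lra.
have Hlen := length_deg_list n M ltac:(rewrite /M; nia).
have HM1 : (1 + INR n / INR M) ^ M <= (2 ^ m) ^ n.
  rewrite -pow_mult Nat.mul_comm -/M. apply: pow_incr. rewrite /M mult_INR.
  have -> : INR n / (INR n * INR m) = / INR m by field; lra.
  have H1 : 0 < / INR m by apply: Rinv_0_lt_compat.
  have H2 : / INR m <= / 1 by apply: Rinv_le_contravar; [lra|apply: (le_INR 1)].
  rewrite Rinv_1 in H2; lra.
have HeM : exp (INR M) = (exp 1 ^ m) ^ n by rewrite -pow_mult Nat.mul_comm -/M exp_pow; congr exp; ring.
have H24 : 24 <= 24 ^ n by rewrite -{1}(pow_1 24); apply: Rle_pow; [lra|].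
have He2 : exp (2 * INR n) = exp 2 ^ n by rewrite exp_pow; congr exp; ring.
have Hfin : (Cmod (f z) ^ 2) ^ n <= (192 * exp 2 * (2 * exp 1) ^ m * INR n * sg) ^ n.
  (* [24 = 6 * 4] is the constant of [nikolskii] times the factor 4 in [Hmom]; [A] brings the
     remaining 8. *)
  have -> : 192 * exp 2 * (2 * exp 1) ^ m * INR n * sg = 24 * (exp 1 ^ m * 2 ^ m) * (A * exp 2).
    rewrite HA Rpow_mult_distr; ring.
  rewrite (Rpow_mult_distr (24 * _)) (Rpow_mult_distr 24) (Rpow_mult_distr (exp 1 ^ m)) (Rpow_mult_distr A) -He2 -HeM.
  apply: Rle_trans Hmain _.
  have HX : 0 <= A ^ n * exp (2 * INR n) by apply: Rmult_le_pos; [apply: pow_le; lra|exact/Rlt_le/exp_pos].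
  have HE0 := exp_pos (INR M).
  have HL : INR (length (deg_list n M)) <= exp (INR M) * (2 ^ m) ^ n.
    apply: Rle_trans Hlen _. apply: Rmult_le_compat_l; lra.
  have HL0 := pos_INR (length (deg_list n M)).
  apply: (Rle_trans _ (6 * INR (length (deg_list n M)) * (A ^ n * (2 * (2 * exp (2 * INR n)))))).
    apply: Rmult_le_compat_l => //; lra.
  apply: (Rle_trans _ (24 * (exp (INR M) * (2 ^ m) ^ n) * (A ^ n * exp (2 * INR n)))).
    have := Rmult_le_compat_r _ _ _ HX HL. lra.
  apply: Rmult_le_compat_r => //. apply: Rmult_le_compat_r => //. apply: Rmult_le_pos; [lra|apply: pow_le; apply: pow_le; lra].
have Hrhs : 0 <= 192 * exp 2 * (2 * exp 1) ^ m * INR n * sg.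
  have := exp_pos 2. have : 0 < (2 * exp 1) ^ m by apply: pow_lt; have := exp_pos 1; lra.
  move=> H1 H2. do ?apply: Rmult_le_pos; lra.
apply: (pow_le_inv _ _ n) => //. exact: pow2_ge_0.
Qed.

(** * The estimates *)

Lemma chi_mon_le r s n m J K : 0 <= K ->
  (forall c eps, suppJ J c -> (forall a, Cmod (eps a) = 1) ->
     supnorm r s n m (fun a => Cmult (eps a) (c a)) <= K * supnorm r s n m c) ->
  Rbar_le (chi_mon r s n m J) (Finite K).
Proof. move=> H1 H2. by apply: (proj1 (Glb_Rbar_correct _) K). Qed.

Lemma chi_mon_ge r s n m J b :
  (forall K, 0 <= K -> (forall c eps, suppJ J c -> (forall a, Cmod (eps a) = 1) ->
     supnorm r s n m (fun a => Cmult (eps a) (c a)) <= K * supnorm r s n m c) -> b <= K) ->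
  Rbar_le (Finite b) (chi_mon r s n m J).
Proof. move=> H. apply: (proj2 (Glb_Rbar_correct _) (Finite b)) => K [H1 H2]. exact: H. Qed.

(* Dilating by a point [z] of the ball gives a polynomial on the polydisc. *)
Lemma chi_mon_upper r s n m J : Rbar_le (Finite 1) s -> deg_le J m -> (1 <= m)%nat ->
  Rbar_le (chi_mon r s n m J) (Finite (1 + 3 * 4 ^ m * sqrt (exp (INR m) * (1 + INR n / INR m) ^ (m - 1)))).
Proof.
move=> Hs HJ Hm. set K := 1 + _.
have HK : 0 <= K.
  have : 0 <= 3 * 4 ^ m * sqrt (exp (INR m) * (1 + INR n / INR m) ^ (m - 1)); last by rewrite /K; lra.
  apply: Rmult_le_pos; last exact: sqrt_pos. apply: Rmult_le_pos; [lra|apply: pow_le; lra].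
apply: chi_mon_le => // c eps Hc Heps.
have Hc' : suppJ J (fun a => Cmult (eps a) (c a)) by move=> a Ha; apply: Hc => E; apply: Ha; rewrite E; ring.
apply: supnorm_lub => // z Hz. rewrite (peval_deg J) //.
apply: Rle_trans (Cmod_sum _ _) _.
rewrite (sumR_ext _ _ (fun l => Cmod (Cmult (c (ext l)) (mono n z (ext l))))); last first.
  by move=> l _; rewrite !Cmod_mult Heps Rmult_1_l.
apply: (bohr_polydisc n m (fun l => Cmult (c (ext l)) (mono n z (ext l)))) => // u Hu.
rewrite -mpoly_scale -(peval_deg J) //. apply: supnorm_ub => //. exact: ball_scale.
Qed.

(** [rel_proj_const] sees only projections whose operator norm is a finite real. A given bound makes
    the infimum finite, and dividing by [norm y] shows that the infimum is itself a bound. *)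
Lemma opnorm_attained (Y : CompleteNormedModule C_AbsRing) (Q : Y -> Y) k : 0 <= k -> (forall y, norm (Q y) <= k * norm y) ->
  exists x, opnorm Y Q = Finite x /\ 0 <= x <= k /\ forall y, norm (Q y) <= x * norm y.
Proof.
move=> Hk HQ. have [H1 H2] := Glb_Rbar_correct (fun k => 0 <= k /\ forall y, norm (Q y) <= k * norm y).
rewrite /opnorm. have Hle := H1 k (conj Hk HQ).
have Hge : Rbar_le (Finite 0) (Glb_Rbar (fun k => 0 <= k /\ forall y, norm (Q y) <= k * norm y)) by apply: H2 => k' [].
case: (Glb_Rbar _) H1 H2 Hle Hge => [x||] //= H1 H2 Hle Hge. exists x; split=> //; split=> // y.
case: (Rle_lt_or_eq_dec _ _ (norm_ge_0 y)) => Hy; last first.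
  have := HQ y. rewrite -Hy !Rmult_0_r //.
suff : norm (Q y) / norm y <= x.
  move=> H. have := Rmult_le_compat_r _ _ _ (Rlt_le _ _ Hy) H. rewrite /Rdiv Rmult_assoc Rinv_l; lra.
apply: (H2 (Finite (norm (Q y) / norm y))) => k' [Hk' HQ'] /=.
apply: (Rmult_le_reg_r (norm y)) => //. rewrite /Rdiv Rmult_assoc Rinv_l; last lra. rewrite Rmult_1_r. exact: HQ'.
Qed.

(** [proj_const] ranges over finite relative constants; finiteness comes from the single bounded
    projection [Q0]. *)
Lemma rel_proj_const_between J (Y : CompleteNormedModule C_AbsRing) I b k Q0 :
  is_proj J Y I Q0 -> 0 <= k -> (forall y, norm (Q0 y) <= k * norm y) ->
  (forall Q k', is_proj J Y I Q -> 0 <= k' -> (forall y, norm (Q y) <= k' * norm y) -> b <= k') ->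
  exists x, rel_proj_const J Y I = Finite x /\ b <= x <= k.
Proof.
move=> HQ0 Hk Hk0 Hb. have [x0 [Ho [Hx0 _]]] := opnorm_attained Y Q0 k Hk Hk0.
have [H1 H2] := Glb_Rbar_correct (fun x => exists Q, is_proj J Y I Q /\ opnorm Y Q = Finite x).
rewrite /rel_proj_const. have Hle := H1 x0 (ex_intro _ Q0 (conj HQ0 Ho)).
have Hge : Rbar_le (Finite b) (Glb_Rbar (fun x => exists Q, is_proj J Y I Q /\ opnorm Y Q = Finite x)).
  apply: H2 => x [Q [HQ HQx]] /=.
  have [Hg1 Hg2] := Glb_Rbar_correct (fun k => 0 <= k /\ forall y, norm (Q y) <= k * norm y).
  have : Rbar_le (Finite b) (opnorm Y Q) by apply: Hg2 => k' [Hk1 Hk2]; apply: (Hb Q).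
  by rewrite HQx.
case: (Glb_Rbar _) Hle Hge => [x||] //= Hle Hge. exists x; split=> //. lra.
Qed.

Lemma proj_const_upper r s n m J : 2 <= r -> Rbar_le (Finite 1) s -> deg_le J m ->
  Rbar_le (proj_const r s n m J) (Finite (sqrt (6 * INR (length (deg_list n m))))).
Proof.
move=> Hr Hs HJ. apply: (proj2 (Lub_Rbar_correct _)) => x [Y [I [HI Hx]]].
have [Q [HQ HQk]] := bounded_projection r s n m J Y I Hr Hs HJ HI.
have [x' [Hx' Hx'']] := rel_proj_const_between J Y I 0 _ Q HQ (sqrt_pos _) HQk (fun _ _ _ H _ => H).
move: Hx. rewrite Hx' => -[<-] /=. lra.
Qed.

(** Evaluation into the bounded functions on the ball is one competitor in the supremum;
    [bounded_projection] makes its relative constant finite. *)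
Lemma proj_const_ge r s n m J b (Hs : Rbar_le (Finite 1) s) : 2 <= r -> deg_le J m ->
  (forall Q k, is_proj J (linf_ball r s n Hs) (eval_embed r s n m Hs) Q -> 0 <= k -> (forall y, norm (Q y) <= k * norm y) -> b <= k) ->
  Rbar_le (Finite b) (proj_const r s n m J).
Proof.
move=> Hr HJ Hb. have HI := eval_embed_iso r s n m J Hs.
have [Q [HQ HQk]] := bounded_projection r s n m J _ _ Hr Hs HJ HI.
have [x [Hx Hx']] := rel_proj_const_between J _ _ b _ Q HQ (sqrt_pos _) HQk Hb.
apply: (Rbar_le_trans _ (Finite x)); first by case: Hx'.
apply: (proj1 (Lub_Rbar_correct _)). by exists (linf_ball r s n Hs), (eval_embed r s n m Hs).
Qed.

Lemma Rbar_mult_ge a b v (x : Rbar) : 0 < a -> Rbar_le (Finite b) x -> v <= a * b -> Rbar_le (Finite v) (Rbar_mult (Finite a) x).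
Proof.
move=> Ha Hb Hv. case: x Hb => [x||] //= Hb; first nra.
case: Rle_dec => [H|H]; last lra. case: Rle_lt_or_eq_dec => // H'; lra.
Qed.

Lemma Rpower_half_sqrt x k : 0 < x -> Rpower x (INR k / 2) = sqrt (x ^ k).
Proof.
move=> Hx. rewrite -Rpower_sqrt; last exact: pow_lt. rewrite -(Rpower_pow k) // Rpower_mult; congr Rpower; field.
Qed.
Lemma sqrt_le_of_sq x w : 0 <= w -> x <= w ^ 2 -> sqrt x <= w.
Proof. move=> Hw H. rewrite -(sqrt_pow2 w) //. exact: sqrt_le_1_alt. Qed.
Lemma INR_pred_half m : (1 <= m)%nat -> (INR m - 1) / 2 = INR (m - 1) / 2.
Proof. move=> H. rewrite minus_INR //. Qed.

(** Nontriviality of the space makes both constants at least 1; together with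
    [small_dimension_bound] this settles the lower bounds for [n < m]. *)
Lemma monomial_supnorm_pos r s n m J : 2 <= r -> Rbar_le (Finite 1) s -> deg_le J m ->
  (exists a, J a /\ forall i, (n <= i)%nat -> a i = 0%nat) ->
  exists c, suppJ J c /\ 0 < supnorm r s n m c.
Proof.
move=> Hr Hs HJ [a [Ha Ha0]]. pose l := map a (seq 0 n).
have El : ext l = a.
  apply: functional_extensionality => i. rewrite /ext /l. case: (Nat.lt_ge_cases i n) => Hi.
  - rewrite (nth_indep _ _ (a 0%nat)); last by rewrite length_map length_seq. by rewrite map_nth seq_nth.
  - rewrite nth_overflow ?Ha0 //. by rewrite length_map length_seq.
have Hl : In l (mindices n m).
  apply/incl_deg_list/in_deg_list. split; first by rewrite length_map length_seq.
  rewrite -psum_ext El. exact: HJ.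
exists (fun a' => RtoC (indic (a' = a))); split.
  by move=> a' Ha'; have -> : a' = a by apply: NNPP => E; apply: Ha'; rewrite indic_F.
have [x0 [Hx0 Hx0']] := ball_interior r s n Hr Hs.
apply: Rlt_le_trans (coeff_le_supnorm r s n m Hs _ x0 l Hx0 Hl).
rewrite El indic_T // Cmod_1 Rmult_1_l Cmod_mono. apply: prodR_gt0 => i /in_seq Hi. apply/pow_lt/Cmod_gt_0/Hx0'. lia.
Qed.

Lemma chi_mon_ge1 r s n m J : 2 <= r -> Rbar_le (Finite 1) s -> deg_le J m ->
  (exists a, J a /\ forall i, (n <= i)%nat -> a i = 0%nat) -> Rbar_le (Finite 1) (chi_mon r s n m J).
Proof.
move=> Hr Hs HJ Ha. have [c [Hc Hc0]] := monomial_supnorm_pos r s n m J Hr Hs HJ Ha.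
apply: chi_mon_ge => K HK H. have := H c (fun _ => RtoC 1) Hc (fun _ => Cmod_1).
rewrite (supnorm_ext r s n m Hs _ c); last by move=> l _; ring. nra.
Qed.
Lemma proj_const_ge1 r s n m J : 2 <= r -> Rbar_le (Finite 1) s -> deg_le J m ->
  (exists a, J a /\ forall i, (n <= i)%nat -> a i = 0%nat) -> Rbar_le (Finite 1) (proj_const r s n m J).
Proof.
move=> Hr Hs HJ Ha. have [c [Hc Hc0]] := monomial_supnorm_pos r s n m J Hr Hs HJ Ha.
apply: (proj_const_ge r s n m J 1 Hs) => // Q k [_ [_ [_ HQ]]] Hk Hk'.
have := Hk' (eval_embed r s n m Hs c). rewrite HQ //.
have [_ [_ Hn]] := eval_embed_iso r s n m J Hs. rewrite Hn //. nra.
Qed.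

(** The test polynomial [c] has the signs of [small_tetra_polynomial]. Multiplying by the same signs
    again gives the polynomial [P] with coefficients 1, whose value at the constant vector [rho] is
    [tetra_count n m * rho ^ m]. Hence this number is at most the norm of [P], and so at most
    [K * sqrt W]. *)
Lemma tetra_count_le_chi r s n m J K S2 rho : 2 <= r -> Rbar_le (Finite 1) s -> deg_le J m ->
  (1 <= m)%nat -> (1 <= n)%nat -> (forall a, LambdaT m a -> J a) -> 0 < S2 -> 0 < rho ->
  (forall z, lorentz r s n z < 1 -> sumR (seq 0 n) (fun i => Cmod (z i) ^ 2) <= S2) ->
  lorentz r s n (fun _ => RtoC rho) < 1 -> 0 <= K ->
  (forall c eps, suppJ J c -> (forall a, Cmod (eps a) = 1) ->
     supnorm r s n m (fun a => Cmult (eps a) (c a)) <= K * supnorm r s n m c) ->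
  (tetra_count n m * rho ^ m) ^ 2 <= K ^ 2 * (192 * exp 2 * (2 * exp 1) ^ m * INR n * (exp 1 * S2 / INR m) ^ m).
Proof.
move=> Hr Hs HJ Hm Hn HT HS2 Hrho HS Hrho1 HK HKc. set W := 192 * _ * _ * _ * _.
have [eps [He1 He2]] := small_tetra_polynomial n m (fun z => lorentz r s n z < 1) S2 Hm Hn HS2
  (fun z Hz i => ball_le1 r s n Hs z i Hz) (ball_interior r s n Hr Hs)
  (fun z w Hz Hw => ball_scale r s n Hs z w Hz (fun i Hi => Req_le _ _ (Hw i Hi))) HS.
rewrite -/W in He2.
pose res (a : multi_index) := map a (seq 0 n).
pose P (a : multi_index) : C := RtoC (indic (LambdaT m a)).
pose c a := Cmult (RtoC (eps (res a))) (P a).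
have HPJ : suppJ J P by move=> a Ha; apply: HT; apply: NNPP => H; apply: Ha; rewrite /P indic_F.
have Hc : suppJ J c by exact: (fun a Ha => HPJ a (fun E => Ha (eq_trans (f_equal (Cmult _) E) (Cmult_0_r _)))).
have Hres l : In l (deg_list n m) -> res (ext l) = l.
  move=> /in_deg_list [Hl _]. rewrite /res. apply: (nth_ext _ _ (ext l 0%nat) 0%nat); first by rewrite length_map length_seq.
  move=> i. rewrite length_map length_seq => Hi. by rewrite map_nth seq_nth.
have HPl l : In l (deg_list n m) -> P (ext l) = RtoC (indic (tetra l /\ list_sum l = m)).
  move=> /in_deg_list [Hl _]. congr RtoC; apply: indic_ext; split; last by move=> [H1 H2]; apply: (tetra_LambdaT n).
  move=> [H1 [N [H2 H3]]]. split=> //. rewrite -psum_ext Hl -H3.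
  have Hn0 i : (n <= i)%nat -> ext l i = 0%nat by move=> Hi; rewrite /ext nth_overflow // Hl.
  by rewrite -(psum_tail (ext l) n N Hn0) -(psum_tail (ext l) N n H2) Nat.add_comm.
have HW0 : 0 <= W.
  have H1 := exp_pos 2. have H2 := exp_pos 1. have Hm0 : 0 < INR m by apply: lt_0_INR.
  have H3 : 0 < exp 1 * S2 / INR m by apply: Rdiv_lt_0_compat => //; apply: Rmult_lt_0_compat.
  rewrite /W. do 4 (apply: Rmult_le_pos; [|try apply: pow_le; try lra; try exact: pos_INR]); lra.
have Hsc : supnorm r s n m c <= sqrt W.
  apply: supnorm_lub => // z Hz. rewrite (peval_deg J) // -(sqrt_pow2 (Cmod _)); last exact: Cmod_ge_0.
  apply: sqrt_le_1_alt. apply: Rle_trans (He2 z Hz). right; congr (_ ^ 2); congr Cmod. apply: sumC_ext => l Hl.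
  by rewrite /c Hres // HPl // RtoC_mult.
have HsP : supnorm r s n m (fun a => Cmult (RtoC (eps (res a))) (c a)) = supnorm r s n m P.
  apply: supnorm_ext => // l _. rewrite /c Cmult_assoc -RtoC_mult. case: (He1 (res (ext l))) => ->.
  - rewrite Rmult_1_l; ring.
  - have -> : -1 * -1 = 1 by ring. ring.
have H1 := HKc c (fun a => RtoC (eps (res a))) Hc
  ltac:(move=> a; rewrite Cmod_R; case: (He1 (res a)) => ->; [exact: Rabs_R1|by rewrite Rabs_Ropp Rabs_R1]).
rewrite HsP in H1.
have H2 : tetra_count n m * rho ^ m <= supnorm r s n m P.
  apply: Rle_trans (supnorm_ub r s n m Hs P _ Hrho1). rewrite (peval_deg J) //.
  have -> : mpoly n (deg_list n m) (fun l => P (ext l)) (fun _ => RtoC rho) = RtoC (tetra_count n m * rho ^ m).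
    rewrite /tetra_count -sumR_scal_r RtoC_sum. apply: sumC_ext => l Hl. rewrite HPl // RtoC_mult.
    case: (classic (tetra l /\ list_sum l = m)) => H; last by rewrite indic_F //; ring.
    congr Cmult. have /in_deg_list [Hl1 _] := Hl. rewrite RtoC_pow -(proj2 H) -list_sum_pow Hl1 //.
  rewrite Cmod_R; exact: Rle_abs.
have H3 : 0 <= tetra_count n m * rho ^ m.
  apply: Rmult_le_pos; [|apply: pow_le; lra]. apply: sumR_ge0 => l _; exact: indic_ge0.
have H4 : tetra_count n m * rho ^ m <= K * sqrt W.
  apply: Rle_trans H2 _. apply: Rle_trans H1 _. exact: Rmult_le_compat_l.
apply: (Rle_trans _ ((K * sqrt W) ^ 2)); first by apply: pow_incr.
rewrite Rpow_mult_distr pow2_sqrt //; lra.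
Qed.

(** * Explicit constants and assembly *)

Lemma one_le_mult a b : 1 <= a -> 1 <= b -> 1 <= a * b.
Proof. nra. Qed.

(** In [16 ^ m = 4 ^ m * 4 ^ m] one factor is that of [bohr_polydisc], the other absorbs
    [1 + 3 = 4]; [exp 1 ^ m] covers the square root of [exp m]. For the projection constant
    [6 <= 16] is more than enough. *)
Lemma upper_bounds r s : 2 <= r -> Rbar_le (Finite 1) s -> forall J n m, deg_le J m -> (1 <= m)%nat ->
  Rbar_le (chi_mon r s n m J) (Finite ((16 * exp 1) ^ m * Rpower (1 + INR n / INR m) ((INR m - 1) / 2))) /\
  Rbar_le (proj_const r s n m J) (Finite ((16 * exp 1) ^ m * Rpower (1 + INR n / INR m) (INR m / 2))).
Proof.
move=> Hr Hs J n m HJ Hm. have Hm0 : 0 < INR m by apply: lt_0_INR.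
set x := 1 + INR n / INR m.
have Hx : 1 <= x.
  have : 0 <= INR n / INR m by apply: Rmult_le_pos; [exact: pos_INR|apply/Rlt_le/Rinv_0_lt_compat]. rewrite /x; lra.
have He : exp (INR m) = exp 1 ^ m by rewrite exp_pow Rmult_1_r.
have He1 : 1 <= exp 1 by have := one_plus_le_exp 1; lra.
have Hem : 1 <= exp 1 ^ m by apply: pow_R1_Rle.
have Hse : sqrt (exp (INR m)) <= exp 1 ^ m by rewrite He; apply: sqrt_le_of_sq; nra.
have H4m : 1 <= 4 ^ m by apply: pow_R1_Rle; lra.
have H4m' : 4 <= 4 ^ m by rewrite -{1}(pow_1 4); apply: Rle_pow; [lra|].
have H16 : 16 ^ m = 4 ^ m * 4 ^ m by rewrite -Rpow_mult_distr; congr pow; ring.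
rewrite Rpow_mult_distr H16. split.
- apply: Rbar_le_trans (chi_mon_upper r s n m J Hs HJ Hm) _ => /=. rewrite -/x.
  rewrite INR_pred_half // Rpower_half_sqrt; last lra.
  have HP : 1 <= x ^ (m - 1) by apply: pow_R1_Rle.
  have HsP : 1 <= sqrt (x ^ (m - 1)) by rewrite -sqrt_1; apply: sqrt_le_1_alt.
  rewrite sqrt_mult; [|exact/Rlt_le/exp_pos|lra].
  set p := sqrt (x ^ (m - 1)) in HsP *. set e := sqrt (exp (INR m)) in Hse *.
  have He0 : 0 <= e by exact: sqrt_pos.
  have H1 : 3 * 4 ^ m * (e * p) <= 3 * 4 ^ m * (exp 1 ^ m * p).
    apply: Rmult_le_compat_l; [lra|]. apply: Rmult_le_compat_r; lra.
  have Hep : 1 <= exp 1 ^ m * p by apply: one_le_mult; lra.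
  have H2 : 1 <= 4 ^ m * (exp 1 ^ m * p) by apply: one_le_mult; lra.
  have H3 : 4 * (4 ^ m * (exp 1 ^ m * p)) <= 4 ^ m * (4 ^ m * (exp 1 ^ m * p)) by apply: Rmult_le_compat_r; lra.
  lra.
- apply: Rbar_le_trans (proj_const_upper r s n m J Hr Hs HJ) _ => /=.
  rewrite Rpower_half_sqrt; last lra.
  have HP : 1 <= x ^ m by apply: pow_R1_Rle.
  have Hlen := length_deg_list n m Hm. rewrite -/x He in Hlen.
  apply: sqrt_le_of_sq; first by apply: Rmult_le_pos; [|exact: sqrt_pos]; apply: Rmult_le_pos; nra.
  rewrite Rpow_mult_distr pow2_sqrt; last lra.
  apply: (Rle_trans _ (6 * (exp 1 ^ m * x ^ m))); first lra.
  rewrite -Rmult_assoc. apply: Rmult_le_compat_r; first lra.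
  have H1 : 16 <= 4 ^ m * 4 ^ m by nra. have H2 : 16 * exp 1 ^ m <= 4 ^ m * 4 ^ m * exp 1 ^ m by apply: Rmult_le_compat_r; lra.
  nra.
Qed.

(** For [n < m] the base is at most 2, so the claimed lower bound is absorbed by [C' ^ m]. *)
Lemma small_dimension_bound n m k C' : (n < m)%nat -> (k <= m)%nat -> 2 <= C' ->
  Rpower (1 + INR n / INR m) (INR k / 2) <= C' ^ m.
Proof.
move=> Hnm Hk HC. have Hm0 : 0 < INR m by apply: lt_0_INR; lia.
have H0 : 0 <= INR n / INR m by apply: Rmult_le_pos; [exact: pos_INR|apply/Rlt_le/Rinv_0_lt_compat].
have H1 : INR n / INR m <= 1.
  apply: (Rmult_le_reg_r (INR m)) => //. rewrite /Rdiv Rmult_assoc Rinv_l; last lra.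
  have : INR n <= INR m by apply: le_INR; lia. lra.
rewrite Rpower_half_sqrt; last lra.
have HC1 : 1 <= C' ^ m by apply: pow_R1_Rle; lra.
apply: sqrt_le_of_sq; first lra.
apply: (Rle_trans _ (C' ^ m)); last nra.
apply: (Rle_trans _ (C' ^ k)); first by apply: pow_incr; lra. apply: Rle_pow => //; lra.
Qed.

Lemma lower_bounds r s : 2 <= r -> Rbar_le (Finite 1) s -> (2 < r \/ (r = 2 /\ Rbar_le s (Finite 2))) ->
  exists C', 0 < C' /\ forall J n m, deg_le J m -> (1 <= m)%nat -> (forall a, LambdaT m a -> J a) ->
   (exists a, J a /\ forall i, (n <= i)%nat -> a i = 0%nat) ->
   Rbar_le (Finite (Rpower (1 + INR n / INR m) ((INR m - 1) / 2))) (Rbar_mult (Finite (C' ^ m)) (chi_mon r s n m J)) /\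
   Rbar_le (Finite (Rpower (1 + INR n / INR m) (INR m / 2))) (Rbar_mult (Finite (C' ^ m)) (proj_const r s n m J)).
Proof.
move=> Hr Hs Hcase.
have [A [HA HAs]] := sum_sq_bound r s Hr Hs Hcase.
have [A1 [HA1 HA1s]] := lorentz_const r s Hr Hs.
(* The value for which [rho ^ 2 / S2] is [/ (D * n)]; the 4 is the square of the 2 in [rho], which
   places the constant vector strictly inside the ball. *)
pose D := 4 * A * A1 ^ 2.
have HD : 0 < D by rewrite /D; have := pow_lt A1 2 HA1; nra.
have He2 := exp_pos 2. have He1 := exp_pos 1. have He4 := exp_pos 4.
have HX : 0 < exp 4 * D by apply: Rmult_lt_0_compat.
have He22 : exp 2 * exp 2 = exp 4 by rewrite -exp_plus; congr exp; ring.
(* The 2 handles [n < m]. For [m <= n], [1536 = 2 * 192 * 2 * 2] collects [1 + y <= 2 * y], the 192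
   of [small_tetra_polynomial], [m <= 2 ^ m], and the 2 of its [2 * exp 1]; [exp 4] is the product
   of the two [exp 2] that occur. *)
pose C' := 2 + 1536 * (exp 4 * D).
have HC2 : 2 <= C' by rewrite /C'; lra.
exists C'; split; first lra. move=> J n m HJ Hm HT Hex.
have HCm : 0 < C' ^ m by apply: pow_lt; lra.
case: (Nat.lt_ge_cases n m) => Hnm.
- split.
  + apply: (Rbar_mult_ge _ 1) => //; first exact: chi_mon_ge1. rewrite Rmult_1_r INR_pred_half //.
    apply: small_dimension_bound => //; lia.
  + apply: (Rbar_mult_ge _ 1) => //; first exact: proj_const_ge1. rewrite Rmult_1_r.
    exact: small_dimension_bound.
have Hn : (1 <= n)%nat by lia.
have Hm0 : 0 < INR m by apply: lt_0_INR. have Hn0 : 0 < INR n by apply: lt_0_INR.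
set S2 := A * Rpower (INR n) (1 - 2 / r).
have HS2 : 0 < S2 by apply: Rmult_lt_0_compat => //; exact: Rpower_pos.
have HP := Rpower_pos (INR n) (/ r).
set rho := / (2 * A1 * Rpower (INR n) (/ r)).
have Hrho : 0 < rho by apply: Rinv_0_lt_compat; nra.
have Hrho1 : lorentz r s n (fun _ => RtoC rho) < 1.
  apply: Rle_lt_trans (HA1s n rho Hn Hrho) _. have -> : A1 * rho * Rpower (INR n) (/ r) = / 2 by rewrite /rho; field; lra. lra.
have HSz z : lorentz r s n z < 1 -> sumR (seq 0 n) (fun i => Cmod (z i) ^ 2) <= S2 by exact: HAs.
set y := INR n / INR m.
have Hy : 1 <= y.
  apply: (Rmult_le_reg_r (INR m)) => //. rewrite /y /Rdiv Rmult_assoc Rinv_l; last lra. have := le_INR _ _ Hnm; lra.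
(* The powers of [n] from the constant vector and from the sum of squares combine to [/ n] exactly,
   so [r] and [s] survive only in [D]. *)
have Hkey : rho ^ 2 / S2 = / (D * INR n).
  have E : Rpower (INR n) (1 - 2 / r) * Rpower (INR n) (/ r) ^ 2 = INR n.
    rewrite pow2_Rpower // Rpower_mult -Rpower_plus. have -> : 1 - 2 / r + / r * 2 = 1 by field; lra. exact: Rpower_1.
  rewrite /rho /S2 /D -[X in _ = / (_ * X)]E. field. have := Rpower_pos (INR n) (1 - 2 / r). split; last split; lra.
have Hcnt := tetra_count_lower n m Hnm Hm. rewrite -/y in Hcnt.
have Hym : 0 < y ^ m by apply: pow_lt; lra.
have H2y k : (1 + y) ^ k <= 2 ^ k * y ^ k by rewrite -Rpow_mult_distr; apply: pow_incr; lra.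
have Hrm : 0 < rho ^ m by apply: pow_lt.
have HC2m : (C' ^ m) ^ 2 = (C' ^ 2) ^ m by rewrite -!pow_mult Nat.mul_comm.
have HCC : C' <= C' ^ 2 by rewrite /=; nra.
split.
- apply: (Rbar_mult_ge _ (sqrt ((1 + y) ^ (m - 1)) / C' ^ m)) => //; last first.
    rewrite INR_pred_half // Rpower_half_sqrt; last lra. right; field; lra.
  apply: chi_mon_ge => K HK HKc.
  have H := tetra_count_le_chi r s n m J K S2 rho Hr Hs HJ Hm Hn HT HS2 Hrho HSz Hrho1 HK HKc.
  apply: (Rmult_le_reg_r (C' ^ m)) => //. rewrite /Rdiv Rmult_assoc Rinv_l; last lra. rewrite Rmult_1_r.
  apply: sqrt_le_of_sq; first by apply: Rmult_le_pos; lra.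
  have H1 : (y ^ m * rho ^ m) ^ 2 <= K ^ 2 * (192 * exp 2 * (2 * exp 1) ^ m * INR n * (exp 1 * S2 / INR m) ^ m).
    apply: Rle_trans H. apply: pow_incr. split; first nra. apply: Rmult_le_compat_r; lra.
  set q := / (2 * exp 1) * (/ (exp 1 * S2 / INR m)).
  have Hq0 : 0 < exp 1 * S2 / INR m by apply: Rdiv_lt_0_compat => //; nra.
  have Hq : 0 < q by apply: Rmult_lt_0_compat; apply: Rinv_0_lt_compat; lra.
  have H2 : (y ^ 2 * rho ^ 2 * q) ^ m <= K ^ 2 * (192 * exp 2 * INR n).
    have Hqm : 0 <= q ^ m by apply: pow_le; lra.
    have := Rmult_le_compat_r _ _ _ Hqm H1.
    have -> : (y ^ m * rho ^ m) ^ 2 * q ^ m = (y ^ 2 * rho ^ 2 * q) ^ m.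
      rewrite -Rpow_mult_distr -pow_mult (Nat.mul_comm m 2) pow_mult -Rpow_mult_distr; congr pow; ring.
    have -> : K ^ 2 * (192 * exp 2 * (2 * exp 1) ^ m * INR n * (exp 1 * S2 / INR m) ^ m) * q ^ m =
      K ^ 2 * (192 * exp 2 * INR n) * (2 * exp 1 * (exp 1 * S2 / INR m) * q) ^ m.
      rewrite (Rpow_mult_distr (2 * exp 1 * _)) (Rpow_mult_distr (2 * exp 1) (exp 1 * S2 / INR m)); ring.
    have -> : 2 * exp 1 * (exp 1 * S2 / INR m) * q = 1 by rewrite /q; field; split; lra.
    rewrite pow1 Rmult_1_r //.
  have He11 : exp 1 * exp 1 = exp 2 by rewrite -exp_plus; congr exp; ring.
  have E : y ^ 2 * rho ^ 2 * q = y * / (2 * exp 2 * D).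
    have -> : y ^ 2 * rho ^ 2 * q = y ^ 2 * INR m * / (2 * (exp 1 * exp 1)) * (rho ^ 2 / S2) by rewrite /q; field; split; lra.
    rewrite Hkey He11 /y. field. split; last split; lra.
  rewrite E in H2.
  have Hnm' : INR n = y * INR m by rewrite /y; field; lra.
  have Hm2 : INR m <= 2 ^ m.
    clear. elim: m => [|m IH]; first by rewrite /=; lra. rewrite S_INR -tech_pow_Rmult.
    have : 1 <= 2 ^ m by apply: pow_R1_Rle; lra. lra.
  have H192 : 192 * exp 2 <= (192 * exp 2) ^ m.
    rewrite -{1}(pow_1 (192 * exp 2)). apply: Rle_pow => //. have := one_plus_le_exp 2; lra.
  have Hy1 : y ^ m = y * y ^ (m - 1) by rewrite tech_pow_Rmult; congr pow; lia.
  have Hy0 : 0 < y ^ (m - 1) by apply: pow_lt; lra.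
  (* The factor [n = y * m] in the norm of the test polynomial cancels one of the [m] powers of [y],
     whence the exponent [m - 1]. *)
  have H3 : y ^ (m - 1) <= K ^ 2 * (192 * exp 2 * INR m) * (2 * exp 2 * D) ^ m.
    apply: (Rmult_le_reg_l y); first lra. rewrite -Hy1.
    have HD2 : 0 < 2 * exp 2 * D by nra.
    have -> : y ^ m = (y * / (2 * exp 2 * D)) ^ m * (2 * exp 2 * D) ^ m.
      rewrite -Rpow_mult_distr; congr pow; field; split; lra.
    have := Rmult_le_compat_r _ _ _ (Rlt_le _ _ (pow_lt _ m HD2)) H2. rewrite Hnm'. lra.
  have HK2 := pow2_ge_0 K.
  apply: Rle_trans (H2y (m - 1)%nat) _.
  apply: (Rle_trans _ (2 ^ m * (K ^ 2 * ((192 * exp 2) ^ m * 2 ^ m) * (2 * exp 2 * D) ^ m))).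
  + apply: Rmult_le_compat; [apply: pow_le; lra|lra|apply: Rle_pow; [lra|lia]|].
    apply: Rle_trans H3 _. apply: Rmult_le_compat_r; first by apply: pow_le; nra.
    apply: Rmult_le_compat_l => //. apply: Rmult_le_compat; lra.
  + rewrite (Rpow_mult_distr K) HC2m.
    have -> : 2 ^ m * (K ^ 2 * ((192 * exp 2) ^ m * 2 ^ m) * (2 * exp 2 * D) ^ m) = K ^ 2 * (1536 * (exp 4 * D)) ^ m.
      rewrite -He22. have -> : 1536 * (exp 2 * exp 2 * D) = 2 * (192 * exp 2) * 2 * (2 * exp 2 * D) by ring.
      rewrite (Rpow_mult_distr (2 * (192 * exp 2) * 2)) (Rpow_mult_distr (2 * (192 * exp 2))) (Rpow_mult_distr 2 (192 * exp 2)). ring.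
    apply: Rmult_le_compat_l => //. apply: pow_incr. split; first lra. rewrite /C' in HCC *; lra.
- apply: (Rbar_mult_ge _ (sqrt ((1 + y) ^ m) / C' ^ m)) => //; last first.
    rewrite Rpower_half_sqrt; last lra. right; field; lra.
  apply: (proj_const_ge r s n m J _ Hs) => // Q k HQ Hk HQk.
  pose t := sqrt (INR m / S2).
  have Ht2 : t ^ 2 = INR m / S2 by apply: pow2_sqrt; apply/Rlt_le/Rdiv_lt_0_compat.
  have Ht0 : 0 <= t by exact: sqrt_pos.
  have H := riesz_lower r s n m J Hs HJ Hm Q k HQ HQk HT S2 rho t HSz Hrho Hrho1 Ht0.
  have Het : exp (2 * t ^ 2 * S2) = exp 2 ^ m by rewrite Ht2 exp_pow; congr exp; field; lra.
  rewrite Het in H.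
  apply: (Rmult_le_reg_r (C' ^ m)) => //. rewrite /Rdiv Rmult_assoc Rinv_l; last lra. rewrite Rmult_1_r.
  apply: sqrt_le_of_sq; first by apply: Rmult_le_pos; lra.
  have H1 : (y ^ m * (t * rho) ^ m) ^ 2 <= (k * exp 2 ^ m) ^ 2.
    have Htr : 0 <= (t * rho) ^ m by apply: pow_le; nra.
    apply: pow_incr; split; first nra. apply: Rle_trans H. apply: Rmult_le_compat_r; lra.
  have Htr2 : (t * rho) ^ 2 = / (D * y).
    rewrite Rpow_mult_distr Ht2. have -> : INR m / S2 * rho ^ 2 = INR m * (rho ^ 2 / S2) by field; lra.
    rewrite Hkey /y; field; split; last split; lra.
  have E : (y ^ m * (t * rho) ^ m) ^ 2 = (y * / D) ^ m.
    rewrite -Rpow_mult_distr -pow_mult Nat.mul_comm pow_mult. congr pow.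
    rewrite Rpow_mult_distr Htr2. field; split; lra.
  have E2 : (k * exp 2 ^ m) ^ 2 = k ^ 2 * exp 4 ^ m.
    rewrite Rpow_mult_distr -pow_mult Nat.mul_comm pow_mult. congr (_ * _ ^ _). rewrite -He22; ring.
  rewrite E E2 in H1.
  have H2 : y ^ m <= k ^ 2 * (exp 4 * D) ^ m.
    have -> : y ^ m = (y * / D) ^ m * D ^ m by rewrite -Rpow_mult_distr; congr pow; field; lra.
    have HDm := pow_lt D m HD. rewrite (Rpow_mult_distr (exp 4)). have := Rmult_le_compat_r _ _ _ (Rlt_le _ _ HDm) H1. lra.
  apply: Rle_trans (H2y m) _.
  apply: (Rle_trans _ (2 ^ m * (k ^ 2 * (exp 4 * D) ^ m))).
    apply: Rmult_le_compat_l => //. apply: pow_le; lra.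
  rewrite (Rpow_mult_distr k) HC2m.
  have -> : 2 ^ m * (k ^ 2 * (exp 4 * D) ^ m) = k ^ 2 * (2 * (exp 4 * D)) ^ m by rewrite (Rpow_mult_distr 2); ring.
  apply: Rmult_le_compat_l; first exact: pow2_ge_0. apply: pow_incr. split; first lra. rewrite /C' in HCC *; lra.
Qed.

Theorem theorem3p5 (r : R) (s : Rbar) (Hr : 2 <= r) (Hs : Rbar_le (Finite 1) s) :
  (exists C : R, 0 < C /\
     forall J : nat -> multi_index -> Prop,
       (forall m, index_set (J m) /\ deg_le (J m) m) ->
       forall n m : nat, (1 <= m)%nat ->
         Rbar_le (chi_mon r s n m (J m))
           (Finite (C ^ m * Rpower (1 + INR n / INR m) ((INR m - 1) / 2))) /\
         Rbar_le (proj_const r s n m (J m))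
           (Finite (C ^ m * Rpower (1 + INR n / INR m) (INR m / 2)))) /\
  ((2 < r \/ (r = 2 /\ Rbar_le s (Finite 2))) ->
   exists C' : R, 0 < C' /\
     forall J : nat -> multi_index -> Prop,
       (forall m, index_set (J m) /\ deg_le (J m) m) ->
       forall n m : nat, (1 <= m)%nat ->
         (forall a, LambdaT m a -> J m a) ->
         (exists a, J m a /\ forall i, (n <= i)%nat -> a i = 0%nat) ->
         Rbar_le (Finite (Rpower (1 + INR n / INR m) ((INR m - 1) / 2)))
           (Rbar_mult (Finite (C' ^ m)) (chi_mon r s n m (J m))) /\
         Rbar_le (Finite (Rpower (1 + INR n / INR m) (INR m / 2)))
           (Rbar_mult (Finite (C' ^ m)) (proj_const r s n m (J m)))).
Proof.
split.
- exists (16 * exp 1); split; first by have := exp_pos 1; lra.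
  move=> J HJ n m Hm. apply: upper_bounds => //. by case: (HJ m).
- move=> Hcase. have [C' [HC' H]] := lower_bounds r s Hr Hs Hcase. exists C'; split=> //.
  move=> J HJ n m Hm HT Hex. apply: H => //. by case: (HJ m).
Qed.
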